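(* Let $k$ be an uncountable algebraically closed field of characteristic $0$, and let $V$ be a universal biquadratic space over $k$ of length two. Then: (a) The group $\mathrm{Aut}(V)$ is linearly oligomorphic (with respect to its action on $V$). (b) The space $V$ is linearly $\omega$-categorical.
   Context: All vector spaces are over $k$ and have dimension at most $\aleph_0$. A biquadratic space $(V,\omega,\omega')$ is a vector space with two symmetric bilinear forms. An embedding is an injective linear map respecting both forms; an isomorphism is a bijective embedding; $\mathrm{Aut}(V)$ is the group of self-isomorphisms. $V$ is universal if every finite dimensional biquadratic space embeds into it. The length of $V$ is its length as a representation of $\mathrm{Aut}(V)$. A representation $V$ of a group $G$ is linearly oligomorphic if for every $d\ge 0$ there is a finite dimensional subspace $E\subset V$ such that for every $d$-dimensional subspace $W\subset V$ there is $g\in G$ with $gW\subset E$. First-order language of biquadratic spaces: there are two sorts of variables, scalars and vectors; binary function symbols for addition and multiplication of scalars and a constant scalar symbol for each element of $k$; function symbols for addition of vectors and for scalar multiplication, and a constant vector symbol $0$; and two function symbols $\omega,\omega'$, each taking two vectors to a scalar. A biquadratic space is a structure for this language (with scalar sort $k$), and $\mathrm{Th}(V)$ denotes the set of all sentences true in $V$. $V$ is linearly $\omega$-categorical if every biquadratic space $W$ over $k$ (of dimension at most $\aleph_0$) with $\mathrm{Th}(W)=\mathrm{Th}(V)$ is isomorphic to $V$. *)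

(* Defs.v *)
From HB Require Import structures.
From mathcomp Require Import all_boot all_order all_algebra.
From mathcomp Require Import boolp classical_sets functions cardinality.

Set Implicit Arguments.
Unset Strict Implicit.
Unset Printing Implicit Defensive.

Import GRing.Theory.
Local Open Scope classical_set_scope.
Local Open Scope ring_scope.

Section Dimension.
Variables (k : fieldType) (V : lmodType k).

Definition is_subspace (S : set V) : Prop := submod_closed [in S].

Definition lin_independent (I : eqType) (b : I -> V) : Prop :=
  forall (s : seq I) (c : I -> k), uniq s ->
    \sum_(i <- s) c i *: b i = 0 -> {in s, forall i, c i = 0}.

Definition spans (S : set V) (I : eqType) (b : I -> V) : Prop :=
  forall v, S v -> exists (s : seq I) (c : I -> k),
    v = \sum_(i <- s) c i *: b i.

Definition is_basis (S : set V) (I : eqType) (b : I -> V) : Prop :=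
  [/\ forall i, S (b i), lin_independent b & spans S b].

Definition is_subspace_of_dim (d : nat) (S : set V) : Prop :=
  is_subspace S /\ exists b : 'I_d -> V, is_basis S b.

Definition finite_dim_subspace (S : set V) : Prop :=
  exists d, is_subspace_of_dim d S.

Definition countable_dim : Prop :=
  exists (I : countType) (b : I -> V), is_basis [set: V] b.

End Dimension.

Section Representations.
Variable k : fieldType.

Record representation (G : groupType) (V : lmodType k) := Representation {
  rep_act :> G -> V -> V;
  rep_linear : forall g, linear (rep_act g);
  rep_1 : rep_act 1%g =1 id;
  rep_M : forall g h, rep_act (g * h)%g =1 rep_act g \o rep_act h
}.

Variables (G : groupType) (V : lmodType k) (rho : representation G V).

Definition is_subrep (S : set V) : Prop :=
  is_subspace S /\ forall g, rho g @` S `<=` S.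

(* The last clause says that the quotient F i.+1 / F i is irreducible. *)
Definition is_composition_series (n : nat) (F : nat -> set V) : Prop :=
  [/\ F 0%N = [set 0], F n = [set: V],
      forall i, (i <= n)%N -> is_subrep (F i) &
      forall i, (i < n)%N -> F i `<` F i.+1 /\
        forall S, is_subrep S -> F i `<=` S -> S `<=` F i.+1 ->
          S = F i \/ S = F i.+1].

Definition has_length (n : nat) : Prop := exists F, is_composition_series n F.

Definition linearly_oligomorphic : Prop :=
  forall d : nat, exists2 E : set V, finite_dim_subspace E &
    forall W : set V, is_subspace_of_dim d W -> exists g, rho g @` W `<=` E.

End Representations.

Record biquadratic (k : fieldType) := Biquadratic {
  bq_space :> lmodType k;
  bq_omega : {symmetric bq_space};
  bq_omega' : {symmetric bq_space};
  bq_countable_dim : countable_dim bq_space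
}.

Section Morphisms.
Variable k : fieldType.
Implicit Types U V W : biquadratic k.

Definition is_embedding V W (f : V -> W) : Prop :=
  [/\ linear f, injective f,
      forall u v, bq_omega W (f u) (f v) = bq_omega V u v &
      forall u v, bq_omega' W (f u) (f v) = bq_omega' V u v].

Definition is_isomorphism V W (f : V -> W) : Prop :=
  is_embedding f /\ bijective f.

Definition isomorphic V W : Prop := exists f : V -> W, is_isomorphism f.

Definition universal V : Prop :=
  forall U, finite_dim_subspace [set: U] -> exists f : U -> V, is_embedding f.

Definition bq_aut V : Type := {f : V -> V | is_isomorphism f}.

Lemma is_isomorphism_id V : is_isomorphism (@id V).
Proof. by split; [split | exists id]. Qed.

Lemma is_isomorphism_comp U V W (g : V -> W) (f : U -> V) :
  is_isomorphism g -> is_isomorphism f -> is_isomorphism (g \o f).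
Proof.
move=> [[gl gi g1 g2] gb] [[fl fi f1 f2] fb]; split; last exact: bij_comp.
split; first by move=> a u v /=; rewrite fl gl.
- exact: inj_comp.
- by move=> u v /=; rewrite g1 f1.
- by move=> u v /=; rewrite g2 f2.
Qed.

Lemma is_isomorphism_inv V W (f : V -> W) (g : W -> V) :
  is_isomorphism f -> cancel f g -> cancel g f -> is_isomorphism g.
Proof.
move=> [[fl fi f1 f2] fb] fK gK; split; last by exists f.
split; first by move=> a u v; apply: fi; rewrite gK fl !gK.
- exact: can_inj gK.
- by move=> u v; rewrite -f1 !gK.
- by move=> u v; rewrite -f2 !gK.
Qed.

Lemma is_isomorphism_invP V (f : bq_aut V) :
  exists g : V -> V, [/\ is_isomorphism g, cancel (sval f) g & cancel g (sval f)].
Proof.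
case: f => f fP /=; case: (fP) => _ [g fK gK].
by exists g; split=> //; exact: is_isomorphism_inv gK.
Qed.

Definition bq_aut_one V : bq_aut V := exist _ id (is_isomorphism_id V).

Definition bq_aut_mul V (g f : bq_aut V) : bq_aut V :=
  exist _ (sval g \o sval f) (is_isomorphism_comp (svalP g) (svalP f)).

Definition bq_aut_inv V (f : bq_aut V) : bq_aut V :=
  let: exist g gP := cid (is_isomorphism_invP f) in
  let: And3 giso _ _ := gP in exist _ g giso.

Lemma bq_aut_eq V (f g : bq_aut V) : sval f =1 sval g -> f = g.
Proof.
case: f g => [f fP] [g gP] /= /funext fg.
by rewrite fg in fP *; congr exist; exact: Prop_irrelevance.
Qed.

Lemma bq_aut_mulA V : associative (@bq_aut_mul V).
Proof. by move=> f g h; exact: bq_aut_eq. Qed.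

Lemma bq_aut_mul1 V : left_id (bq_aut_one V) (@bq_aut_mul V).
Proof. by move=> f; exact: bq_aut_eq. Qed.

Lemma bq_aut_mulr1 V : right_id (bq_aut_one V) (@bq_aut_mul V).
Proof. by move=> f; exact: bq_aut_eq. Qed.

Lemma bq_aut_mulV V : left_inverse (bq_aut_one V) (@bq_aut_inv V) (@bq_aut_mul V).
Proof.
move=> f; apply: bq_aut_eq => v; rewrite /bq_aut_inv /=.
by case: cid => g [giso fK gK] /=; exact: fK.
Qed.

Lemma bq_aut_mulrV V :
  right_inverse (bq_aut_one V) (@bq_aut_inv V) (@bq_aut_mul V).
Proof.
move=> f; apply: bq_aut_eq => v; rewrite /bq_aut_inv /=.
by case: cid => g [giso fK gK] /=; exact: gK.
Qed.

HB.instance Definition _ V := gen_eqMixin (bq_aut V).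
HB.instance Definition _ V := gen_choiceMixin (bq_aut V).
HB.instance Definition _ V := isGroup.Build (bq_aut V)
  (@bq_aut_mulA V) (@bq_aut_mul1 V) (@bq_aut_mulr1 V)
  (@bq_aut_mulV V) (@bq_aut_mulrV V).

Lemma bq_aut_linear V (g : bq_aut V) : linear (sval g).
Proof. by case: (svalP g) => -[]. Qed.

Definition aut_rep V : representation (bq_aut V) V :=
  @Representation k (bq_aut V) V (fun g => sval g) (@bq_aut_linear V)
    (fun v => erefl) (fun g h v => erefl).

End Morphisms.

Section Language.
Variable k : fieldType.

(* Variables of both sorts are named by natural numbers. *)
Inductive sterm : Type :=
| SVar of nat
| SConst of k
| SAdd of sterm & sterm
| SMul of sterm & sterm
| SOmega of vterm & vterm
| SOmega' of vterm & vterm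
with vterm : Type :=
| VVar of nat
| VZero
| VAdd of vterm & vterm
| VScale of sterm & vterm.

Inductive formula : Type :=
| FSEq of sterm & sterm
| FVEq of vterm & vterm
| FFalse
| FNot of formula
| FAnd of formula & formula
| FOr of formula & formula
| FImp of formula & formula
| FSForall of nat & formula
| FSExists of nat & formula
| FVForall of nat & formula
| FVExists of nat & formula.

(* [fv_* s x]: the variable numbered x occurs free; s selects its sort, true
   for scalar variables and false for vector variables. *)
Fixpoint fv_sterm (s : bool) (x : nat) (t : sterm) : bool :=
  match t with
  | SVar y => s && (x == y)
  | SConst _ => false
  | SAdd t1 t2 | SMul t1 t2 => fv_sterm s x t1 || fv_sterm s x t2
  | SOmega t1 t2 | SOmega' t1 t2 => fv_vterm s x t1 || fv_vterm s x t2
  end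
with fv_vterm (s : bool) (x : nat) (t : vterm) : bool :=
  match t with
  | VVar y => ~~ s && (x == y)
  | VZero => false
  | VAdd t1 t2 => fv_vterm s x t1 || fv_vterm s x t2
  | VScale t1 t2 => fv_sterm s x t1 || fv_vterm s x t2
  end.

Fixpoint fv_formula (s : bool) (x : nat) (p : formula) : bool :=
  match p with
  | FSEq t1 t2 => fv_sterm s x t1 || fv_sterm s x t2
  | FVEq t1 t2 => fv_vterm s x t1 || fv_vterm s x t2
  | FFalse => false
  | FNot p1 => fv_formula s x p1
  | FAnd p1 p2 | FOr p1 p2 | FImp p1 p2 => fv_formula s x p1 || fv_formula s x p2
  | FSForall y p1 | FSExists y p1 => ~~ (s && (x == y)) && fv_formula s x p1
  | FVForall y p1 | FVExists y p1 => ~~ (~~ s && (x == y)) && fv_formula s x p1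
  end.

Definition is_sentence (p : formula) : Prop := forall s x, ~~ fv_formula s x p.

Variable V : biquadratic k.

Fixpoint seval (es : nat -> k) (ev : nat -> V) (t : sterm) : k :=
  match t with
  | SVar x => es x
  | SConst a => a
  | SAdd t1 t2 => seval es ev t1 + seval es ev t2
  | SMul t1 t2 => seval es ev t1 * seval es ev t2
  | SOmega t1 t2 => bq_omega V (veval es ev t1) (veval es ev t2)
  | SOmega' t1 t2 => bq_omega' V (veval es ev t1) (veval es ev t2)
  end
with veval (es : nat -> k) (ev : nat -> V) (t : vterm) : V :=
  match t with
  | VVar x => ev x
  | VZero => 0
  | VAdd t1 t2 => veval es ev t1 + veval es ev t2
  | VScale t1 t2 => seval es ev t1 *: veval es ev t2
  end.

Fixpoint holds (es : nat -> k) (ev : nat -> V) (p : formula) : Prop :=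
  match p with
  | FSEq t1 t2 => seval es ev t1 = seval es ev t2
  | FVEq t1 t2 => veval es ev t1 = veval es ev t2
  | FFalse => False
  | FNot p1 => ~ holds es ev p1
  | FAnd p1 p2 => holds es ev p1 /\ holds es ev p2
  | FOr p1 p2 => holds es ev p1 \/ holds es ev p2
  | FImp p1 p2 => holds es ev p1 -> holds es ev p2
  | FSForall x p1 => forall a : k, holds [eta es with x |-> a] ev p1
  | FSExists x p1 => exists a : k, holds [eta es with x |-> a] ev p1
  | FVForall x p1 => forall v : V, holds es [eta ev with x |-> v] p1
  | FVExists x p1 => exists v : V, holds es [eta ev with x |-> v] p1
  end.

(* The truth value of a sentence does not depend on the assignment. *)
Definition Th : set formula :=
  [set p | is_sentence p /\ forall es ev, holds es ev p].

End Language.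

Definition linearly_omega_categorical (k : fieldType) (V : biquadratic k) : Prop :=
  forall W : biquadratic k, Th W = Th V -> isomorphic W V.

(* Main.v *)
From HB Require Import structures.
Require Import Defs.
From mathcomp Require Import all_boot all_order all_algebra.
From mathcomp Require Import ring.
From mathcomp Require Import boolp classical_sets functions cardinality.

Set Implicit Arguments.
Unset Strict Implicit.
Unset Printing Implicit Defensive.

Import GRing.Theory.
Local Open Scope classical_set_scope.
Local Open Scope ring_scope.

(** A subspace of V is called stable if it is invariant under G = Aut(V).  Length two gives a
    nonzero proper stable subspace, and makes every such subspace both minimal and maximal
    ([has_length_twoP]).  As k is uncountable and algebraically closed while V has countable
    dimension, irreducible stable subspaces satisfy Schur's lemma: if an endomorphism phi had no
    eigenvalue, the vectors (phi - a)^-1 v for a in k would form an uncountable independent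
    family ([schur_zero], [schur_stable], [schur_forms]).

    Apply this to the stable relation consisting of the pairs (x, y) with
    omega(x, .) = omega'(y, .).  Either the relation reduces to the radical of V and the forms
    are generic modulo the radical; or some member p of the pencil of forms has a kernel S, and
    then the position of S relative to its orthogonal for a second member p' leaves an orthogonal
    sum, a flag S in V, or a free module over k[T]/(T^2) on which p is p' twisted by T; or no
    member of the pencil is degenerate, and V is the sum of two copies of a space S carrying at
    most four generic forms ([classification]).

    All these spaces are generic in the same sense.  Finitely many vectors that are independent
    modulo obvious subspaces impose independent linear conditions, so there is a new vector having
    prescribed products with them and, since k is algebraically closed of characteristic not two,
    prescribed norms ([extends_all]).  A back-and-forth argument then shows that a space is
    determined by its type, and that families with the same Gram matrix are conjugate under G
    ([carrier_iso]).  A fixed finite dimensional subspace realizes all Gram matrices of a given size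
    ([gram_box]), which proves (a) ([carrier_oligomorphic]).

    For (b), the types are described by sentences in which scalars of k occur as constants, together
    with one sentence or one scheme for the dimension of a possible summand.  A space W with the
    same theory as V is therefore of the same type ([first_order_transfer]), hence isomorphic to V.
    Universality is used through orthonormal systems of every size, whose existence is first order
    as well. *)

(** * Subspaces, spans of lists, dual families *)

Lemma left_kernel_tall (k : fieldType) m n (M : 'M[k]_(m, n)) : (n < m)%N ->
  exists2 u : 'rV_m, u != 0 & u *m M = 0.
Proof.
move=> nm; have /rowV0Pn[u /sub_kermxP uM u0] : kermx M != 0; last by exists u.
rewrite kermx_eq0 /row_free; apply: contraTN nm => /eqP <-.
by rewrite -leqNgt rank_leq_col.
Qed.

Section LinearAlgebra.
Variables (k : fieldType) (V : lmodType k).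
Implicit Types (S X N : set V) (r s : seq V).

Definition subsp S : Prop :=
  S 0 /\ forall a u v, S u -> S v -> S (a *: u + v).

Lemma subspP S : is_subspace S <-> subsp S.
Proof.
split=> -[S0 SD].
  split=> [|a u v Su Sv]; first by move: S0; rewrite inE.
  by have := SD a u v; rewrite !inE; apply.
by split=> [|a u v]; rewrite !inE => *; [exact: S0 | exact: SD].
Qed.

Lemma subspZ S a u : subsp S -> S u -> S (a *: u).
Proof. by move=> [S0 SD] Su; rewrite -[_ *: _]addr0; exact: SD. Qed.

Lemma subspD S u v : subsp S -> S u -> S v -> S (u + v).
Proof. by move=> [S0 SD] Su Sv; rewrite -[u]scale1r; exact: SD. Qed.

Lemma subspN S u : subsp S -> S u -> S (- u).
Proof. by move=> sS Su; rewrite -scaleN1r; exact: subspZ. Qed.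

Lemma subspB S u v : subsp S -> S u -> S v -> S (u - v).
Proof. by move=> sS Su Sv; apply: subspD => //; exact: subspN. Qed.

Lemma subspBl S u v : subsp S -> S (u - v) -> S v -> S u.
Proof. by move=> sS Suv Sv; rewrite -(subrK v u); exact: subspD. Qed.

Lemma subsp_sum S (I : Type) (r : seq I) (P : pred I) (f : I -> V) :
  subsp S -> (forall i, P i -> S (f i)) -> S (\sum_(i <- r | P i) f i).
Proof.
move=> sS Sf; elim/big_ind : _ => //; first by case: sS.
by move=> *; exact: subspD.
Qed.

Lemma subsp_lcomb S (I : eqType) (r : seq I) (P : pred I) (c : I -> k) (f : I -> V) :
  subsp S -> (forall i, i \in r -> P i -> S (f i)) ->
  S (\sum_(i <- r | P i) c i *: f i).
Proof.
move=> sS Sf; rewrite big_seq_cond; apply: subsp_sum => // i /andP[ir Pi].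
by apply: subspZ => //; exact: Sf.
Qed.

Lemma subsp0 : subsp [set 0].
Proof. by split=> //= a u v -> ->; rewrite scaler0 addr0. Qed.

Lemma subspT : subsp setT. Proof. by []. Qed.

(** The span of a list of pairs in V * W is a linear relation between V and W; the recursive
    form makes adding one pair to such a relation a matter of computation. *)
Fixpoint lspan s : set V :=
  if s is x :: s' then [set v | exists a, lspan s' (v - a *: x)] else [set 0].

Lemma lspan_subsp s : subsp (lspan s).
Proof.
elim: s => [|x s [IH0 IH]]; first exact: subsp0.
split=> /= [|a u v [b ub] [c vc]]; first by exists 0; rewrite scale0r subr0.
exists (a * b + c); have := IH a _ _ ub vc.
by rewrite scalerBr scalerDl scalerA opprD addrACA.
Qed.

Lemma lspan_min s S : subsp S -> (forall x, x \in s -> S x) -> lspan s `<=` S.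
Proof.
move=> sS; elim: s => [|x s IH] Ss v /=; first by move=> ->; case: sS.
move=> [a /IH Sv]; rewrite -(subrK (a *: x) v); apply: subspD => //.
  by apply: Sv => y ys; apply: Ss; rewrite inE ys orbT.
by apply: subspZ => //; apply: Ss; rewrite mem_head.
Qed.

Lemma lspan_mem s x : x \in s -> lspan s x.
Proof.
elim: s => // y s IH; rewrite inE => /predU1P[->|/IH xs] /=.
  by exists 1; rewrite scale1r subrr; case: (lspan_subsp s).
by exists 0; rewrite scale0r subr0.
Qed.

Lemma lspan_sub s s' : {subset s <= s'} -> lspan s `<=` lspan s'.
Proof.
move=> ss'; apply: lspan_min; first exact: lspan_subsp.
by move=> x /ss'; exact: lspan_mem.
Qed.

Lemma lspan_cat s s' v :
  lspan (s ++ s') v <-> exists2 u, lspan s u & lspan s' (v - u).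
Proof.
split.
  apply: (@lspan_min _ [set v | exists2 u, lspan s u & lspan s' (v - u)]).
    split=> /= [|a u v' [x xs xs'] [y ys ys']].
      by exists 0; [case: (lspan_subsp s) | rewrite subr0; case: (lspan_subsp s')].
    exists (a *: x + y); first by apply: (lspan_subsp s).2.
    have := (lspan_subsp s').2 a _ _ xs' ys'.
    by rewrite scalerBr opprD addrACA.
  move=> x; rewrite mem_cat => /orP[] xs /=.
    by exists x; [exact: lspan_mem | rewrite subrr; case: (lspan_subsp s')].
  by exists 0; [case: (lspan_subsp s) | rewrite subr0; exact: lspan_mem].
move=> [u us vs]; apply: (subspBl (lspan_subsp _) (v := u)).
  by apply: lspan_sub vs => x xs; rewrite mem_cat xs orbT.
by apply: lspan_sub us => x xs; rewrite mem_cat xs.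
Qed.

Lemma lspan_mapP (I : eqType) (t : seq I) (f : I -> V) v : uniq t ->
  lspan (map f t) v <-> exists c : I -> k, v = \sum_(i <- t) c i *: f i.
Proof.
move=> ut; split; last first.
  move=> [c ->]; apply: subsp_lcomb => [|i it _]; first exact: lspan_subsp.
  by apply: lspan_mem; exact: map_f.
elim: t v ut => [|i t IH] v /=; first by move=> _ ->; exists (fun=> 0); rewrite big_nil.
move=> /andP[it ut] [a /(IH _ ut)[c vE]].
exists (fun j => if j == i then a else c j); rewrite big_cons eqxx.
rewrite -[LHS](subrK (a *: f i)) vE addrC; congr (_ + _).
by apply: eq_big_seq => j jt; case: eqP jt it => // -> ->.
Qed.

Lemma lspan_coord r v : lspan r v -> exists c : 'I_(size r) -> k,
  v = \sum_i c i *: r`_i.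
Proof.
rewrite -{1}(mkseq_nth 0 r) => /(lspan_mapP _ _ (iota_uniq _ _))[c ->].
exists (fun i => c (val i)).
by rewrite -[X in iota 0 X]subn0 -/(index_iota 0 (size r)) big_mkord.
Qed.

Lemma lspan_dep n (x : 'I_n -> V) r : (size r < n)%N -> (forall i, lspan r (x i)) ->
  exists2 c : 'I_n -> k, exists i, c i != 0 & \sum_i c i *: x i = 0.
Proof.
move=> rn xr; have /choice[C CE] := fun i => lspan_coord (xr i).
pose M := \matrix_(i < n, j < size r) C i j.
have [u u0 uM] := left_kernel_tall M rn.
exists (u 0).
  by have /rV0Pn[i ui] := u0; exists i.
under eq_bigr do rewrite CE scaler_sumr.
rewrite exchange_big big1 //= => j _.
under eq_bigr do rewrite scalerA.
rewrite -scaler_suml.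
have /rowP/(_ j) := uM; rewrite !mxE.
by under eq_bigr do rewrite mxE; move=> ->; rewrite scale0r.
Qed.

(** X is infinite dimensional modulo N. *)
Definition infmod X N : Prop :=
  forall r, exists2 w, X w & forall n, N n -> ~ lspan r (w - n).

Definition lin1 (f : V -> k) : Prop := forall a u v, f (a *: u + v) = a * f u + f v.

Lemma lin1_0 f : lin1 f -> f 0 = 0.
Proof. by move=> /(_ (-1) 0 0); rewrite scaler0 addr0 mulN1r addNr. Qed.

Lemma lin1Z f a u : lin1 f -> f (a *: u) = a * f u.
Proof. by move=> fl; rewrite -[_ *: _]addr0 fl lin1_0 // addr0. Qed.

Lemma lin1D f u v : lin1 f -> f (u + v) = f u + f v.
Proof. by move=> fl; rewrite -[u]scale1r fl mul1r scale1r. Qed.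

Lemma lin1N f u : lin1 f -> f (- u) = - f u.
Proof. by move=> fl; rewrite -scaleN1r lin1Z // mulN1r. Qed.

Lemma lin1B f u v : lin1 f -> f (u - v) = f u - f v.
Proof. by move=> fl; rewrite lin1D // lin1N. Qed.

Lemma lin1_sum f (I : Type) (r : seq I) (P : pred I) (c : I -> k) (g : I -> V) :
  lin1 f -> f (\sum_(i <- r | P i) c i *: g i) = \sum_(i <- r | P i) c i * f (g i).
Proof.
move=> fl; elim/big_rec2 : _ => [|i y z _ <-]; first exact: lin1_0.
by rewrite fl.
Qed.

Lemma lin1_bigsum f (I : Type) (r : seq I) (P : pred I) (g : I -> V) :
  lin1 f -> f (\sum_(i <- r | P i) g i) = \sum_(i <- r | P i) f (g i).
Proof.
move=> fl; elim/big_rec2 : _ => [|i y z _ <-]; first exact: lin1_0.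
exact: lin1D.
Qed.

(** Each equation can be imposed in turn: a vector on which it fails, added to a finite set
    spanning its solutions modulo N, would span X modulo N. *)
Lemma infmod_ker X N (I : eqType) (L : seq I) (l : I -> V -> k) :
  subsp X -> (forall i, lin1 (l i)) -> infmod X N ->
  infmod [set x | X x /\ forall i, i \in L -> l i x = 0] N.
Proof.
move=> sX ll infX; elim: L => [|i L IH] r.
  by have [w Xw wN] := infX r; exists w.
case: (pselect (exists2 b, X b /\ (forall j, j \in L -> l j b = 0) & l i b != 0)).
  move=> [b [Xb bL] bi]; have [w [Xw wL] wN] := IH (b :: r).
  exists (w - (l i w / l i b) *: b).
    split=> [|j]; first by apply: subspB => //; exact: subspZ.
    rewrite inE => /predU1P[->|jL]; first by rewrite (lin1B _ _ (ll i)) (lin1Z _ _ (ll i)) divfK // subrr.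
    by rewrite (lin1B _ _ (ll j)) (lin1Z _ _ (ll j)) (wL _ jL) (bL _ jL) mulr0 subr0.
  move=> n Nn wr; apply: (wN n Nn); exists (l i w / l i b).
  by rewrite addrAC.
move=> nb; have [w [Xw wL] wN] := IH r; exists w => //; split=> // j.
rewrite inE => /predU1P[->|/wL //].
by apply/eqP; apply: contra_notT nb => wi; exists w.
Qed.

(** A further functional, corrected by its values on the dual vectors found so far, still does
    not vanish on X. *)
Lemma dual_family X (I : eqType) (r : seq I) (l : I -> V -> k) :
  subsp X -> uniq r -> (forall i, lin1 (l i)) ->
  (forall c : I -> k, (forall y, X y -> \sum_(i <- r) c i * l i y = 0) ->
     forall i, i \in r -> c i = 0) ->
  exists e : I -> V, forall i, i \in r ->
    X (e i) /\ forall j, j \in r -> l j (e i) = (j == i)%:R.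
Proof.
move=> sX ur ll; elim: r ur => [|i0 r IH] /=; first by exists (fun=> 0).
move=> /andP[i0r ur] ind; case: IH => // [c cr i ir|e eP].
  have ii0 : (i == i0) = false by apply: contraNF i0r => /eqP <-.
  have := ind (fun j => if j == i0 then 0 else c j); move=> /(_ _ i).
  rewrite inE ir orbT ii0; apply=> // y Xy.
  rewrite big_cons eqxx mul0r add0r -[RHS](cr y Xy); apply: eq_big_seq => j jr.
  by case: eqP jr i0r => // -> ->.
have [x Xx lx] : exists2 x, X x & l i0 x - \sum_(j <- r) l j x * l i0 (e j) != 0.
  apply: contrapT => nx.
  pose c j := if j == i0 then 1 else - l i0 (e j).
  have /ind/(_ i0 (mem_head _ _)) : forall y, X y -> \sum_(i <- i0 :: r) c i * l i y = 0.
    move=> y Xy; rewrite big_cons /c eqxx mul1r.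
    apply/eqP; apply: contrapT => /negP ny; apply: nx; exists y => //.
    apply: contraNN ny => /eqP E; apply/eqP; rewrite -[RHS]E -sumrN; congr (_ + _).
    apply: eq_big_seq => j jr; case: eqP jr i0r => [-> ->//|_ _ _].
    by rewrite mulNr mulrC.
  by rewrite /c eqxx => /eqP; rewrite oner_eq0.
pose x' := x - \sum_(j <- r) l j x *: e j.
have Xx' : X x'.
  by apply: subspB => //; apply: subsp_lcomb => // j jr _; case: (eP j jr).
have lx' j : j \in r -> l j x' = 0.
  move=> jr; rewrite (lin1B _ _ (ll j)) (lin1_sum _ _ _ _ (ll j)) (bigD1_seq j) //= big_seq_cond big1.
    by rewrite (eP j jr).2 // eqxx mulr1 addr0 subrr.
  by move=> m /andP[mr mj]; rewrite (eP m mr).2 // eq_sym (negbTE mj) mulr0.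
have li0 : l i0 x' != 0 by rewrite lin1B // lin1_sum.
pose e0 := (l i0 x')^-1 *: x'.
have le0 : l i0 e0 = 1 by rewrite lin1Z // mulVf.
have lje0 j : j \in r -> l j e0 = 0 by move=> jr; rewrite (lin1Z _ _ (ll j)) (lx' _ jr) mulr0.
have Xe0 : X e0 by exact: subspZ.
exists (fun j => if j == i0 then e0 else e j - l i0 (e j) *: e0) => i.
rewrite inE; case: eqP => [-> _|ii0 /= ir].
  split=> // j; rewrite inE; case: eqP => [-> _|_ /= jr] //.
  exact: lje0.
split=> [|j].
  by apply: subspB; [| exact: (eP i ir).1 | exact: subspZ].
rewrite inE; case: (j =P i0) => [-> _|ji0 /= jr].
  rewrite (lin1B _ _ (ll i0)) (lin1Z _ _ (ll i0)) le0 mulr1 subrr eq_sym.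
  by case: eqP.
by rewrite (lin1B _ _ (ll j)) (lin1Z _ _ (ll j)) (lje0 _ jr) mulr0 subr0 (eP i ir).2.
Qed.

(** Zorn's lemma is applied to sets of vectors whose span meets N trivially rather than to
    subspaces, so that the union of an empty chain qualifies. *)
Lemma complementP N : subsp N -> exists B, [/\ subsp B,
  forall v, exists2 b, B b & N (v - b) & forall b, B b -> N b -> b = 0].
Proof.
move=> sN.
pose P (A : set V) := forall s, (forall x, x \in s -> A x) -> forall v, lspan s v -> N v -> v = 0.
have [F FP Ftot|A [PA Amax]] := @Zorn_bigcup V P.
  move=> s sF v vs Nv.
  have [[A FA sA]|s0] : (exists2 A, F A & forall x, x \in s -> A x) \/ s = [::].
    elim: s sF {vs} => [|x s IH] sF; first by right.
    left; have [A FA Ax] : (\bigcup_(X in F) X) x by apply: sF; rewrite mem_head.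
    case: IH => [y ys|[B FB Bs]|s0].
    - by apply: sF; rewrite inE ys orbT.
    - case: (Ftot _ _ FA FB) => AB.
        exists B => // y; rewrite inE => /predU1P[->|/Bs//].
        exact: AB.
      exists A => // y; rewrite inE => /predU1P[->//|/Bs].
      exact: AB.
    - by exists A => // y; rewrite s0 inE => /eqP ->.
  - exact: (FP A FA s sA v vs Nv).
  - by move: vs; rewrite s0.
pose B := [set v | exists2 s, (forall x, x \in s -> A x) & lspan s v].
have sB : subsp B.
  split=> [|a u v [s sA su] [t tA tv]]; first by exists [::].
  exists (s ++ t).
    by move=> x; rewrite mem_cat => /orP[/sA|/tA].
  apply: (lspan_subsp _).2.
    by apply: lspan_sub su => x xs; rewrite mem_cat xs.
  by apply: lspan_sub tv => x xs; rewrite mem_cat xs orbT.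
exists B; split=> //; last by move=> b [s sA sb] Nb; exact: PA sA _ sb Nb.
move=> v; apply: contrapT => nv.
apply: (Amax (A `|` [set v])).
  split; first by move=> x Ax; left.
  move=> AvA; apply: nv; exists v; last by rewrite subrr; case: sN.
  exists [:: v]; last by apply: lspan_mem; rewrite mem_head.
  by move=> x; rewrite inE => /eqP ->; apply: AvA; right.
move=> s sAv u us Nu.
have [w [Bw [a uE]]] : exists w, B w /\ exists a, u = w + a *: v.
  apply: (lspan_min (S := [set u | exists w, B w /\ exists a, u = w + a *: v])) us.
    split=> /= [|a x y [w [Bw [b ->]]] [w' [Bw' [b' ->]]]].
      by exists 0; split; [case: sB | exists 0; rewrite scale0r addr0].
    exists (a *: w + w'); split; first exact: sB.2.
    exists (a * b + b'); rewrite scalerDr scalerDl scalerA.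
    by rewrite addrACA.
  move=> x /sAv[Ax|->] /=.
    exists x; split; last by exists 0; rewrite scale0r addr0.
    exists [:: x]; last by apply: lspan_mem; rewrite mem_head.
    by move=> y; rewrite inE => /eqP ->.
  by exists 0; split; [case: sB | exists 1; rewrite add0r scale1r].
have [a0|a0] := eqVneq a 0.
  move: uE; rewrite a0 scale0r addr0 => uw.
  by case: Bw => t tA; rewrite -uw => /PA -> .
case: nv; exists (- a^-1 *: w); first exact: subspZ.
have -> : v - - a^-1 *: w = a^-1 *: u.
  by rewrite uE scalerDr scalerA mulVf // scale1r scaleNr opprK addrC.
exact: subspZ.
Qed.

End LinearAlgebra.

(** * Schur's lemma in countable dimension *)

Lemma infinite_set_uniq (T : eqType) (A : set T) n : ~ finite_set A ->
  exists s : seq T, [/\ uniq s, size s = n & forall x, x \in s -> A x].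
Proof.
move=> infA; elim: n => [|n [s [us sn sA]]]; first by exists [::].
have [x Ax xs] : exists2 x, A x & x \notin s.
  apply: contrapT => nx; apply: infA; apply: sub_finite_set (finite_seq s).
  by move=> x Ax; apply: contrapT => /negP xs; apply: nx; exists x.
exists (x :: s); split=> /=; [by rewrite xs | by rewrite sn|].
by move=> y; rewrite inE => /predU1P[->|/sA].
Qed.

(** A space of countable dimension is a countable union of finite dimensional subspaces, each
    of which contains finitely many members of the family. *)
Lemma countable_independent (k : fieldType) (V : lmodType k) (J : eqType)
    (x : J -> V) : countable_dim V -> lin_independent x -> countable [set: J].
Proof.
move=> [I [b [_ _ bV]]] xind.
pose L n : seq I := pmap unpickle (iota 0 n).
have sL n : (size (map b (L n)) <= n)%N.
  by rewrite size_map size_pmap (leq_trans (count_size _ _)) // size_iota.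
have LV v : exists n, lspan (map b (L n)) v.
  have [s [c ->]] := bV v Logic.I.
  exists (\max_(i <- s) (pickle i).+1)%N; apply: subsp_lcomb; first exact: lspan_subsp.
  move=> i si _; apply/lspan_mem/map_f; rewrite mem_pmap.
  rewrite -[Some i](pickleK i); apply: map_f; rewrite mem_iota add0n.
  exact: (@leq_bigmax_seq _ _ _ (fun i => (pickle i).+1)).
have -> : [set: J] = \bigcup_n [set j | lspan (map b (L n)) (x j)].
  by apply/seteqP; split=> // j _; have [n xn] := LV (x j); exists n.
apply: bigcup_countable => // n _; apply: finite_set_countable.
apply: contrapT => /(infinite_set_uniq n.+1)[s [us sn sA]].
have [j0 _] : exists j0, j0 \in s by case: s sn {us sA} => // j0 s _; exists j0; rewrite mem_head.
have [||c [i ci] cx] := @lspan_dep k V n.+1 (fun i => x (nth j0 s i)) (map b (L n)).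
- by rewrite ltnS.
- by move=> i; apply: sA; rewrite mem_nth // sn.
case/eqP: ci.
have ins (l : 'I_n.+1) : index (nth j0 s l) s = l by rewrite index_uniq // sn.
have := xind s (fun j => c (inord (index j s))) us.
move=> /(_ _ (nth j0 s i)); rewrite ins inord_val; apply; last by rewrite mem_nth // sn.
rewrite (big_nth j0) sn big_mkord -[RHS]cx; apply: eq_bigr => l _.
by rewrite ins inord_val.
Qed.

Section Schur.
Variables (k : closedFieldType) (V : lmodType k).
Variables (B : set V) (Z : V -> V -> Prop).
Hypothesis sB : subsp B.
Hypothesis ZB : forall x y, Z x y -> B x /\ B y.
Hypothesis Zlin : forall a x y x' y', Z x y -> Z x' y' -> Z (a *: x + x') (a *: y + y').
Hypothesis Ztot : forall x, B x -> exists y, Z x y.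
Hypothesis Zfun : forall y, Z 0 y -> y = 0.
Hypothesis Zinj : forall a x, Z x (a *: x) -> x = 0.
Hypothesis Zsurj : forall a u, B u -> exists x y, Z x y /\ u = y - a *: x.

Let Zuniq x y y' : Z x y -> Z x y' -> y = y'.
Proof.
move=> xy xy'; have := Zlin (-1) xy' xy.
by rewrite !scaleN1r addNr addrC => /Zfun/subr0_eq.
Qed.

Let phi (x : V) : V := xget 0 [set y | Z x y].

Let phiP x : B x -> Z x (phi x).
Proof. by move=> /Ztot[y Zy]; rewrite /phi; case: xgetP => [_ _ //|/(_ y)]. Qed.

Let phiB x : B x -> B (phi x).
Proof. by move=> /phiP/ZB[]. Qed.

Let phi_lin a x y : B x -> B y -> phi (a *: x + y) = a *: phi x + phi y.
Proof.
move=> Bx By; apply: (@Zuniq (a *: x + y)); last by apply: Zlin; exact: phiP.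
by apply: phiP; exact: sB.2.
Qed.

Let iterB n x : B x -> B (iter n phi x).
Proof. by move=> Bx; elim: n => //= n; exact: phiB. Qed.

Let iter_lin n a x y : B x -> B y ->
  iter n phi (a *: x + y) = a *: iter n phi x + iter n phi y.
Proof. by move=> Bx By; elim: n => //= n ->; apply: phi_lin; exact: iterB. Qed.

Let phi0 : phi 0 = 0.
Proof. by apply: Zfun; apply: phiP; case: sB. Qed.

Let phi_sum n (c : 'I_n -> k) (f : 'I_n -> V) : (forall i, B (f i)) ->
  phi (\sum_i c i *: f i) = \sum_i c i *: phi (f i).
Proof.
move=> Bf; elim: n c f Bf => [|n IH] c f Bf; first by rewrite !big_ord0 phi0.
by rewrite !big_ord_recl phi_lin ?IH //; apply: subsp_lcomb.
Qed.

(** The action of a polynomial in phi. *)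
Let pact (p : {poly k}) (v : V) : V := \sum_(i < size p) p`_i *: iter i phi v.

Let pactE n (p : {poly k}) v : (size p <= n)%N -> pact p v = \sum_(i < n) p`_i *: iter i phi v.
Proof.
move=> pn; rewrite /pact -!(big_mkord xpredT (fun i => p`_i *: iter i phi v)).
rewrite (@big_cat_nat _ _ _ (size p) 0 n) //= [X in _ = _ + X]big_nat_cond.
rewrite [X in _ = _ + X]big1 ?addr0 // => i /andP[/andP[pi _] _].
by rewrite nth_default // scale0r.
Qed.

Let pactB (p : {poly k}) v : B v -> B (pact p v).
Proof. by move=> Bv; apply: subsp_lcomb => // i _ _; exact: iterB. Qed.

Let pact_linl a (p q : {poly k}) v : pact (a *: p + q) v = a *: pact p v + pact q v.
Proof.
pose n := maxn (size (a *: p + q)) (maxn (size p) (size q)).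
rewrite !(@pactE n) ?leq_max ?leqnn ?orbT // scaler_sumr -big_split /=.
by apply: eq_bigr => i _; rewrite coefD coefZ scalerDl scalerA.
Qed.

Let pact_linr (p : {poly k}) a x y : B x -> B y -> pact p (a *: x + y) = a *: pact p x + pact p y.
Proof.
move=> Bx By; rewrite /pact scaler_sumr -big_split /=; apply: eq_bigr => i _.
by rewrite iter_lin // scalerDr !scalerA mulrC.
Qed.

Let pact0 v : pact 0 v = 0.
Proof. by rewrite /pact size_poly0 big_ord0. Qed.

Let pactv0 (p : {poly k}) : pact p 0 = 0.
Proof.
rewrite /pact big1 // => i _.
by elim: (val i) => [|n IHn] /=; rewrite ?scaler0 // iter_fix ?phi0 // scaler0.
Qed.

Let pactX (p : {poly k}) v : B v -> pact (p * 'X) v = phi (pact p v).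
Proof.
move=> Bv; rewrite (@pactE (size p).+1); last first.
  have [->|p0] := eqVneq p 0; first by rewrite mul0r size_poly0.
  by rewrite size_mulX.
rewrite big_ord_recl coefMX /= scale0r add0r /pact phi_sum => [|i]; last exact: iterB.
by apply: eq_bigr => i _; rewrite coefMX.
Qed.

Let pactMr (p : {poly k}) a v : B v -> pact (p * ('X - a%:P)) v = phi (pact p v) - a *: pact p v.
Proof.
move=> Bv; rewrite mulrBr mulrC -[p * _]mulrC mul_polyC addrC -scaleNr pact_linl.
by rewrite mulrC pactX // scaleNr addrC.
Qed.

Let pactMl (p : {poly k}) a v : B v -> pact (p * ('X - a%:P)) v = pact p (phi v - a *: v).
Proof.
move=> Bv; rewrite pactMr // addrC [in RHS]addrC -!scaleNr pact_linr //; last exact: phiB.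
congr (_ + _); rewrite /pact phi_sum => [|i]; last exact: iterB.
by apply: eq_bigr => i _; rewrite -iterS iterSr.
Qed.

Let pact_inj (p : {poly k}) v : B v -> p != 0 -> pact p v = 0 -> v = 0.
Proof.
elim: {p}(size p) {-2}p (erefl (size p)) => [|n IH] p sp Bv p0.
  by move/eqP: sp; rewrite size_poly_eq0 (negbTE p0).
have [s1|/closed_rootP[a /factor_theorem[q pE]]] := eqVneq (size p) 1%R.
  have [c c0 ->] : exists2 c, c != 0 & p = c%:P.
    by have /eqP/size_poly1P[c c0 ->] := s1; exists c.
  rewrite /pact size_polyC c0 big_ord1 coefC eqxx /= => /eqP.
  by rewrite scaler_eq0 (negbTE c0) => /eqP.
have q0 : q != 0 by apply: contraNneq p0 => q0; rewrite pE q0 mul0r.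
rewrite pE pactMr // => /eqP; rewrite subr_eq0 => /eqP qv.
apply: (IH q) => //.
  by move: sp; rewrite pE size_Mmonic ?monicXsubC // size_XsubC addn2 => -[].
by apply: (@Zinj a); rewrite -qv; apply: phiP; exact: pactB.
Qed.

(** Z is the graph of an endomorphism phi of B for which every phi - a is bijective.  The
    resolvents (phi - a)^-1 v of a vector v <> 0 are then an uncountable independent family:
    a relation between them, multiplied by the product of the phi - a, says that a nonzero
    polynomial in phi kills v, and this polynomial is a product of injective factors. *)
Lemma schur_zero : countable_dim V -> ~ countable [set: k] -> forall v, B v -> v = 0.
Proof.
move=> Vc kc v Bv; apply: contrapT => v0; apply: kc.
have /choice[x xP] a : exists x, B x /\ phi x - a *: x = v.
  have [x [y [Zxy ->]]] := Zsurj a Bv; exists x; have [Bx _] := ZB Zxy.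
  by split=> //; congr (_ - _); apply: Zuniq Zxy; exact: phiP.
apply: (countable_independent (x := x)) => // s c us cx.
pose P a := \prod_(b <- s | b != a) ('X - b%:P).
have Px a : a \in s -> pact (\prod_(b <- s) ('X - b%:P)) (x a) = pact (P a) v.
  move=> sa; rewrite (bigD1_seq a) //= mulrC pactMl ?(xP a).2 //.
  by case: (xP a).
have PL : pact (\sum_(a <- s) c a *: P a) v = 0.
  have rP r : {subset r <= s} -> pact (\sum_(a <- r) c a *: P a) v =
      pact (\prod_(b <- s) ('X - b%:P)) (\sum_(a <- r) c a *: x a).
    elim: r => [|a r IH] rs; first by rewrite !big_nil pact0 pactv0.
    rewrite !big_cons pact_linl pact_linr; last 2 first.
    - by case: (xP a).
    - by apply: subsp_lcomb => // i _ _; case: (xP i).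
    rewrite Px ?IH //; last by apply: rs; rewrite mem_head.
    by move=> b br; apply: rs; rewrite inE br orbT.
  by rewrite rP // cx pactv0.
have q0 : \sum_(a <- s) c a *: P a = 0.
  by apply: contrapT => /eqP q0; apply: v0; exact: pact_inj q0 PL.
move=> a sa; have /(congr1 (fun q => q.[a])) := q0.
rewrite horner0 horner_sum (bigD1_seq a) //= big1_seq ?addr0 => [|b /andP[ba sb]].
  rewrite hornerZ horner_prod => /eqP; rewrite mulf_eq0 => /orP[/eqP//|].
  rewrite prodf_seq_eq0 => /hasP[b _ /andP[ba]].
  by rewrite hornerXsubC subr_eq0 eq_sym (negbTE ba).
apply/eqP; rewrite hornerZ /P horner_prod mulf_eq0 prodf_seq_eq0; apply/orP; right.
by apply/hasP; exists a => //; rewrite eq_sym ba hornerXsubC subrr eqxx.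
Qed.

End Schur.

(** * Pencils of forms, back and forth *)

Section Pencil.
Variable k : fieldType.
Implicit Types (e : k * k).

(** The member of the pencil of omega and omega' with coordinates e. *)
Definition pen e (V : biquadratic k) (u v : V) : k :=
  e.1 * bq_omega V u v + e.2 * bq_omega' V u v.

Lemma penC e (V : biquadratic k) (u v : V) : pen e u v = pen e v u.
Proof. by rewrite /pen hermC [bq_omega' _ _ _]hermC !expr0 !mul1r. Qed.

Lemma pen_linr e (V : biquadratic k) (u : V) : lin1 (pen e u).
Proof. by move=> a x y; rewrite /pen !linearPr /=; ring. Qed.

Lemma pen_linl e (V : biquadratic k) (v : V) : lin1 (fun u => pen e u v).
Proof. by move=> a x y; rewrite ![pen _ _ v]penC pen_linr. Qed.

Lemma pen0r e (V : biquadratic k) (u : V) : pen e u 0 = 0.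
Proof. exact: lin1_0 (pen_linr e u). Qed.

Lemma pen0l e (V : biquadratic k) (u : V) : pen e (0 : V) u = 0.
Proof. by rewrite penC pen0r. Qed.

Lemma pen_iso e (V W : biquadratic k) (f : V -> W) : is_isomorphism f ->
  forall u v, pen e (f u) (f v) = pen e u v.
Proof. by move=> [[_ _ f1 f2] _] u v; rewrite /pen f1 f2. Qed.

Definition pdet e e' : k := e.1 * e'.2 - e.2 * e'.1.

Lemma pen_omega e e' (V W : biquadratic k) (u v : V) (x y : W) : pdet e e' != 0 ->
  pen e u v = pen e x y -> pen e' u v = pen e' x y ->
  bq_omega V u v = bq_omega W x y /\ bq_omega' V u v = bq_omega' W x y.
Proof.
move=> d0 E E'; split; apply: (mulfI d0).
  transitivity (e'.2 * pen e u v - e.2 * pen e' u v); first by rewrite /pen /pdet; ring.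
  by rewrite E E' /pen /pdet; ring.
transitivity (e.1 * pen e' u v - e'.1 * pen e u v); first by rewrite /pen /pdet; ring.
by rewrite E E' /pen /pdet; ring.
Qed.

End Pencil.

Section BackForth.
Variables (k : fieldType) (V W : biquadratic k) (e e' : k * k).
Hypothesis ee' : pdet e e' != 0.
Variable P : seq (V * W) -> Prop.
Hypothesis P0 : forall s v w, P s -> lspan s (v, w) -> v = 0 <-> w = 0.
Hypothesis Pform : forall s v w v' w', P s -> lspan s (v, w) -> lspan s (v', w') ->
  pen e v v' = pen e w w' /\ pen e' v v' = pen e' w w'.
Hypothesis forth : forall s v, P s -> exists s',
  [/\ P s', lspan s `<=` lspan s' & exists w, lspan s' (v, w)].
Hypothesis back : forall s w, P s -> exists s',
  [/\ P s', lspan s `<=` lspan s' & exists v, lspan s' (v, w)].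

Lemma countable_dim_exhaust (U : biquadratic k) :
  exists b : nat -> U, forall v, exists n, lspan (map b (iota 0 n)) v.
Proof.
have [I [b [_ _ bV]]] := bq_countable_dim U.
exists (fun n => if unpickle n is Some i then b i else 0) => v.
have [s [c ->]] := bV v Logic.I.
exists (\max_(i <- s) (pickle i).+1)%N; apply: subsp_lcomb; first exact: lspan_subsp.
move=> i si _; apply: lspan_mem.
have -> : b i = (fun n => if unpickle n is Some i then b i else 0) (pickle i).
  by rewrite pickleK.
apply: map_f; rewrite mem_iota add0n.
exact: (@leq_bigmax_seq _ _ _ (fun i => (pickle i).+1)).
Qed.

(** A chain of finite lists of pairs, extended in turn towards the enumerations of V and of W,
    spans the graph of an isomorphism. *)
Lemma back_forth s0 : P s0 ->
  exists2 f : V -> W, is_isomorphism f & forall v w, lspan s0 (v, w) -> f v = w.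
Proof.
move=> Ps0.
have [bV bVP] := countable_dim_exhaust V; have [bW bWP] := countable_dim_exhaust W.
have step (ns : nat * seq (V * W)) : exists s', P ns.2 -> [/\ P s',
    lspan ns.2 `<=` lspan s', exists w, lspan s' (bV ns.1, w) & exists v, lspan s' (v, bW ns.1)].
  case: (pselect (P ns.2)) => [Ps|nPs]; last by exists [::].
  have [s1 [Ps1 ss1 [w w1]]] := forth (bV ns.1) Ps.
  have [s2 [Ps2 ss2 [v v2]]] := back (bW ns.1) Ps1.
  exists s2; split=> //; last by exists v.
    exact: subset_trans ss2.
  by exists w; exact: ss2.
have {step}[next nextP] := choice step.
pose C n := nat_rect (fun=> seq (V * W)) s0 (fun n s => next (n, s)) n.
have CP n : P (C n).
  by elim: n => //= n IH; case: (nextP (n, C n) IH).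
have Cmono m n : (m <= n)%N -> lspan (C m) `<=` lspan (C n).
  elim: n => [|n IH]; first by rewrite leqn0 => /eqP ->.
  rewrite leq_eqVlt => /predU1P[-> //|/IH mn].
  by apply: subset_trans mn _; case: (nextP (n, C n) (CP n)).
pose R v w := exists n, lspan (C n) (v, w).
have RP v w v' w' : R v w -> R v' w' -> exists n, lspan (C n) (v, w) /\ lspan (C n) (v', w').
  move=> [m vw] [n vw']; exists (maxn m n); split.
    exact: Cmono (leq_maxl _ _) _ vw.
  exact: Cmono (leq_maxr _ _) _ vw'.
have R0 : R 0 0 by exists 0%N; case: (lspan_subsp (C 0)).
have Rlin a v w v' w' : R v w -> R v' w' -> R (a *: v + v') (a *: w + w').
  move=> vw vw'; have [n [h h']] := RP _ _ _ _ vw vw'; exists n.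
  exact: ((lspan_subsp _).2 a _ _ h h').
have R_0 v w : R v w -> v = 0 <-> w = 0 by move=> [n]; exact: P0 (CP n).
have Rtot v : exists w, R v w.
  have [n] := bVP v; apply: (@lspan_min _ _ _ [set v | exists w, R v w]).
    split=> [|a u u' [w uw] [w' uw']]; first by exists 0.
    by exists (a *: w + w'); exact: Rlin.
  move=> _ /mapP[i _ ->]; case: (nextP (i, C i) (CP i)) => _ _ [w w1] _.
  by exists w, i.+1.
have Rsurj w : exists v, R v w.
  have [n] := bWP w; apply: (@lspan_min _ _ _ [set w | exists v, R v w]).
    split=> [|a u u' [v uv] [v' uv']]; first by exists 0.
    by exists (a *: v + v'); exact: Rlin.
  move=> _ /mapP[i _ ->]; case: (nextP (i, C i) (CP i)) => _ _ _ [v v1].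
  by exists v, i.+1.
have [f fR] := choice Rtot; have [g gR] := choice Rsurj.
have Rfun v w w' : R v w -> R v w' -> w = w'.
  move=> vw vw'; have := Rlin (-1) _ _ _ _ vw' vw.
  by rewrite !scaleN1r addNr addrC => /R_0[/(_ erefl)/subr0_eq].
have Rinj v v' w : R v w -> R v' w -> v = v'.
  move=> vw vw'; have := Rlin (-1) _ _ _ _ vw' vw.
  by rewrite !scaleN1r addNr addrC => /R_0[_ /(_ erefl)/subr0_eq].
have Rform v w v' w' : R v w -> R v' w' ->
    bq_omega V v v' = bq_omega W w w' /\ bq_omega' V v v' = bq_omega' W w w'.
  move=> vw vw'; have [n [h h']] := RP _ _ _ _ vw vw'.
  by have [E E'] := Pform (CP n) h h'; exact: pen_omega E E'.
exists f; last by move=> v w vw; apply: (Rfun v) => //; exists 0%N.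
split; last first.
  by exists g => x; [apply: Rinj (gR _) (fR _) | apply: Rfun (fR _) (gR _)].
split=> [a u v|u v uv|u v|u v].
- by apply: (Rfun (a *: u + v)) => //; apply: Rlin.
- by apply: (Rinj u v (f u)) => //; rewrite uv.
- by case: (Rform _ _ _ _ (fR u) (fR v)).
- by case: (Rform _ _ _ _ (fR u) (fR v)).
Qed.

End BackForth.

(** * Systems of generic forms *)

Section Systems.
Variables (k : closedFieldType) (J I : finType) (m : J -> J -> pred I).

(** Vectors come in kinds j, those of kind j being taken in X j and modulo N j; between the
    kinds j and l the forms F i with i in m j l are free.  By [sys_nd], vectors that are
    independent modulo the N j define independent functionals on X l; there u j i stands for a
    combination of such vectors, which is why it vanishes as soon as it lies in N j. *)
Record system (V : lmodType k) (X N : J -> set V) (F : I -> V -> V -> k) : Prop := System {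
  sys_X : forall j, subsp (X j);
  sys_N : forall j, subsp (N j);
  sys_lin : forall i x, lin1 (F i x);
  sys_sym : forall i j l x y, X j x -> X l y -> F i x y = F i y x;
  sys_nd : forall l (u : J -> I -> V), (forall j i, X j (u j i)) ->
    (forall j i, N j (u j i) -> u j i = 0) ->
    (forall y, X l y -> \sum_j \sum_(i | m j l i) F i (u j i) y = 0) ->
    forall j i, m j l i -> u j i = 0;
  sys_inf : forall j, infmod (X j) (N j)
}.

Hypothesis mC : forall j l i, m j l i = m l j i.
Hypothesis two_neq0 : 2%:R != 0 :> k.
Variables (V : lmodType k) (X N : J -> set V) (F : I -> V -> V -> k).

(** Independence modulo N within each kind; the kinds are not compared with one another. *)
Definition good (A : eqType) (kd : A -> J) (s : seq A) (x : A -> V) : Prop :=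
  (forall a, a \in s -> X (kd a) (x a)) /\
  forall j (c : A -> k), N j (\sum_(a <- s | kd a == j) c a *: x a) ->
    forall a, a \in s -> kd a = j -> c a = 0.

Definition fresh (A : eqType) (kd : A -> J) (s : seq A) (x : A -> V) l y : Prop :=
  forall c : A -> k, ~ N l (y - \sum_(a <- s | kd a == l) c a *: x a).

Lemma good_perm (A : eqType) (kd : A -> J) s s' (x : A -> V) :
  perm_eq s s' -> good kd s x -> good kd s' x.
Proof.
move=> ss' [gX gN]; split=> [a|j c]; first by rewrite -(perm_mem ss'); exact: gX.
by rewrite -(perm_big _ ss') => /gN H a; rewrite -(perm_mem ss'); exact: H.
Qed.

Lemma good_cons (A : eqType) (kd : A -> J) s (x : A -> V) a y :
  (forall j, subsp (N j)) -> a \notin s ->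
  good kd s x -> X (kd a) y -> fresh kd s x (kd a) y ->
  good kd (a :: s) [eta x with a |-> y].
Proof.
move=> sN as_ [gX gN] Xy fy; split=> [b|j c].
  rewrite inE /=; case: eqP => [-> _|_ /= sb] //; exact: gX.
have sE : \sum_(b <- s | kd b == j) c b *: [eta x with a |-> y] b =
    \sum_(b <- s | kd b == j) c b *: x b.
  rewrite big_seq_cond [RHS]big_seq_cond; apply: eq_bigr => b /andP[sb _] /=.
  by case: eqP sb as_ => // -> ->.
rewrite big_cons sE /= eqxx; case: eqP => [ka|ka] Nc b; last first.
  by rewrite inE => /predU1P[->//|sb] kb; apply: gN Nc b sb kb.
have ca : c a = 0.
  apply: contrapT => /eqP ca; apply: (fy (fun b => - (c a)^-1 * c b)); rewrite ka.
  under eq_bigr do rewrite -scalerA.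
  rewrite -scaler_sumr scaleNr opprK; have := subspZ (c a)^-1 (sN j) Nc.
  by rewrite scalerDr scalerA mulVf // scale1r.
rewrite inE => /predU1P[->//|sb] kb.
by move: Nc; rewrite ca scale0r add0r => Nc; apply: gN Nc b sb kb.
Qed.

Hypothesis sys : system X N F.

(** The flags serve the proof of [extends_all], in which the norms are first left free and then
    made zero: D requires the norms q, and Z restricts the values to be prescribed to zero. *)
Definition extends (D Z : bool) : Prop :=
  forall (A : eqType) (kd : A -> J) s (x : A -> V) l (t : A -> I -> k) (q : I -> k),
  uniq s -> good kd s x -> (Z -> (forall a i, t a i = 0) /\ forall i, q i = 0) ->
  exists y, [/\ X l y, fresh kd s x l y,
    forall a i, a \in s -> m (kd a) l i -> F i (x a) y = t a i &
    D -> forall i, m l l i -> F i y y = q i].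

(** By [sys_nd] the products with a good family are independent functionals on X l; their
    dual vectors solve the equations, and a solution of the homogeneous equations outside a
    finite span modulo N makes the result fresh. *)
Lemma extends_linear : extends false false.
Proof.
move=> A kd s x l t q us [gX gN] _.
pose r := [seq p <- [seq (a, i) | a <- s, i <- enum I] | m (kd p.1) l p.2].
have ur : uniq r.
  apply: filter_uniq; apply: allpairs_uniq => //; first exact: enum_uniq.
  by move=> [? ?] [? ?] _ _ [-> ->].
have rP a i : ((a, i) \in r) = (a \in s) && m (kd a) l i.
  rewrite mem_filter /= andbC; congr (_ && _).
  apply/allpairsP/idP => [[[b j] /= [sb _ [-> _]]] //|sa].
  by exists (a, i); rewrite mem_enum.
have [|c cr p|e eP] := @dual_family k V (X l) _ r (fun p => F p.2 (x p.1)) (sys_X sys l) ur.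
- by move=> p; exact: sys_lin sys _ _.
- pose u j i := \sum_(a <- s | kd a == j) c (a, i) *: x a.
  have Xu j i : X j (u j i).
    apply: subsp_lcomb; first exact: sys_X sys j.
    by move=> a sa /eqP <-; exact: gX.
  case: p => a i; rewrite rP => /andP[sa mai].
  have u0 : u (kd a) i = 0.
    apply: (sys_nd sys (l := l)) mai => // [j i' Nu|y Xy].
      rewrite /u big_seq_cond big1 // => b /andP[sb /eqP kb].
      by rewrite (gN j _ Nu b sb kb) scale0r.
    rewrite -[RHS](cr y Xy) /r big_filter [RHS]big_mkcond [RHS]big_allpairs /=.
    rewrite [RHS](partition_big kd xpredT) //=; apply: eq_bigr => j _.
    under [RHS]eq_bigr do rewrite -big_mkcond /=.
    under eq_bigr => i' mj.
      rewrite (sys_sym sys _ (Xu j i') Xy) /u lin1_sum; last exact: sys_lin sys _ _.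
      over.
    rewrite exchange_big /=; rewrite big_seq_cond [RHS]big_seq_cond.
    apply: eq_bigr => b /andP[sb /eqP kb].
    rewrite kb [RHS]big_enum_cond; apply: eq_big => // i' _.
    by rewrite (sys_sym sys _ (gX b sb) Xy).
  apply: (gN (kd a) (fun a => c (a, i))) => //.
  by rewrite -/(u (kd a) i) u0; case: (sys_N sys (kd a)).
have [w Xw wN] := sys_inf sys l (map e r ++ map x s).
pose y := \sum_(p <- r) (t p.1 p.2 - F p.2 (x p.1) w) *: e p + w.
exists y; split=> //.
- apply: subspD => //; first exact: sys_X sys l.
  apply: subsp_lcomb; first exact: sys_X sys l.
  by move=> p pr _; case: (eP p pr).
- move=> c Ny; apply: (wN _ Ny); rewrite opprB.
  have -> (z : V) : w + (z - y) = z - (y - w) by rewrite opprB addrCA.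
  rewrite /y addrK; apply: subspB; first exact: lspan_subsp.
    apply: subsp_lcomb => [|a sa _]; first exact: lspan_subsp.
    by apply: lspan_mem; rewrite mem_cat map_f ?orbT.
  apply: subsp_lcomb => [|p pr _]; first exact: lspan_subsp.
  by apply: lspan_mem; rewrite mem_cat map_f.
- move=> a i sa mi; have pr : (a, i) \in r by rewrite rP sa.
  have Fl := sys_lin sys i (x a).
  rewrite /y lin1D // lin1_sum // (bigD1_seq (a, i)) //= big_seq_cond big1 => [|p /andP[p_r pa]].
    by have := (eP _ pr).2 _ pr; rewrite /= eqxx => ->; rewrite mulr1 addr0 subrK.
  have := (eP _ p_r).2 _ pr; rewrite /= eq_sym (negbTE pa) => ->.
  by rewrite mulr0.
Qed.

Lemma extends_family D Z : extends D Z ->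
  forall (A : eqType) (kd : A -> J) (s t : seq A) (x : A -> V) (g : I -> A -> A -> k),
  uniq (t ++ s) -> good kd s x ->
  (forall i a b, a \in t ++ s -> b \in t ++ s -> m (kd a) (kd b) i -> g i a b = g i b a) ->
  (Z -> forall i a b, g i a b = 0) ->
  exists x', [/\ {in s, x' =1 x}, good kd (t ++ s) x' &
    forall a b i, a \in t -> b \in t ++ s -> (a != b) || D -> m (kd a) (kd b) i ->
      F i (x' a) (x' b) = g i a b].
Proof.
move=> ext A kd s t x g; elim: t => [|a t IH] /=; first by exists x; split.
move=> /andP[ats uts] gs gsym gZ.
have [//|//|i b c sb sc|//|x1 [x1s g1 F1]] := IH.
  by apply: gsym; rewrite inE ?sb ?sc orbT.
have [y [Xy fy Fy Dy]] := ext A kd (t ++ s) x1 (kd a) (fun b i => g i a b)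
  (fun i => g i a a) uts g1 (fun z => conj (fun b i => gZ z i a b) (fun i => gZ z i a a)).
have x2E b : b \in t ++ s -> [eta x1 with a |-> y] b = x1 b.
  by move=> sb /=; case: eqP sb ats => // -> ->.
have Xts b : b \in t ++ s -> X (kd b) (x1 b) by case: g1 => gX _; exact: gX.
exists [eta x1 with a |-> y]; split.
- by move=> b sb; rewrite x2E ?mem_cat ?sb ?orbT // x1s.
- by apply: good_cons => //; exact: sys_N sys.
- move=> b c i; rewrite inE => /predU1P[->|tb].
    rewrite /= eqxx inE => /predU1P[->|sc]; first by rewrite !eqxx /= => /Dy; exact.
    rewrite -/([eta x1 with a |-> y] c) => _ mi; rewrite x2E // (sys_sym sys _ Xy (Xts c sc)).
    by rewrite Fy // -mC.
  have sb : b \in t ++ s by rewrite mem_cat tb.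
  rewrite inE => /predU1P[->|sc] bc mi; last by rewrite !x2E // F1.
  rewrite x2E //= eqxx Fy //; apply: gsym; rewrite ?inE ?eqxx ?sb ?orbT //.
  by rewrite mC.
Qed.

Lemma sqrt_exists (a : k) : exists b, b ^+ 2 = a.
Proof.
have [b bE] := @solve_monicpoly k 2 (fun i => if i is 0%N then a else 0) isT.
by exists b; rewrite bE !big_ord_recl big_ord0 /= expr0 mulr1 mul0r !addr0.
Qed.

(** Take more mutually orthogonal vectors than there are forms: their norms satisfy a linear
    relation, and the square roots of its coefficients combine them to an isotropic vector. *)
Lemma extends_isotropic : extends true true.
Proof.
move=> A kd s x l t q us gs z0; have [t0 q0] := z0 isT.
pose n := #|I|.+1.
pose kd' (a : A + 'I_n) := if a is inl a then kd a else l.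
pose x0 (a : A + 'I_n) := if a is inl a then x a else 0.
pose sl := map (@inl A 'I_n) s; pose sr := map (@inr A 'I_n) (enum 'I_n).
have uslr : uniq (sr ++ sl).
  have injl : injective (@inl A 'I_n) by move=> ? ? [].
  have injr : injective (@inr A 'I_n) by move=> ? ? [].
  rewrite cat_uniq (map_inj_uniq injr) enum_uniq (map_inj_uniq injl) us andbT.
  by apply/hasPn => _ /mapP[a _ ->]; apply/mapP => -[].
have bigl (j : J) (c : A + 'I_n -> V) : \sum_(a <- sl | kd' a == j) c a =
    \sum_(a <- s | kd a == j) c (inl a) by rewrite big_map.
have bigr (c : A + 'I_n -> V) : \sum_(a <- sr | kd' a == l) c a =
    \sum_b c (inr b) by rewrite big_map /= eqxx big_enum.
have gsl : good kd' sl x0.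
  case: gs => gX gN; split=> [_ /mapP[a sa ->]|j c]; first exact: gX.
  rewrite bigl => Nc _ /mapP[a sa ->] ka.
  exact: (gN j (fun a => c (inl a)) Nc).
have [//|//|x' [x's [gX gN] gF]] := extends_family extends_linear
  (t := sr) (g := fun _ _ _ => 0) uslr gsl.
pose y b := x' (inr b).
have insr b : inr b \in sr by apply: map_f; rewrite mem_enum.
have Xy b : X l (y b) by apply: (gX (inr b)); rewrite mem_cat insr.
pose M := \matrix_(b < n, i < #|I|) (if m l l (enum_val i) then F (enum_val i) (y b) (y b) else 0).
have [u u0 uM] := left_kernel_tall M (leqnn _).
have /choice[sq sqE] := sqrt_exists.
exists (\sum_b sq (u 0 b) *: y b); split.
- by apply: subsp_lcomb => //; exact: sys_X sys l.
- move=> c Nc; have := gN l (fun a => if a is inr b then sq (u 0 b) else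
      if a is inl a then - c a else 0).
  rewrite big_cat bigl bigr /=.
  have -> : \sum_(a <- s | kd a == l) - c a *: x' (inl a) =
      - \sum_(a <- s | kd a == l) c a *: x a.
    rewrite -sumrN big_seq_cond [RHS]big_seq_cond; apply: eq_bigr => a /andP[sa _].
    by rewrite x's ?map_f // scaleNr.
  move=> /(_ Nc) H; case/eqP: u0; apply/rowP => b; rewrite mxE.
  have := H (inr b); rewrite mem_cat insr => /(_ isT erefl) /= sq0.
  by rewrite -(sqE (u 0 b)) sq0 expr0n.
- move=> a i sa mi; rewrite t0 lin1_sum; last exact: sys_lin sys _ _.
  rewrite big1 // => b _.
  have -> : x a = x' (inl a) by rewrite x's ?map_f.
  rewrite (sys_sym sys _ (gX (inl a) _) (Xy b)); last by rewrite mem_cat map_f ?orbT.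
  have mba : m (kd' (inr b)) (kd' (inl a)) i by rewrite mC.
  have ia : inl a \in sr ++ sl by rewrite mem_cat map_f ?orbT.
  by rewrite (gF _ _ i (insr b) ia isT mba) mulr0.
- move=> _ i mi; rewrite q0 lin1_sum; last exact: sys_lin sys _ _.
  transitivity (\sum_b u 0 b * F i (y b) (y b)).
    have Xs : X l (\sum_b sq (u 0 b) *: y b).
      by apply: subsp_lcomb => //; exact: sys_X sys l.
    apply: eq_bigr => b _; rewrite (sys_sym sys _ Xs (Xy b)).
    rewrite lin1_sum; last exact: sys_lin sys _ _.
    rewrite (bigD1 b) //= big1 => [|c cb]; first by rewrite addr0 mulrA -expr2 sqE.
    rewrite (gF (inr b) (inr c)) ?mulr0 ?mem_cat ?insr //.
    by rewrite orbF; apply: contraNneq cb => -[->].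
  have /rowP/(_ (enum_rank i)) := uM; rewrite !mxE => u_i.
  rewrite -[RHS]u_i; apply: eq_bigr => b _; by rewrite mxE enum_rankK mi.
Qed.

(** Isotropic vectors y i orthogonal to the family are added first, and a linear solution x1 is
    chosen dual to them.  The norms of x1 + sum al i *: y i are then affine functions of al. *)
Lemma extends_all : extends true false.
Proof.
move=> A kd s x l t q us gs _.
pose kd' (a : A + I) := if a is inl a then kd a else l.
pose x0 (a : A + I) := if a is inl a then x a else 0.
pose sl := map (@inl A I) s; pose sr := map (@inr A I) (enum I).
have uslr : uniq (sr ++ sl).
  have injl : injective (@inl A I) by move=> ? ? [].
  have injr : injective (@inr A I) by move=> ? ? [].
  rewrite cat_uniq (map_inj_uniq injr) enum_uniq (map_inj_uniq injl) us andbT.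
  by apply/hasPn => _ /mapP[a _ ->]; apply/mapP => -[].
have bigl (j : J) (c : A + I -> V) : \sum_(a <- sl | kd' a == j) c a =
    \sum_(a <- s | kd a == j) c (inl a) by rewrite big_map.
have bigr (c : A + I -> V) : \sum_(a <- sr | kd' a == l) c a =
    \sum_b c (inr b) by rewrite big_map /= eqxx big_enum.
have gsl : good kd' sl x0.
  case: gs => gX gN; split=> [_ /mapP[a sa ->]|j c]; first exact: gX.
  rewrite bigl => Nc _ /mapP[a sa ->] ka.
  exact: (gN j (fun a => c (inl a)) Nc).
have [//|//|x' [x's gx' gF]] := extends_family extends_isotropic
  (t := sr) (g := fun _ _ _ => 0) uslr gsl.
pose y b := x' (inr b).
have insr b : inr b \in sr by apply: map_f; rewrite mem_enum.
have insl a : a \in s -> inl a \in sr ++ sl by move=> sa; rewrite mem_cat map_f ?orbT.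
have Xy b : X l (y b) by apply: (gx'.1 (inr b)); rewrite mem_cat insr.
have [//|x1 [Xx1 fx1 Fx1 _]] := @extends_linear _ kd' (sr ++ sl) x' l
  (fun a i => if a is inr b then (b == i)%:R else if a is inl a then t a i else 0)
  (fun=> 0) uslr gx'.
pose al i := (q i - F i x1 x1) / 2%:R.
have Xs : X l (\sum_i al i *: y i) by apply: subsp_lcomb => //; exact: sys_X sys l.
exists (x1 + \sum_i al i *: y i); split.
- by apply: subspD => //; exact: sys_X sys l.
- move=> c Nc; apply: (fx1 (fun a => if a is inr i then - al i else if a is inl a then c a else 0)).
  rewrite big_cat bigl bigr /=.
  under [X in _ - (X + _)]eq_bigr do rewrite scaleNr.
  rewrite sumrN opprD opprK addrA.
  have -> : \sum_(a <- s | kd a == l) c a *: x' (inl a) =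
      \sum_(a <- s | kd a == l) c a *: x a => //.
  rewrite big_seq_cond [RHS]big_seq_cond; apply: eq_bigr => a /andP[sa _].
  by rewrite x's ?map_f.
- move=> a i sa mi; rewrite lin1D ?lin1_sum; try exact: sys_lin sys _ _.
  have -> : x a = x' (inl a) by rewrite x's ?map_f.
  rewrite (Fx1 (inl a)) ?insl // big1 ?addr0 // => b _.
  rewrite (sys_sym sys _ (gx'.1 _ (insl a sa)) (Xy b)).
  have mba : m (kd' (inr b)) (kd' (inl a)) i by rewrite mC.
  by rewrite (gF _ _ i (insr b) (insl a sa) isT mba) mulr0.
- move=> _ i mi; have Fl := sys_lin sys i.
  have Xx : X l (x1 + \sum_i al i *: y i) by apply: subspD => //; exact: sys_X sys l.
  rewrite lin1D // (sys_sym sys _ Xx Xx1) (sys_sym sys _ Xx Xs).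
  rewrite !lin1D // [F i x1 (\sum_i _)](sys_sym sys _ Xx1 Xs).
  have -> : F i (\sum_i al i *: y i) x1 = al i.
    rewrite (sys_sym sys _ Xs Xx1) lin1_sum // (bigD1 i) //= big1 => [|b bi].
      rewrite (sys_sym sys _ Xx1 (Xy i)) (Fx1 (inr i)) ?mem_cat ?insr //=.
      by rewrite eqxx mulr1 addr0.
    rewrite (sys_sym sys _ Xx1 (Xy b)) (Fx1 (inr b)) ?mem_cat ?insr //=.
    by rewrite (negbTE bi) mulr0.
  have -> : F i (\sum_i al i *: y i) (\sum_i al i *: y i) = 0.
    rewrite lin1_sum // big1 // => b _; rewrite (sys_sym sys _ Xs (Xy b)) lin1_sum //.
    rewrite big1 ?mulr0 // => c _.
    by rewrite (gF (inr b) (inr c)) ?mulr0 ?mem_cat ?insr ?orbT.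
  have al2 : al i + al i = q i - F i x1 x1 by rewrite -mulr2n -mulr_natr divfK.
  by rewrite addr0 -addrA al2 addrC subrK.
Qed.

End Systems.

(** * Spaces carried by a system, homogeneity *)

Section PairSpan.
Variables (k : fieldType) (V W : lmodType k).

Lemma pair_lcomb (A : Type) (r : seq A) (c : A -> k) (f : A -> V) (g : A -> W) :
  \sum_(i <- r) c i *: ((f i, g i) : V * W) =
  (\sum_(i <- r) c i *: f i, \sum_(i <- r) c i *: g i).
Proof. by elim: r => [|i r IH]; rewrite ?big_nil // !big_cons IH. Qed.

Lemma lspan_fst (s : seq (V * W)) v w : lspan s (v, w) -> lspan (map fst s) v.
Proof.
apply: (@lspan_min _ _ s [set p | lspan (map fst s) p.1]).
  split=> [|a [u u'] [v' w']] /=; first by case: (lspan_subsp (map fst s)).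
  by move=> *; apply: (lspan_subsp _).2.
by move=> p ps; apply: lspan_mem; exact: map_f.
Qed.

Lemma lspan_snd (s : seq (V * W)) v w : lspan s (v, w) -> lspan (map snd s) w.
Proof.
apply: (@lspan_min _ _ s [set p | lspan (map snd s) p.2]).
  split=> [|a [u u'] [v' w']] /=; first by case: (lspan_subsp (map snd s)).
  by move=> *; apply: (lspan_subsp _).2.
by move=> p ps; apply: lspan_mem; exact: map_f.
Qed.

Lemma lspan_fstP (s : seq (V * W)) v : lspan (map fst s) v -> exists w, lspan s (v, w).
Proof.
elim: s v => [|[x y] s IH] v /=; first by move=> ->; exists 0.
move=> [a /IH[w vw]]; exists (w + a *: y), a.
by rewrite -[(v, _) - _]/(v - a *: x, w + a *: y - a *: y) addrK.
Qed.

End PairSpan.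

Lemma lspan_swap (k : fieldType) (V W : lmodType k) (s : seq (V * W)) v w :
  lspan s (v, w) -> lspan (map (fun p => (p.2, p.1)) s) (w, v).
Proof.
elim: s v w => [|[x y] s IH] v w /=; first by case=> -> ->.
by move=> [a /IH vw]; exists a.
Qed.

Lemma pen_lspan (k : fieldType) (V W : biquadratic k) e (s : seq (V * W)) :
  (forall p q, p \in s -> q \in s -> pen e p.1 q.1 = pen e p.2 q.2) ->
  forall v w v' w', lspan s (v, w) -> lspan s (v', w') -> pen e v v' = pen e w w'.
Proof.
move=> ss v w v' w' vw vw'.
have H p : p \in s -> pen e p.1 v' = pen e p.2 w'.
  move=> ps; move: vw'; apply: (@lspan_min _ _ s [set q | pen e p.1 q.1 = pen e p.2 q.2]).
    split=> [|a u u' /= E E'] /=; first by rewrite !lin1_0 //; exact: pen_linr.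
    by rewrite !pen_linr E E'.
  by move=> q; exact: ss.
move: vw; apply: (@lspan_min _ _ s [set q | pen e q.1 v' = pen e q.2 w']).
  split=> [|a u u' /= E E'] /=.
    by rewrite penC [RHS]penC !lin1_0 //; exact: pen_linr.
  by rewrite !pen_linl E E'.
by move=> q; exact: H.
Qed.

Section Carrier.
Variables (k : closedFieldType) (J I : finType) (m : J -> J -> pred I).
Variables (M : nat) (b : bool).

(** A family x contributes the x i and the T (x i), besides the fixed vectors D. *)
Definition contr (V : lmodType k) (D : seq V) (T : V -> V) n (x : nat -> V) : seq V :=
  D ++ map x (iota 0 n) ++ map (fun i => T (x i)) (iota 0 n).

(** The bound M in [car_cover] is what linear oligomorphy needs.  The flag b distinguishes the
    spaces in which the T (x i) are independent from those in which T is zero. *)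
Record carrier (V : biquadratic k) (X N : J -> set V) (F : I -> V -> V -> k)
    (T : V -> V) (D : seq V) : Prop := Carrier {
  car_sys : system m X N F;
  car_lin : forall a u v, T (a *: u + v) = a *: T u + T v;
  car_cover : forall n kd x v, good X N kd (iota 0 n) x -> exists n' kd' x',
    [/\ (n <= n' <= n + M)%N, forall i, (i < n)%N -> kd' i = kd i /\ x' i = x i,
        good X N kd' (iota 0 n') x' & lspan (contr D T n' x') v];
  car_free : forall n kd x, good X N kd (iota 0 n) x -> forall d (c c' : nat -> k),
    lspan D d ->
    d + \sum_(i <- iota 0 n) c i *: x i + T (\sum_(i <- iota 0 n) c' i *: x i) = 0 ->
    [/\ d = 0, forall i, (i < n)%N -> c i = 0 & b -> forall i, (i < n)%N -> c' i = 0];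
  car_T0 : ~~ b -> forall x, T x = 0
}.

(** Through [tr_form], the free values of the system determine all products of contributions. *)
Record transfer (V W : biquadratic k) (X : J -> set V) (F : I -> V -> V -> k)
    (T : V -> V) (X' : J -> set W) (F' : I -> W -> W -> k) (T' : W -> W)
    (DD : seq (V * W)) : Prop := Transfer {
  tr_form : forall e j l x y x' y', X j x -> X l y -> X' j x' -> X' l y' ->
    (forall i, m j l i -> F i x y = F' i x' y') ->
    [/\ pen e x y = pen e x' y', pen e (T x) y = pen e (T' x') y' &
        pen e (T x) (T y) = pen e (T' x') (T' y')];
  tr_DD : forall e p q, p \in DD -> q \in DD -> pen e p.1 q.1 = pen e p.2 q.2;
  tr_DX : forall e p j x, p \in DD -> X j x -> pen e p.1 x = 0 /\ pen e p.1 (T x) = 0;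
  tr_DX' : forall e p j x, p \in DD -> X' j x -> pen e p.2 x = 0 /\ pen e p.2 (T' x) = 0;
  tr_D0 : forall d d', lspan DD (d, d') -> d = 0 <-> d' = 0
}.

Definition swap (A B : Type) (p : A * B) := (p.2, p.1).

Section Matching.
Hypothesis mC : forall j l i, m j l i = m l j i.
Hypothesis two_neq0 : 2%:R != 0 :> k.

Definition matching (V W : biquadratic k) X N (F : I -> V -> V -> k) X' N'
  (F' : I -> W -> W -> k) n (kd : nat -> J) (x : nat -> V) (x' : nat -> W) :=
  [/\ @good k J V X N _ kd (iota 0 n) x, @good k J W X' N' _ kd (iota 0 n) x' &
      forall a c i, (a < n)%N -> (c < n)%N -> m (kd a) (kd c) i ->
        F i (x a) (x c) = F' i (x' a) (x' c)].

Definition mpairs (V W : lmodType k) (DD : seq (V * W)) T T' n (x : nat -> V) (x' : nat -> W) :=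
  DD ++ map (fun i => (x i, x' i)) (iota 0 n) ++
  map (fun i => (T (x i), T' (x' i)) : V * W) (iota 0 n).

(** Good vectors covering v are added in V, and vectors with the same Gram matrix in W. *)
Lemma matching_extend V W X N F T D X' N' F' T' D' n kd x x' v :
  @carrier V X N F T D -> @carrier W X' N' F' T' D' ->
  matching X N F X' N' F' n kd x x' ->
  exists n' kd1 x1 x1', [/\ (n <= n')%N,
    forall i, (i < n)%N -> [/\ kd1 i = kd i, x1 i = x i & x1' i = x' i],
    matching X N F X' N' F' n' kd1 x1 x1' & lspan (contr D T n' x1) v].
Proof.
move=> cV cW [gx gx' E].
have [n1 [kd1 [x1 [/andP[nn1 _] x1x gx1 vs]]]] := car_cover cV v gx.
have iE : iota 0 n1 = iota 0 n ++ iota n (n1 - n) by rewrite -iotaD subnKC.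
have gx1' : good X' N' kd1 (iota 0 n) x'.
  case: gx' => gX gN; split=> [a|j c Nc a].
    by move=> /[dup] ai; rewrite mem_iota => /x1x[-> _]; exact: gX.
  move=> /[dup] ai; rewrite mem_iota => /x1x[-> _] ka; apply: (gN j) => //.
  congr (N' j _): Nc; rewrite big_seq_cond [RHS]big_seq_cond; apply: eq_bigl => d.
  by apply/andb_id2l; rewrite mem_iota => /x1x[-> _].
have [|||x2 [x2x' gx2 F2]] := extends_family mC (car_sys cW)
  (extends_all mC two_neq0 (car_sys cW)) (s := iota 0 n) (t := iota n (n1 - n))
  (g := fun i a c => F i (x1 a) (x1 c)) _ gx1' _ _ => //.
- by rewrite uniq_catC -iE iota_uniq.
- move=> i a c; rewrite !mem_cat ![(_ \in iota n _) || _]orbC -!mem_cat -!iE => an cn _.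
  by apply: (sys_sym (car_sys cV)); [apply: (gx1.1 a) | apply: (gx1.1 c)].
exists n1, kd1, x1, x2; split=> //.
  move=> i ni; have [-> ->] := x1x i ni; split=> //.
  by apply: x2x'; rewrite mem_iota.
have gx2' : good X' N' kd1 (iota 0 n1) x2.
  by apply: good_perm gx2; rewrite iE perm_catC.
split=> // a c i an1 cn1 mi.
have [na|an] := leqP n a.
  rewrite F2 ?orbT //; first by rewrite mem_iota na subnKC.
  by rewrite mem_cat orbC -mem_cat -iE mem_iota.
have [nc|cn] := leqP n c.
  have Xi d : (d < n1)%N -> X (kd1 d) (x1 d) by move=> dn; apply: gx1.1; rewrite mem_iota.
  have Xi' d : (d < n1)%N -> X' (kd1 d) (x2 d) by move=> dn; apply: gx2'.1; rewrite mem_iota.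
  rewrite (sys_sym (car_sys cV) i (Xi a an1) (Xi c cn1)).
  rewrite (sys_sym (car_sys cW) i (Xi' a an1) (Xi' c cn1)).
  rewrite F2 ?orbT //; first by rewrite mem_iota nc subnKC.
  - by rewrite mem_cat orbC -mem_cat -iE mem_iota.
  - by rewrite mC.
have [ka xa] := x1x a an; have [kc xc] := x1x c cn.
by rewrite xa xc !x2x' ?mem_iota // E // -ka -kc.
Qed.

Lemma matching_sym (V W : biquadratic k) X N (F : I -> V -> V -> k) X' N'
    (F' : I -> W -> W -> k) n kd x x' :
  matching X N F X' N' F' n kd x x' -> matching X' N' F' X N F n kd x' x.
Proof. by move=> [g g' E]; split=> // a c i an cn mi; rewrite E. Qed.

Lemma mpairs_span (V W : lmodType k) (DD : seq (V * W)) T T' n x x' v w :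
  (forall a u v, T (a *: u + v) = a *: T u + T v) ->
  (forall a u v, T' (a *: u + v) = a *: T' u + T' v) ->
  lspan (mpairs DD T T' n x x') (v, w) -> exists d d' c c',
  [/\ lspan DD (d, d'),
    v = d + \sum_(i <- iota 0 n) c i *: x i + T (\sum_(i <- iota 0 n) c' i *: x i) &
    w = d' + \sum_(i <- iota 0 n) c i *: x' i + T' (\sum_(i <- iota 0 n) c' i *: x' i)].
Proof.
move=> Tl Tl' /lspan_cat[[d d'] Dd] /lspan_cat[p].
move=> /(lspan_mapP _ _ (iota_uniq _ _))[c ->] /(lspan_mapP _ _ (iota_uniq _ _))[c'].
have TS (U U' : lmodType k) (S : U -> U') (f : nat -> U) :
    (forall a u v, S (a *: u + v) = a *: S u + S v) ->
    S (\sum_(i <- iota 0 n) c' i *: f i) = \sum_(i <- iota 0 n) c' i *: S (f i).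
  move=> Sl; elim: (iota 0 n) => [|i r IH].
    by rewrite !big_nil; have := Sl (-1) 0 0; rewrite scaler0 addr0 scaleN1r addNr.
  by rewrite !big_cons Sl IH.
rewrite !pair_lcomb -!(TS _ _ _ _ Tl) -(TS _ _ _ _ Tl') => -[E E'].
have aux (U : lmodType k) (a1 a2 a3 a4 : U) : a1 - a2 - a3 = a4 -> a1 = a2 + a3 + a4.
  by move=> <-; rewrite -[a1 - a2 - a3]addrA -opprD [RHS]addrC subrK.
exists d, d', c, c'; split=> //.
  exact: aux.
exact: aux.
Qed.

(** The contributions of two good families with the same Gram matrix span a partial isometry,
    which [matching_extend] prolongs in both directions. *)
Lemma carrier_iso (V W : biquadratic k) X N (F : I -> V -> V -> k) T X' N'
    (F' : I -> W -> W -> k) T' (DD : seq (V * W)) n kd x x' :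
  carrier X N F T (map fst DD) -> carrier X' N' F' T' (map snd DD) ->
  transfer X F T X' F' T' DD -> matching X N F X' N' F' n kd x x' ->
  exists2 f : V -> W, is_isomorphism f &
    forall v w, lspan (mpairs DD T T' n x x') (v, w) -> f v = w.
Proof.
move=> cV cW tr mt.
pose P s := exists n kd x x',
  matching X N F X' N' F' n kd x x' /\ s = mpairs DD T T' n x x'.
have sub_mpairs n1 n2 (x1 x2 : nat -> V) (y1 y2 : nat -> W) : (n1 <= n2)%N ->
    (forall i, (i < n1)%N -> x2 i = x1 i /\ y2 i = y1 i) ->
    lspan (mpairs DD T T' n1 x1 y1) `<=` lspan (mpairs DD T T' n2 x2 y2).
  move=> n12 x12; apply: lspan_sub => p; rewrite !mem_cat => /or3P[-> //||] /mapP[i].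
    rewrite mem_iota => ni ->; have [<- <-] := x12 i ni; apply/or3P/Or32.
    by apply/mapP; exists i; rewrite // mem_iota (leq_trans ni).
  rewrite mem_iota => ni ->; have [<- <-] := x12 i ni; apply/or3P/Or33.
  by apply/mapP; exists i; rewrite // mem_iota (leq_trans ni).
have fstE n1 x1 x1' : map fst (mpairs DD T T' n1 x1 x1') = contr (map fst DD) T n1 x1.
  by rewrite /mpairs /contr !map_cat -!map_comp.
have sndE n1 x1 x1' : map (@swap _ _) (mpairs DD T T' n1 x1 x1') =
    mpairs (map (@swap _ _) DD) T' T n1 x1' x1.
  by rewrite /mpairs /contr !map_cat -!map_comp.
have e01 : pdet (1, 0) (0, 1) != 0 :> k by rewrite /pdet /= mul0r subr0 mul1r oner_neq0.
have [|||||f fi fP] := @back_forth k V W (1, 0) (0, 1) e01 P _ _ _ _ (mpairs DD T T' n x x').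
- move=> _ v w [n1 [kd1 [x1 [x1' [[g1 g1' E] ->]]]]].
  move=> /(mpairs_span (car_lin cV) (car_lin cW))[d [d' [c [c' [Dd -> ->]]]]].
  have vanish (U : lmodType k) (r : nat -> U) (a : nat -> k) :
      (forall i, (i < n1)%N -> a i = 0) -> \sum_(i <- iota 0 n1) a i *: r i = 0.
    move=> a0; rewrite big_seq big1 // => i; rewrite mem_iota => ni.
    by rewrite a0 ?scale0r.
  have T0 (U : biquadratic k) Y Q (G : I -> U -> U -> k) S D :
      carrier Y Q G S D -> S 0 = 0.
    by move=> cU; have := car_lin cU (-1) 0 0; rewrite scaler0 addr0 scaleN1r addNr.
  split=> [/(car_free cV g1 (lspan_fst Dd))|/(car_free cW g1' (lspan_snd Dd))] [d0 c0 c0'].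
    have -> : d' = 0 by apply/(tr_D0 tr Dd).
    rewrite vanish // !add0r; case: (boolP b) => [/c0' h|nb]; last exact: (car_T0 cW).
    by rewrite vanish // (T0 _ _ _ _ _ _ cW).
  have -> : d = 0 by apply/(tr_D0 tr Dd).
  rewrite vanish // !add0r; case: (boolP b) => [/c0' h|nb]; last exact: (car_T0 cV).
  by rewrite vanish // (T0 _ _ _ _ _ _ cV).
- move=> _ v w v' w' [n1 [kd1 [x1 [x1' [[g1 g1' E] ->]]]]] vw vw'.
  have Xi d : (d < n1)%N -> X (kd1 d) (x1 d) by move=> dn; apply: g1.1; rewrite mem_iota.
  have Xi' d : (d < n1)%N -> X' (kd1 d) (x1' d) by move=> dn; apply: g1'.1; rewrite mem_iota.
  have pE e : forall p q, p \in mpairs DD T T' n1 x1 x1' -> q \in mpairs DD T T' n1 x1 x1' ->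
      pen e p.1 q.1 = pen e p.2 q.2.
    have tE a c : (a < n1)%N -> (c < n1)%N -> [/\ pen e (x1 a) (x1 c) = pen e (x1' a) (x1' c),
        pen e (T (x1 a)) (x1 c) = pen e (T' (x1' a)) (x1' c) &
        pen e (T (x1 a)) (T (x1 c)) = pen e (T' (x1' a)) (T' (x1' c))].
      move=> an cn; apply: (tr_form tr e (Xi a an) (Xi c cn) (Xi' a an) (Xi' c cn)).
      by move=> i mi; exact: E.
    have dE p a : p \in DD -> (a < n1)%N -> [/\ pen e p.1 (x1 a) = 0,
        pen e p.1 (T (x1 a)) = 0, pen e p.2 (x1' a) = 0 & pen e p.2 (T' (x1' a)) = 0].
      move=> pD an; have [-> ->] := tr_DX tr e pD (Xi a an).
      by have [-> ->] := tr_DX' tr e pD (Xi' a an).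
    move=> p q; rewrite !mem_cat .
    move=> /or3P[pD|/mapP[a /[!mem_iota] an ->]|/mapP[a /[!mem_iota] an ->]]
      /or3P[qD|/mapP[c /[!mem_iota] cn ->]|/mapP[c /[!mem_iota] cn ->]] /=.
    - by rewrite (tr_DD tr).
    - by have [-> _ -> _] := dE p c pD cn.
    - by have [_ -> _ ->] := dE p c pD cn.
    - by rewrite penC [RHS]penC; have [-> _ -> _] := dE q a qD an.
    - by have [->] := tE _ _ an cn.
    - by rewrite penC [RHS]penC; have [_ ->] := tE _ _ cn an.
    - by rewrite penC [RHS]penC; have [_ -> _ ->] := dE q a qD an.
    - by have [_ ->] := tE _ _ an cn.
    - by have [_ _ ->] := tE _ _ an cn.
  by split; apply: (pen_lspan (pE _)).
- move=> _ v [n1 [kd1 [x1 [x1' [m1 ->]]]]].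
  have [n2 [kd2 [x2 [x2' [n12 x12 m2 vx]]]]] := matching_extend v cV cW m1.
  exists (mpairs DD T T' n2 x2 x2'); split; first by exists n2, kd2, x2, x2'.
    by apply: sub_mpairs n12 _ => i /x12[].
  by apply: lspan_fstP; rewrite fstE.
- move=> _ w [n1 [kd1 [x1 [x1' [m1 ->]]]]].
  have [n2 [kd2 [x2' [x2 [n12 x12 m2 vx]]]]] := matching_extend w cW cV (matching_sym m1).
  exists (mpairs DD T T' n2 x2 x2'); split.
  - by exists n2, kd2, x2, x2'; split=> //; exact: matching_sym.
  - by apply: sub_mpairs n12 _ => i /x12[].
  have [v] : exists v, lspan (mpairs (map (@swap _ _) DD) T' T n2 x2' x2) (w, v).
    apply: lspan_fstP; rewrite /mpairs !map_cat -!map_comp.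
    by rewrite (eq_map (g := snd)) //.
  rewrite -sndE => /lspan_swap; rewrite -map_comp (eq_map (g := id)) ?map_id => [|[]//].
  by exists v.
- by exists n, kd, x, x'.
by exists f.
Qed.

End Matching.
End Carrier.

(** * Linear oligomorphy *)

Section FiniteDimension.
Variables (k : fieldType) (V : lmodType k).

Lemma lin_independent_fin (I : finType) (b : I -> V) :
  lin_independent b <-> forall c : I -> k, \sum_i c i *: b i = 0 -> forall i, c i = 0.
Proof.
split=> [bi c c0 i|bi s c us cs i si].
  by apply: (bi _ c (index_enum_uniq I)) => //; exact: mem_index_enum.
have := bi (fun i => if i \in s then c i else 0) _ i; rewrite si; apply.
rewrite -[RHS]cs (big_uniq _ us) [RHS]big_mkcond /=.
by apply: eq_bigr => j _; case: ifP => //; rewrite scale0r.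
Qed.

Lemma lspan_basis (s : seq V) : exists d (b : 'I_d -> V), is_basis (lspan s) b.
Proof.
elim: s => [|x s [d [b [bs bi sb]]]].
  exists 0%N, (fun=> 0); split=> //= [|v ->]; last by exists [::], (fun=> 0); rewrite big_nil.
  by apply/lin_independent_fin => c _ [].
have [xs|xs] := pselect (lspan s x).
  have E : lspan (x :: s) = lspan s.
    apply/seteqP; split; apply: lspan_min; try exact: lspan_subsp.
      by move=> y; rewrite inE => /predU1P[->//|]; exact: lspan_mem.
    by move=> y ys; apply: lspan_mem; rewrite inE ys orbT.
  by exists d, b; rewrite E.
pose b' (i : 'I_d.+1) := if unlift ord0 i is Some j then b j else x.
have b'0 : b' ord0 = x by rewrite /b' unlift_none.
have b'l j : b' (lift ord0 j) = b j by rewrite /b' liftK.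
exists d.+1, b'; split.
- move=> i; case: (unliftP ord0 i) => [j ->|->]; last first.
    by rewrite b'0; apply: lspan_mem; rewrite mem_head.
  rewrite b'l; apply: lspan_sub (bs j) => y ys; by rewrite inE ys orbT.
- apply/lin_independent_fin => c; rewrite big_ord_recl b'0.
  under eq_bigr do rewrite b'l.
  move=> c0; have c00 : c ord0 = 0.
    apply: contrapT => /eqP c00; apply: xs.
    have -> : x = - (c ord0)^-1 *: \sum_i c (lift ord0 i) *: b i.
      move/eqP: c0; rewrite addr_eq0 => /eqP c0.
      by rewrite scaleNr -scalerN -c0 scalerA mulVf // scale1r.
    apply: subspZ; first exact: lspan_subsp.
    by apply: subsp_lcomb => //; exact: lspan_subsp.
  move: c0; rewrite c00 scale0r add0r => c0 i.
  case: (unliftP ord0 i) => [j ->|->//].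
  by have /lin_independent_fin := bi; move=> /(_ (fun j => c (lift ord0 j)) c0 j).
- move=> v [a /sb[t [c vE]]]; exists (ord0 :: map (lift ord0) t).
  exists (fun i => if unlift ord0 i is Some j then c j else a).
  rewrite big_cons unlift_none b'0 big_map.
  under eq_bigr do rewrite liftK b'l.
  by rewrite -vE addrC subrK.
Qed.

Lemma lspan_finite_dim (s : seq V) : finite_dim_subspace (lspan s).
Proof.
have [d [b bb]] := lspan_basis s; exists d; split; last by exists b.
by apply/subspP; exact: lspan_subsp.
Qed.

End FiniteDimension.

Section Oligomorphic.
Variables (k : closedFieldType) (J I : finType) (m : J -> J -> pred I).
Hypothesis mC : forall j l i, m j l i = m l j i.
Hypothesis two_neq0 : 2%:R != 0 :> k.

Section FixedLength.
Variables (V : lmodType k) (X N : J -> set V) (F : I -> V -> V -> k).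
Hypothesis sys : system m X N F.

(** The box E is spanned by isotropic, mutually orthogonal vectors y_a, and by vectors z_(a,b,i)
    of the kind of y_a, isotropic, mutually orthogonal and dual to y_b for F_i.  Adding to y_a
    multiples of the z_(a,b,i) with b <= a realizes every Gram matrix. *)
Lemma gram_box L (kd : 'I_L -> J) : exists E : seq V,
  forall t : I -> 'I_L -> 'I_L -> k,
    (forall i a c, m (kd a) (kd c) i -> t i a c = t i c a) ->
  exists x : 'I_L -> V, [/\ good X N kd (enum 'I_L) x,
    forall a c i, m (kd a) (kd c) i -> F i (x a) (x c) = t i a c &
    forall a, lspan E (x a)].
Proof.
pose A : finType := ('I_L + 'I_L * 'I_L * I)%type.
pose kdA (a : A) := match a with inl a => kd a | inr (a, _, _) => kd a end.
pose g i (p q : A) : k := match p, q with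
  | inl a, inr (_, c, i') => ((a == c) && (i == i'))%:R
  | inr (_, c, i'), inl a => ((a == c) && (i == i'))%:R
  | _, _ => 0 end.
have [|||//|h [_ [hX hN] hF]] := extends_family mC sys (extends_all mC two_neq0 sys)
  (kd := kdA) (s := [::]) (t := enum A) (x := fun=> 0) (g := g).
- by rewrite cats0 enum_uniq.
- by split.
- by move=> i [a|[[a c] i']] [a'|[[a' c'] i'']].
have inA p : p \in enum A by rewrite mem_enum.
have inA' p : p \in enum A ++ [::] by rewrite cats0 mem_enum.
have Xh p : X (kdA p) (h p) by exact: hX.
exists (map h (enum A)) => t tC.
pose s (a c : 'I_L) (i : I) : k := if (c < a)%N then t i a c else if c == a then t i a a / 2%:R else 0.
pose z (a : 'I_L) := \sum_c \sum_i s a c i *: h (inr (a, c, i)).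
have Xz a : X (kd a) (z a).
  apply: subsp_sum => [|c _]; first exact: sys_X sys (kd a).
  by apply: subsp_lcomb => [|i _ _]; [exact: sys_X sys (kd a) | exact: (Xh (inr (a, c, i)))].
have Xx a : X (kd a) (h (inl a) + z a).
  by apply: subspD => //; [exact: sys_X sys (kd a) | exact: (Xh (inl a))].
have Fz i v a : F i v (z a) = \sum_c \sum_i' s a c i' * F i v (h (inr (a, c, i'))).
  rewrite lin1_bigsum; last exact: sys_lin sys i v.
  by apply: eq_bigr => c _; rewrite lin1_sum //; exact: sys_lin sys i v.
have Fyz i a c : m (kd a) (kd c) i -> F i (h (inl a)) (z c) = s c a i.
  move=> mi; rewrite Fz (bigD1 a) //= (bigD1 i) //= hF ?orbT //= !eqxx mulr1.
  rewrite big1 => [|i' ii']; last first.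
    by rewrite hF ?orbT //= eq_sym (negbTE ii') andbF mulr0.
  rewrite big1 => [|d da]; first by rewrite !addr0.
  by apply: big1 => i' _; rewrite hF ?orbT //= eq_sym (negbTE da) mulr0.
exists (fun a => h (inl a) + z a); split.
- split=> [a _ //|j c Nc a _ ka].
  have := hN j (fun p => match p with inl a => c a | inr (a, b, i) => c a * s a b i end).
  move=> /(_ _ (inl a) (inA' _) ka); apply; rewrite cats0 big_enum_cond /=.
  congr (N j _): Nc; rewrite big_enum_cond /= big_sumType /=.
  under eq_bigr do rewrite scalerDr; rewrite big_split /=; congr (_ + _).
  transitivity (\sum_(a | kd a == j) \sum_b \sum_i (c a * s a b i) *: h (inr (a, b, i))).
    apply: eq_bigr => d _; rewrite scaler_sumr; apply: eq_bigr => b _.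
    by rewrite scaler_sumr; apply: eq_bigr => i _; rewrite scalerA.
  rewrite pair_big_dep pair_big_dep /=.
  by apply: eq_big => [[[? ?] ?]|[[? ?] ?] _] //=; rewrite ?andbT.
- move=> a c i mi; have mi' : m (kd c) (kd a) i by rewrite mC.
  rewrite lin1D; last exact: sys_lin sys _ _.
  rewrite (sys_sym sys i (Xx a) (Xh (inl c))) (sys_sym sys i (Xx a) (Xz c)).
  rewrite !lin1D; try exact: sys_lin sys _ _.
  rewrite hF ?inA ?orbT //= add0r Fyz //.
  rewrite (sys_sym sys i (Xz c) (Xh (inl a))) Fyz //.
  rewrite Fz big1 ?addr0 => [|d _]; last first.
    apply: big1 => i' _; rewrite (sys_sym sys i (Xz c) (Xh (inr (a, d, i')))) Fz big1 ?mulr0 // => d' _.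
    by apply: big1 => i'' _; rewrite hF ?orbT //= mulr0.
  rewrite /s; case: (ltngtP a c) => [ac|ca|/val_inj ->].
  + by rewrite -(inj_eq val_inj) (gtn_eqF ac) add0r tC.
  + by rewrite -(inj_eq val_inj) (gtn_eqF ca) addr0.
  + by rewrite eqxx -mulr2n -(mulr_natr (_ / _)) divfK.
- move=> a; apply: subspD; first exact: lspan_subsp.
    by apply: lspan_mem; exact: map_f.
  apply: subsp_sum => [|c _]; first exact: lspan_subsp.
  apply: subsp_lcomb => [|i _ _]; first exact: lspan_subsp.
  by apply: lspan_mem; exact: map_f.
Qed.

(** There are finitely many patterns of kinds, so one box serves them all. *)
Lemma gram_box_nat L : exists E : seq V,
  forall (kd : nat -> J) (t : I -> nat -> nat -> k),
    (forall i a c, (a < L)%N -> (c < L)%N -> m (kd a) (kd c) i -> t i a c = t i c a) ->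
  exists x : nat -> V, [/\ good X N kd (iota 0 L) x,
    forall a c i, (a < L)%N -> (c < L)%N -> m (kd a) (kd c) i -> F i (x a) (x c) = t i a c &
    forall a, (a < L)%N -> lspan E (x a)].
Proof.
have /choice[E EP] := fun kd : {ffun 'I_L -> J} => gram_box kd.
exists (flatten [seq E kd | kd <- enum {ffun 'I_L -> J}]) => kd t tC.
pose kdf := [ffun a : 'I_L => kd a].
have [|x [[gX gN] xF xE]] := EP kdf (fun i a c => t i a c).
  by move=> i a c; rewrite !ffunE; exact: tC.
pose y a := if insub a is Some i then x i else 0.
have yE (a : 'I_L) : y a = x a by rewrite /y valK.
exists y; split.
- split=> [a|j c].
    rewrite mem_iota => aL; have := gX (Ordinal aL); rewrite -yE ffunE; apply.
    by rewrite mem_enum.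
  rewrite -[X in iota 0 X]subn0 -/(index_iota 0 L) big_mkord => Nc a.
  rewrite mem_iota subn0 => aL ka.
  have := gN j (fun a => c a); move=> /(_ _ (Ordinal aL)); apply.
  - congr (N j _): Nc; rewrite big_enum_cond /=.
    by apply: eq_big => [d|d _]; rewrite ?ffunE ?yE.
  - by rewrite mem_enum.
  - by rewrite ffunE.
- move=> a c i aL cL mi; have := xF (Ordinal aL) (Ordinal cL) i.
  by rewrite -!yE !ffunE; apply.
- move=> a aL; have := xE (Ordinal aL); rewrite -yE; apply: lspan_sub => v vE.
  by apply/flattenP; exists (E kdf) => //; apply: map_f; rewrite mem_enum.
Qed.

End FixedLength.
(** A basis of W is covered by a good family of bounded length.  A box contains a good family with
    the same Gram matrix, and by homogeneity an automorphism moves the first to the second. *)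
Lemma carrier_oligomorphic M b (j0 : J) (V : biquadratic k) X N (F : I -> V -> V -> k) T D :
  carrier m M b X N F T D ->
  transfer m X F T X F T [seq (d, d) | d <- D] ->
  linearly_oligomorphic (aut_rep V).
Proof.
move=> cV tr d.
have /choice[E EP] := gram_box_nat (car_sys cV).
pose EE := flatten [seq D ++ E L ++ map T (E L) | L <- iota 0 (M * d).+1].
exists (lspan EE); first exact: lspan_finite_dim.
move=> W [sW [w [Ww _ wW]]].
have fstD : map fst [seq (d, d) | d <- D] = D by rewrite -map_comp map_id.
have sndD : map snd [seq (d, d) | d <- D] = D by rewrite -map_comp map_id.
have [n [kd [x [nM gx xw]]]] : exists n kd x, [/\ (n <= M * size (enum 'I_d))%N,
    good X N kd (iota 0 n) x &
    forall i, i \in enum 'I_d -> lspan (contr D T n x) (w i)].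
  elim: (enum 'I_d) => [|i r [n [kd [x [nM gx xw]]]]].
    by exists 0%N, (fun=> j0), (fun=> 0); rewrite muln0; split=> //; split.
  have [n' [kd' [x' [/andP[nn' n'M] x'x gx' xi]]]] := car_cover cV (w i) gx.
  exists n', kd', x'; split=> //.
    by rewrite (leq_trans n'M) // mulnS addnC leq_add2l.
  move=> c; rewrite inE => /predU1P[->//|/xw]; apply: lspan_sub => v.
  rewrite !mem_cat => /or3P[-> //||] /mapP[a].
    rewrite mem_iota => ni ->; have [_ <-] := x'x a ni; apply/or3P/Or32.
    by apply: map_f; rewrite mem_iota (leq_trans ni).
  rewrite mem_iota => ni ->; have [_ <-] := x'x a ni; apply/or3P/Or33.
  by apply/mapP; exists a; rewrite // mem_iota (leq_trans ni).
have [|x' [gx' F' xE]] := EP n kd (fun i a c => F i (x a) (x c)).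
  move=> i a c an cn _; apply: (sys_sym (car_sys cV)); by [apply: gx.1; rewrite mem_iota].
have mt : matching m X N F X N F n kd x x'.
  by split=> // a c i an cn mi; rewrite F'.
rewrite -{1}fstD in cV; have cV' := cV; rewrite fstD -{1}sndD in cV'.
have [f fi fP] := carrier_iso mC two_neq0 cV cV' tr mt.
exists (exist _ f fi : bq_aut V) => _ [v Wv <-] /=.
have : lspan (contr D T n x) v.
  have [s [c ->]] := wW v Wv; apply: subsp_lcomb => [|i _ _]; first exact: lspan_subsp.
  by apply: xw; rewrite mem_enum.
have fstE : map fst (mpairs [seq (d, d) | d <- D] T T n x x') = contr D T n x.
  by rewrite /mpairs /contr !map_cat fstD -!map_comp.
have sndE : map snd (mpairs [seq (d, d) | d <- D] T T n x x') = contr D T n x'.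
  by rewrite /mpairs /contr !map_cat sndD -!map_comp.
rewrite -fstE => /lspan_fstP[u vu]; rewrite (fP _ _ vu).
have := lspan_snd vu; rewrite sndE; apply: lspan_min; first exact: lspan_subsp.
have nin : n \in iota 0 (M * d).+1 by rewrite mem_iota ltnS; move: nM; rewrite size_enum_ord.
have sEE : {subset D ++ E n ++ map T (E n) <= EE}.
  move=> y yE; apply/flattenP; exists (D ++ E n ++ map T (E n)) => //.
  by apply/mapP; exists n.
move=> y; rewrite !mem_cat => /or3P[yD||] /=.
- by apply: lspan_mem; apply: sEE; rewrite mem_cat yD.
- move=> /mapP[a]; rewrite mem_iota => an ->; apply: lspan_sub (xE a an) => z zE.
  by apply: sEE; rewrite !mem_cat zE orbT.
- move=> /mapP[a]; rewrite mem_iota => an ->.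
  have := xE a an; apply: (@lspan_min _ _ _ [set z | lspan EE (T z)]).
    have Tl := car_lin cV; split=> [|e z z' h h'] /=; last by rewrite Tl; apply: (lspan_subsp _).2.
    have := Tl (-1) 0 0; rewrite scaler0 addr0 scaleN1r addNr => ->.
    by case: (lspan_subsp EE).
  move=> z zE; apply: lspan_mem; apply: sEE.
  by rewrite !mem_cat (map_f T zE) !orbT.
Qed.

End Oligomorphic.

(** * Covering a vector by a good family *)

Section Covering.
Variables (k : closedFieldType) (J : finType) (V : biquadratic k) (X N : J -> set V).
Hypothesis sN : forall j, subsp (N j).

Definition prolongs M n kd (x : nat -> V) n' (kd' : nat -> J) x' : Prop :=
  [/\ (n <= n' <= n + M)%N, forall i, (i < n)%N -> kd' i = kd i /\ x' i = x i &
      good X N kd' (iota 0 n') x'].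

Lemma prolongs_trans M1 M2 n1 kd1 x1 n2 kd2 x2 n3 kd3 x3 :
  prolongs M1 n1 kd1 x1 n2 kd2 x2 -> prolongs M2 n2 kd2 x2 n3 kd3 x3 ->
  prolongs (M1 + M2) n1 kd1 x1 n3 kd3 x3.
Proof.
move=> [/andP[n12 n21] x12 _] [/andP[n23 n32] x23 g3]; split=> // [|i i1].
  by rewrite (leq_trans n12) //= addnA (leq_trans n32) // leq_add2r.
by have [-> ->] := x23 i (leq_trans i1 n12); exact: x12.
Qed.

Lemma prolongs_lspan M n kd x n' kd' x' : prolongs M n kd x n' kd' x' ->
  lspan (map x (iota 0 n)) `<=` lspan (map x' (iota 0 n')).
Proof.
move=> [/andP[nn' _] xx' _]; apply: lspan_sub => _ /mapP[i ni ->].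
move: ni; rewrite mem_iota => ni; have [_ <-] := xx' i ni.
by apply: map_f; rewrite mem_iota (leq_trans ni).
Qed.

(** If y is fresh it is appended; otherwise it already is in the span modulo N. *)
Lemma cover_step n kd x j y : good X N kd (iota 0 n) x -> X j y ->
  exists n' kd' x', prolongs 1 n kd x n' kd' x' /\
    exists2 z, lspan (map x' (iota 0 n')) z & N j (y - z).
Proof.
move=> gx Xy.
have iE : iota 0 n.+1 = iota 0 n ++ [:: n] by rewrite -addn1 iotaD.
case: (pselect (fresh N kd (iota 0 n) x j y)) => [fy|].
  pose kd' i := if i == n then j else kd i.
  have kdE i : i \in iota 0 n -> kd' i = kd i.
    by rewrite mem_iota add0n /kd' => /ltn_eqF ->.
  have gx' : good X N kd' (iota 0 n) x.
    case: gx => gX gN; split=> [a ai|l c Nc a ai]; rewrite kdE //; first exact: gX.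
    apply: (gN l) ai; congr (N l _): Nc; rewrite big_seq_cond [RHS]big_seq_cond.
    by apply: eq_bigl => d; apply/andb_id2l => /kdE ->.
  have kn : kd' n = j by rewrite /kd' eqxx.
  exists n.+1, kd', [eta x with n |-> y]; split.
    split; first by rewrite leqnSn addn1 leqnn.
      by move=> i ni; rewrite kdE ?mem_iota //= (ltn_eqF ni).
    have fy' : fresh N kd' (iota 0 n) x (kd' n) y.
      move=> c; rewrite kn => Nc; apply: (fy c); congr (N j _): Nc.
      rewrite big_seq_cond [in RHS]big_seq_cond; congr (_ - _).
      by apply: eq_bigl => d; apply/andb_id2l => /kdE ->.
    rewrite iE; apply: (@good_perm _ _ _ _ _ _ _ (n :: iota 0 n)).
      by rewrite -cat1s perm_catC.
    apply: good_cons => //; first by rewrite mem_iota add0n ltnn.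
    by rewrite kn.
  exists y; last by rewrite subrr; case: (sN j).
  apply: lspan_mem; apply/mapP; exists n; first by rewrite mem_iota add0n ltnSn.
  by rewrite /= eqxx.
move=> /existsNP[c /contrapT Nc]; exists n, kd, x; split.
  by split=> //; rewrite leqnn leq_addr.
exists (\sum_(a <- iota 0 n | kd a == j) c a *: x a) => //.
apply: subsp_lcomb => [|a an _]; first exact: lspan_subsp.
by apply: lspan_mem; exact: map_f.
Qed.

End Covering.

(** * The model spaces *)

Lemma pen_comb (k : fieldType) (e e' f : k * k) : pdet e e' != 0 ->
  exists a b, forall (V : biquadratic k) (u v : V), pen f u v = a * pen e u v + b * pen e' u v.
Proof.
move=> d0; exists ((f.1 * e'.2 - f.2 * e'.1) / pdet e e').
exists ((e.1 * f.2 - e.2 * f.1) / pdet e e') => V u v.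
rewrite ![_ / _ * _]mulrAC -mulrDl; apply: (canRL (mulfK d0)).
by rewrite /pen /pdet; ring.
Qed.

Lemma lspan_image (k : fieldType) (V : lmodType k) (T : V -> V) n (y : nat -> V) z :
  lspan (map y (iota 0 n)) z -> (forall a u v, T (a *: u + v) = a *: T u + T v) ->
  lspan (map (fun i => T (y i)) (iota 0 n)) (T z).
Proof.
move=> + Tl; apply: (@lspan_min _ _ _ [set z | lspan (map (fun i => T (y i)) (iota 0 n)) (T z)]).
  split=> [|a u u' h h'] /=; last by rewrite Tl; apply: (lspan_subsp _).2.
  have := Tl (-1) 0 0; rewrite scaler0 addr0 scaleN1r addNr => ->.
  by case: (lspan_subsp (map (fun i => T (y i)) (iota 0 n))).
by move=> _ /mapP[i ni ->]; apply: lspan_mem; exact: (map_f (fun i => T (y i))).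
Qed.

Definition form2 (k : fieldType) (e e' : k * k) (V : biquadratic k) (i : bool) (u v : V) : k :=
  pen (if i then e' else e) u v.

Section Models.
Variables (k : closedFieldType) (e e' : k * k).
Hypothesis ee' : pdet e e' != 0.
Hypothesis two_neq0 : 2%:R != 0 :> k.

Local Notation F := (form2 e e').
Local Notation formsF V := (@form2 k e e' V).

Lemma form_transfer (V W : biquadratic k) (u v : V) (x y : W) :
  (forall i : bool, F i u v = F i x y) -> forall f, pen f u v = pen f x y.
Proof.
move=> E f; have [a [b ab]] := pen_comb f ee'.
by rewrite !ab; have := E true; have := E false; rewrite /form2 => -> ->.
Qed.

Lemma form_transfer0 (V : biquadratic k) (u v : V) :
  pen e u v = 0 -> pen e' u v = 0 -> forall f, pen f u v = 0.
Proof.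
by move=> E E' f; have [a [b ->]] := pen_comb f ee'; rewrite E E' !mulr0 addr0.
Qed.

(** On A only the second form may be nonzero, and it is nondegenerate there if al holds; on B both
    forms are generic if be holds, and otherwise the first one is while the second vanishes.
    B is infinite dimensional, but A need not be. *)
Record orthogonal_sum (al be : bool) (V : biquadratic k) (A B : set V) : Prop := OrthogonalSum {
  os_A : subsp A;
  os_B : subsp B;
  os_AB : forall v, exists2 a, A a & B (v - a);
  os_A0B : forall x, A x -> B x -> x = 0;
  os_perp : forall a b i, A a -> B b -> F i a b = 0;
  os_Ae : forall x y i, A x -> A y -> ~~ (i && al) -> F i x y = 0;
  os_And : al -> forall x, A x -> (forall y, A y -> F true x y = 0) -> x = 0;
  os_Be' : ~~ be -> forall x y, B x -> B y -> F true x y = 0;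
  os_Bnd : forall x y, B x -> B y ->
    (forall z, B z -> F false x z + F true y z = 0) -> x = 0 /\ (be -> y = 0);
  os_Binf : infmod B [set 0]
}.

Section InfiniteSum.
Variables (al be : bool).

Let mask (j l : bool) (i : bool) := (j == l) && (if j then i && al else i ==> be).

Let maskC j l i : mask j l i = mask l j i.
Proof. by rewrite /mask eq_sym; case: eqP => // ->. Qed.

Let X (V : biquadratic k) (A B : set V) (j : bool) := if j then A else B.
Let N (V : biquadratic k) (j : bool) : set V := [set 0].

Lemma F_lin (V : biquadratic k) i (u : V) : lin1 (F i u).
Proof. exact: pen_linr. Qed.

Lemma F_sym (V : biquadratic k) i (u v : V) : F i u v = F i v u.
Proof. exact: penC. Qed.

Lemma orthogonal_sum_carrier (V : biquadratic k) (A B : set V) :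
  orthogonal_sum al be A B -> infmod A [set 0] ->
  carrier mask 2 false (X A B) (@N V) (formsF V) (fun=> 0) [::].
Proof.
move=> os infA; split.
- split.
  + by case; [exact: os_A os | exact: os_B os].
  + by move=> j; exact: subsp0.
  + by move=> i x; exact: F_lin.
  + by move=> *; exact: F_sym.
  + move=> l u Xu _ E j i /andP[/eqP -> {j}] mi.
    have {}E y : X A B l y -> \sum_(i | mask l l i) F i (u l i) y = 0.
      move=> Xy; rewrite -[RHS](E y Xy) [RHS](bigD1 l) //= [X in _ + X]big1 ?addr0 // => j jl.
      by rewrite big1 // => i' /andP[]; rewrite (negbTE jl).
    case: l u Xu E mi => u Xu E mi.
      have /andP[it alt] := mi; apply: (os_And os alt); first exact: (Xu true i).
      move=> y Ay; have := E y Ay; rewrite big_mkcond big_bool /mask /= alt addr0.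
      by rewrite it.
    pose y' := if be then u false true else 0.
    have By' : B y' by rewrite /y'; case: ifP => _; [exact: (Xu false true) | exact: (os_B os).1].
    have [z Bz|x0 y0] := os_Bnd os (Xu false false) By'.
      have := E z Bz; rewrite big_mkcond big_bool /mask /= /y' => <-; rewrite addrC.
      by case: be => //=; rewrite (F_sym true 0 z) (lin1_0 (F_lin true z)).
    by case: i mi => //= hbe; have := y0 hbe; rewrite /y' hbe.
  + by case => //; exact: os_Binf os.
- by move=> a u v; rewrite scaler0 addr0.
- move=> n kd x v gx; have [a Aa Bva] := os_AB os v.
  have sN j : subsp (@N V j) by exact: subsp0.
  have [n1 [kd1 [x1 [p1 [z1 z1s /= z1a]]]]] := cover_step (j := true) sN gx Aa.
  have [_ _ g1] := p1.
  have [n2 [kd2 [x2 [p2 [z2 z2s /= z2b]]]]] := cover_step (j := false) sN g1 Bva.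
  exists n2, kd2, x2.
  have [h1 h2 h3] := prolongs_trans p1 p2; split=> //.
  rewrite /contr /= -(subrK a v) (subr0_eq z2b) (subr0_eq z1a); apply: subspD.
  + exact: lspan_subsp.
  + by apply: lspan_sub z2s => y ys; rewrite mem_cat ys.
  + apply: (lspan_sub (s := map x2 (iota 0 n2))) => [y ys|]; first by rewrite mem_cat ys.
    exact: prolongs_lspan p2 _ z1s.
- move=> n kd x [gX gN] d c c' /= -> ; rewrite add0r addr0 => E; split=> // i ni.
  have ki j : \sum_(i <- iota 0 n | kd i == j) c i *: x i = 0.
    have XS l : X A B l (\sum_(i <- iota 0 n | kd i == l) c i *: x i).
      apply: subsp_lcomb; first by case: l; [exact: os_A os | exact: os_B os].
      by move=> a an /eqP <-; exact: gX.
    have E' : \sum_(i <- iota 0 n | kd i == true) c i *: x i +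
              \sum_(i <- iota 0 n | kd i == false) c i *: x i = 0.
      by rewrite -[RHS]E [RHS](partition_big kd xpredT) //= big_bool.
    have A0 : \sum_(i <- iota 0 n | kd i == true) c i *: x i = 0.
      apply: (os_A0B os); first exact: (XS true).
      move/eqP: E'; rewrite addr_eq0 => /eqP ->.
      by apply: subspN; [exact: os_B os | exact: (XS false)].
    by case: j => //; move: E'; rewrite A0 add0r.
  by have := gN (kd i) c (ki _) i; rewrite mem_iota => /(_ ni erefl).
- by [].
Qed.

Lemma orthogonal_sum_transfer (V W : biquadratic k) (A B : set V) (A' B' : set W) :
  orthogonal_sum al be A B -> orthogonal_sum al be A' B' ->
  transfer mask (X A B) (formsF V) (fun=> 0) (X A' B') (formsF W) (fun=> 0) [::].
Proof.
move=> os os'; split=> //; last by move=> d d' /= [-> ->].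
move=> f j l x y x' y' Xx Xy Xx' Xy' E.
have {}E (i : bool) : F i x y = F i x' y'.
  have [mi|nmi] := boolP (mask j l i); first exact: E.
  have vanish (U : biquadratic k) (C D : set U) u v : orthogonal_sum al be C D ->
      X C D j u -> X C D l v -> F i u v = 0.
    move: nmi; rewrite /mask => nmi o; case: j l nmi {Xx Xy Xx' Xy' E} => [] [] /= nmi Xu Xv.
    - exact: (os_Ae o).
    - exact: (os_perp o).
    - by rewrite F_sym; exact: (os_perp o).
    - by case: i nmi => // nbe; exact: (os_Be' o).
  by rewrite (vanish _ A B) ?(vanish _ A' B').
split; first exact: form_transfer.
  by rewrite penC [RHS]penC !lin1_0 //; exact: pen_linr.
by rewrite !lin1_0 //; exact: pen_linr.
Qed.

Lemma orthogonal_sum_iso (V W : biquadratic k) (A B : set V) (A' B' : set W) :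
  orthogonal_sum al be A B -> infmod A [set 0] ->
  orthogonal_sum al be A' B' -> infmod A' [set 0] -> @isomorphic k V W.
Proof.
move=> os iA os' iA'.
have [|f fi _] := carrier_iso (DD := [::]) maskC two_neq0 (orthogonal_sum_carrier os iA)
  (orthogonal_sum_carrier os' iA') (orthogonal_sum_transfer os os')
  (n := 0) (kd := fun=> true) (x := fun=> 0) (x' := fun=> 0); first by split.
by exists f.
Qed.

Lemma orthogonal_sum_oligo (V : biquadratic k) (A B : set V) :
  orthogonal_sum al be A B -> infmod A [set 0] -> linearly_oligomorphic (aut_rep V).
Proof.
move=> os iA; apply: (carrier_oligomorphic maskC two_neq0 true (orthogonal_sum_carrier os iA)).
exact: orthogonal_sum_transfer.
Qed.

End InfiniteSum.
Section FiniteSum.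
Variables (al be : bool).

Let mask (_ _ : unit) (i : bool) := i ==> be.

Let maskC j l i : mask j l i = mask l j i. Proof. by []. Qed.

Let X (V : biquadratic k) (B : set V) (_ : unit) := B.
Let N (V : biquadratic k) (_ : unit) : set V := [set 0].

(** A finite dimensional A cannot be a space of a system; a basis of it is used as the list of
    fixed vectors. *)
Lemma finite_sum_carrier (V : biquadratic k) (A B : set V) D :
  orthogonal_sum al be A B -> A = lspan D ->
  carrier mask 1 false (X B) (@N V) (formsF V) (fun=> 0) D.
Proof.
move=> os AD; split.
- split.
  + by move=> j; exact: os_B os.
  + by move=> j; exact: subsp0.
  + by move=> i x; exact: F_lin.
  + by move=> *; exact: F_sym.
  + move=> l u Xu _ E j i mi; have -> : j = tt by case: j {mi}.
    pose y' := if be then u tt true else 0.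
    have By' : B y' by rewrite /y'; case: ifP => _; [exact: (Xu tt true) | exact: (os_B os).1].
    have [z Bz|x0 y0] := os_Bnd os (Xu tt false) By'.
      have := E z Bz; rewrite (bigD1 tt) //= [X in _ + X]big1 ?addr0; last by case.
      rewrite big_mkcond big_bool /mask /= /y' => <-; rewrite addrC.
      by case: be => //=; rewrite (F_sym true 0 z) (lin1_0 (F_lin true z)).
    by case: i mi => //= hbe; have := y0 hbe; rewrite /y' hbe.
  + by move=> j; exact: os_Binf os.
- by move=> a u v; rewrite scaler0 addr0.
- move=> n kd x v gx; have [a Aa Bva] := os_AB os v.
  have sN j : subsp (@N V j) by exact: subsp0.
  have [n1 [kd1 [x1 [p1 [z1 z1s /= z1a]]]]] := cover_step (j := tt) sN gx Bva.
  exists n1, kd1, x1; have [h1 h2 h3] := p1; split=> //.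
  rewrite /contr -(subrK a v) (subr0_eq z1a) addrC; apply: subspD; first exact: lspan_subsp.
    by move: Aa; rewrite AD; apply: lspan_sub => y yD; rewrite mem_cat yD.
  by apply: lspan_sub z1s => y ys; rewrite !mem_cat ys orbT.
- move=> n kd x [gX gN] d c c' Dd; rewrite addr0 => E.
  have BS : B (\sum_(i <- iota 0 n) c i *: x i).
    by apply: subsp_lcomb => [|a an _]; [exact: os_B os | exact: gX].
  have d0 : d = 0.
    apply: (os_A0B os); first by rewrite AD.
    move/eqP: E; rewrite addr_eq0 => /eqP ->.
    by apply: subspN => //; exact: os_B os.
  split=> // i ni; have := gN tt c _ i; rewrite mem_iota; apply=> //; last by case: (kd i).
  rewrite /N /= -[RHS]E d0 add0r; apply: eq_bigl => j.
  by case: (kd j).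
- by [].
Qed.

Lemma finite_sum_transfer (V W : biquadratic k) (A B : set V) (A' B' : set W) DD :
  orthogonal_sum al be A B -> orthogonal_sum al be A' B' ->
  A = lspan (map fst DD) -> A' = lspan (map snd DD) ->
  (forall p q i, p \in DD -> q \in DD -> F i p.1 q.1 = F i p.2 q.2) ->
  (forall v w, lspan DD (v, w) -> v = 0 <-> w = 0) ->
  transfer mask (X B) (formsF V) (fun=> 0) (X B') (formsF W) (fun=> 0) DD.
Proof.
move=> os os' AD AD' FD D0; split=> //.
- move=> f j l x y x' y' Xx Xy Xx' Xy' E.
  have {}E (i : bool) : F i x y = F i x' y'.
    have [mi|nmi] := boolP (mask j l i); first exact: E.
    by case: i nmi {E} => //; rewrite /mask /= => nbe; rewrite (os_Be' os) // (os_Be' os').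
  split; first exact: form_transfer.
    by rewrite penC [RHS]penC !lin1_0 //; exact: pen_linr.
  by rewrite !lin1_0 //; exact: pen_linr.
- by move=> f p q pD qD; apply: form_transfer => i; exact: FD.
- move=> f p j x pD Bx; split; last by rewrite lin1_0 //; exact: pen_linr.
  have Ap : A p.1 by rewrite AD; apply: lspan_mem; exact: map_f.
  by apply: form_transfer0; [exact: (os_perp os false) | exact: (os_perp os true)].
- move=> f p j x pD Bx; split; last by rewrite lin1_0 //; exact: pen_linr.
  have Ap : A' p.2 by rewrite AD'; apply: lspan_mem; exact: map_f.
  by apply: form_transfer0; [exact: (os_perp os' false) | exact: (os_perp os' true)].
Qed.

Lemma finite_sum_iso (V W : biquadratic k) (A B : set V) (A' B' : set W) DD :
  orthogonal_sum al be A B -> orthogonal_sum al be A' B' ->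
  A = lspan (map fst DD) -> A' = lspan (map snd DD) ->
  (forall p q i, p \in DD -> q \in DD -> F i p.1 q.1 = F i p.2 q.2) ->
  (forall v w, lspan DD (v, w) -> v = 0 <-> w = 0) ->
  forall n kd x x', matching mask (X B) (@N V) (formsF V) (X B') (@N W) (formsF W) n kd x x' ->
  exists2 f : V -> W, is_isomorphism f & forall i, (i < n)%N -> f (x i) = x' i.
Proof.
move=> os os' AD AD' FD D0 n kd x x' mt.
have [f fi fP] := carrier_iso (DD := DD) maskC two_neq0 (finite_sum_carrier os AD)
  (finite_sum_carrier os' AD') (finite_sum_transfer os os' AD AD' FD D0) mt.
exists f => // i ni; apply: fP; apply: lspan_mem; rewrite !mem_cat.
by apply/orP; right; apply/orP; left; apply/mapP; exists i; rewrite // mem_iota.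
Qed.

Lemma finite_sum_oligo (V : biquadratic k) (A B : set V) D :
  orthogonal_sum al be A B -> A = lspan D -> linearly_oligomorphic (aut_rep V).
Proof.
move=> os AD; apply: (carrier_oligomorphic maskC two_neq0 tt (finite_sum_carrier os AD)).
apply: (finite_sum_transfer os os).
- by rewrite -map_comp map_id.
- by rewrite -map_comp map_id.
- by move=> _ _ i /mapP[p _ ->] /mapP[q _ ->].
- move=> v w; have : lspan [seq (d, d) | d <- D] `<=` [set p : V * V | p.1 = p.2].
    apply: lspan_min => [|_ /mapP[d _ ->] //]; split=> // a p q /= pe qe.
    by rewrite pe qe.
  by move=> H /H /= ->.
Qed.

End FiniteSum.

Definition kernel (V : biquadratic k) : set V := [set x | forall y, F false x y = 0].

Lemma kernel_subsp (V : biquadratic k) : subsp (@kernel V).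
Proof.
split=> [y|a u v Ku Kv y]; first by rewrite F_sym (lin1_0 (F_lin _ _)).
by rewrite F_sym (F_lin false y) F_sym Ku F_sym Kv mulr0 addr0.
Qed.

(** Here the kernel S of the first form need not have an invariant complement.  The kinds are S
    itself and V, the latter taken modulo S. *)
Record flag_space (ga : bool) (V : biquadratic k) : Prop := FlagSpace {
  fl_nd : ga -> forall x : V, (forall s, kernel s -> F true x s = 0) -> x = 0;
  fl_iso : ~~ ga -> forall x s : V, kernel x -> kernel s -> F true x s = 0;
  fl_perp : ~~ ga -> forall x : V, (forall s, kernel s -> F true x s = 0) -> kernel x;
  fl_free : forall x y : V, (forall z, F false x z + F true y z = 0) -> y = 0;
  fl_inf : infmod [set: V] (@kernel V);
  fl_Sinf : infmod (@kernel V) [set 0]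
}.

Section Flag.
Variable ga : bool.

Let mask (j l : bool) (i : bool) := if i then (j && l) ==> ga else ~~ j && ~~ l.

Let maskC j l i : mask j l i = mask l j i.
Proof. by rewrite /mask andbC [~~ j && _]andbC. Qed.

Let X (V : biquadratic k) (j : bool) : set V := if j then @kernel V else setT.
Let N (V : biquadratic k) (j : bool) : set V := if j then [set 0] else @kernel V.

Lemma flag_carrier (V : biquadratic k) : flag_space ga V ->
  carrier mask 2 false (@X V) (@N V) (formsF V) (fun=> 0) [::].
Proof.
move=> fl.
have sK := kernel_subsp V.
have sN j : subsp (@N V j) by case: j; [exact: subsp0 | exact: sK].
split.
- split.
  + by case; [exact: sK | exact: subspT].
  + exact: sN.
  + by move=> i x; exact: F_lin.
  + by move=> *; exact: F_sym.
  + move=> l u Xu Nu E.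
    have {}E y : X l y -> (if mask true l true then F true (u true true) y else 0) +
        (if mask true l false then F false (u true false) y else 0) +
        ((if mask false l true then F true (u false true) y else 0) +
        (if mask false l false then F false (u false false) y else 0)) = 0.
      move=> Xy; rewrite -[RHS](E y Xy) big_bool; congr (_ + _).
        by rewrite big_mkcond big_bool.
      by rewrite [RHS]big_mkcond big_bool.
    case: l E => E.
      have u1 : u false true = 0 /\ (ga -> u true true = 0).
        case: (boolP ga) => g.
          have E0 : u true true + u false true = 0.
            apply: (fl_nd fl g) => s Ks; have := E s Ks; rewrite /mask /= g !addr0.
            by rewrite ![F true _ s]F_sym (lin1D _ _ (F_lin true s)).
          have f0 : u false true = 0.
            apply: Nu; move/eqP: E0; rewrite addrC addr_eq0 => /eqP ->.
            exact: (subspN sK (Xu true true)).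
          by split=> // _; move: E0; rewrite f0 addr0.
        split=> //; apply: Nu; apply: (fl_perp fl g) => s Ks.
        by have := E s Ks; rewrite /mask /= (negbTE g) !addr0 add0r.
      by case=> [] [] //= mi; [exact: (u1.2 mi) | exact: u1.1].
    have E0 z : F false (u false false) z + F true (u true true + u false true) z = 0.
      have := E z Logic.I; rewrite /mask /= !addr0 => <-.
      rewrite [F true (_ + _) z]F_sym (lin1D _ _ (F_lin true z)) ![F true z _]F_sym.
      by rewrite [LHS]addrC [RHS]addrA.
    have {}E0 := fl_free fl E0.
    have f0 : u false true = 0.
      apply: Nu; move/eqP: E0; rewrite addrC addr_eq0 => /eqP ->.
      exact: (subspN sK (Xu true true)).
    have t0 : u true true = 0 by move: E0; rewrite f0 addr0.
    case=> [] [] //= mi; apply: Nu => z; have := E z Logic.I.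
    rewrite /mask /= f0 t0 ![F true 0 z]F_sym (lin1_0 (F_lin true z)).
    by rewrite !add0r.
  + by case; [exact: fl_Sinf fl | exact: fl_inf fl].
- by move=> a u v; rewrite scaler0 addr0.
- move=> n kd x v gx.
  have [n1 [kd1 [x1 [p1 [z1 z1s /= z1a]]]]] := cover_step (X := @X V) (j := false) (y := v) sN gx Logic.I.
  have [_ _ g1] := p1.
  have [n2 [kd2 [x2 [p2 [z2 z2s /= z2b]]]]] := cover_step (j := true) sN g1 z1a.
  exists n2, kd2, x2.
  have [h1 h2 h3] := prolongs_trans p1 p2; split=> //.
  rewrite /contr /= -(subrK z1 v) (subr0_eq z2b); apply: subspD.
  + exact: lspan_subsp.
  + by apply: lspan_sub z2s => y ys; rewrite mem_cat ys.
  + apply: (lspan_sub (s := map x2 (iota 0 n2))) => [y ys|]; first by rewrite mem_cat ys.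
    exact: prolongs_lspan p2 _ z1s.
- move=> n kd x [gX gN] d c c' /= -> ; rewrite add0r addr0 => E; split=> // i ni.
  have E' : \sum_(i <- iota 0 n | kd i == true) c i *: x i +
            \sum_(i <- iota 0 n | kd i == false) c i *: x i = 0.
    by rewrite -[RHS]E [RHS](partition_big kd xpredT) //= big_bool.
  have KS : kernel (\sum_(i <- iota 0 n | kd i == true) c i *: x i).
    apply: subsp_lcomb => // a an /eqP ka; have := gX a an; by rewrite ka.
  have NS : N false (\sum_(i <- iota 0 n | kd i == false) c i *: x i).
    move/eqP: E'; rewrite addrC addr_eq0 => /eqP ->; exact: (subspN sK KS).
  have cf a : a \in iota 0 n -> kd a = false -> c a = 0 by exact: gN NS a.
  have NS' : N true (\sum_(i <- iota 0 n | kd i == true) c i *: x i).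
    move: E'; rewrite [X in _ + X]big_seq_cond [X in _ + X]big1 ?addr0 // => a /andP[an /eqP ka].
    by rewrite cf // scale0r.
  have := mem_iota 0 n i; rewrite add0n ni /= => an.
  by case ki: (kd i); [exact: gN NS' _ an ki | exact: cf].
- by [].
Qed.

Lemma flag_transfer (V W : biquadratic k) : flag_space ga V -> flag_space ga W ->
  transfer mask (@X V) (formsF V) (fun=> 0) (@X W) (formsF W) (fun=> 0) [::].
Proof.
move=> fV fW; split=> //; last by move=> d d' /= [-> ->].
move=> f j l x y x' y' Xx Xy Xx' Xy' E.
have {}E (i : bool) : F i x y = F i x' y'.
  have [mi|nmi] := boolP (mask j l i); first exact: E.
  have vanish (U : biquadratic k) (u v : U) : flag_space ga U -> X j u -> X l v -> F i u v = 0.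
    move=> fU; move: nmi; rewrite /mask; case: i {E}.
      rewrite negb_imply => /andP[/andP[-> ->] g]; exact: (fl_iso fU g).
    by case: j l {Xx Xy Xx' Xy'} => [] [] //= _ Xu Xv; rewrite 1?F_sym.
  by rewrite !vanish.
split; first exact: form_transfer.
  by rewrite penC [RHS]penC !lin1_0 //; exact: pen_linr.
by rewrite !lin1_0 //; exact: pen_linr.
Qed.

Lemma flag_iso (V W : biquadratic k) : flag_space ga V -> flag_space ga W -> isomorphic V W.
Proof.
move=> fV fW.
have [|f fi _] := carrier_iso (DD := [::]) maskC two_neq0 (flag_carrier fV)
  (flag_carrier fW) (flag_transfer fV fW)
  (n := 0) (kd := fun=> true) (x := fun=> 0) (x' := fun=> 0); first by split.
by exists f.
Qed.

Lemma flag_oligo (V : biquadratic k) : flag_space ga V -> linearly_oligomorphic (aut_rep V).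
Proof.
move=> fV; apply: (carrier_oligomorphic maskC two_neq0 true (flag_carrier fV)).
exact: flag_transfer.
Qed.

End Flag.

(** T has S = kernel as kernel and image, so V is a free module over k[T]/(T^2), and the first
    form is the second one twisted by T.  The family consists of vectors independent modulo S;
    the elements of S are reached as T (x i). *)
Record nil_space (V : biquadratic k) (T : V -> V) : Prop := NilSpace {
  nl_T : forall a u v, T (a *: u + v) = a *: T u + T v;
  nl_eq : forall x z, F false x z = F true (T x) z;
  nl_surj : forall s, kernel s -> exists x, s = T x;
  nl_perp : forall x : V, (forall s, kernel s -> F true x s = 0) -> kernel x;
  nl_rad : forall y : V, (forall z, F true y z = 0) -> y = 0;
  nl_inf : infmod [set: V] (@kernel V)
}.

Section Nil.

Let mask (_ _ : unit) (_ : bool) := true.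
Let maskC j l i : mask j l i = mask l j i. Proof. by []. Qed.
Let X (V : biquadratic k) (_ : unit) : set V := setT.
Let N (V : biquadratic k) (_ : unit) : set V := @kernel V.

Lemma nil_image (V : biquadratic k) T (x : V) : nil_space T -> kernel (T x).
Proof.
move=> nl; apply: (nl_perp nl) => s Ks.
by rewrite -(nl_eq nl) F_sym Ks.
Qed.

Lemma nil_kernel (V : biquadratic k) T (x : V) : nil_space T -> kernel x <-> T x = 0.
Proof.
move=> nl; split=> [Kx|Tx z]; last by rewrite (nl_eq nl) Tx F_sym (lin1_0 (F_lin _ _)).
by apply: (nl_rad nl) => z; rewrite -(nl_eq nl).
Qed.

Lemma nil_carrier (V : biquadratic k) T : nil_space T ->
  carrier mask 2 true (@X V) (@N V) (formsF V) T [::].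
Proof.
move=> nl; have sK := kernel_subsp V.
have sN j : subsp (@N V j) by exact: sK.
have TB u v : T (u - v) = T u - T v.
  by rewrite addrC -scaleN1r (nl_T nl) scaleN1r addrC.
split.
- split=> //.
  + by move=> i x; exact: F_lin.
  + by move=> *; exact: F_sym.
  + move=> l u _ Nu E.
    have {}E y : F true (u tt true) y + F false (u tt false) y = 0.
      rewrite -[RHS](E y Logic.I) [RHS](bigD1 tt) //= [X in _ = _ + X]big1 ?addr0; last by case.
      by rewrite big_bool.
    have u1 : u tt true = 0.
      apply: Nu; apply: (nl_perp nl) => s Ks; have := E s.
      by rewrite [F false _ s]F_sym Ks addr0.
    by case=> [] [] _ //; apply: Nu => y; have := E y; rewrite u1 F_sym (lin1_0 (F_lin _ _)) add0r.
  + by move=> j; exact: nl_inf nl.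
- exact: nl_T nl.
- move=> n kd x v gx.
  have [n1 [kd1 [x1 [p1 [z1 z1s /= z1a]]]]] := cover_step (X := @X V) (j := tt) (y := v) sN gx Logic.I.
  have [w vw] := nl_surj nl z1a.
  have [_ _ g1] := p1.
  have [n2 [kd2 [x2 [p2 [z2 z2s /= z2b]]]]] := cover_step (X := @X V) (j := tt) (y := w) sN g1 Logic.I.
  exists n2, kd2, x2.
  have [h1 h2 h3] := prolongs_trans p1 p2; split=> //.
  move: z2b => /(nil_kernel _ nl); rewrite TB => /subr0_eq Twz.
  rewrite /contr /= -(subrK z1 v) vw Twz; apply: subspD.
  + exact: lspan_subsp.
  + apply: (lspan_sub (s := map (fun i => T (x2 i)) (iota 0 n2))) => [y ys|].
      by rewrite mem_cat ys orbT.
    exact: lspan_image z2s (nl_T nl).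
  + apply: (lspan_sub (s := map x2 (iota 0 n2))) => [y ys|]; first by rewrite mem_cat ys.
    exact: prolongs_lspan p2 _ z1s.
- move=> n kd x [gX gN] d c c' /= -> ; rewrite add0r => E.
  have allt (r : seq nat) (f : nat -> V) : \sum_(i <- r | kd i == tt) f i = \sum_(i <- r) f i.
    by apply: eq_bigl => i; case: (kd i).
  have cf (a : nat -> k) : kernel (\sum_(i <- iota 0 n) a i *: x i) -> forall i, (i < n)%N -> a i = 0.
    move=> Ka i ni; have := gN tt a _ i; rewrite mem_iota allt; apply=> //.
    by case: (kd i).
  have c0 : forall i, (i < n)%N -> c i = 0.
    apply: cf; move/eqP: E; rewrite addr_eq0 => /eqP ->.
    exact: (subspN sK (nil_image _ nl)).
  split=> // _; apply: cf; apply/(nil_kernel _ nl); move: E.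
  rewrite [X in X + _]big_seq_cond [X in X + _]big1 ?add0r // => i.
  by rewrite mem_iota andbT => ni; rewrite c0 ?scale0r.
- by [].
Qed.

Lemma nil_transfer (V W : biquadratic k) (T : V -> V) (T' : W -> W) :
  nil_space T -> nil_space T' ->
  transfer mask (@X V) (formsF V) T (@X W) (formsF W) T' [::].
Proof.
move=> nV nW; split=> //; last by move=> d d' /= [-> ->].
move=> f j l x y x' y' _ _ _ _ E.
have Tf (U : biquadratic k) (S : U -> U) (u v : U) : nil_space S -> F false (S u) v = 0.
  by move=> nU; exact: nil_image nU v.
split; apply: form_transfer => i; first exact: E.
  by case: i; rewrite ?Tf // -(nl_eq nV) -(nl_eq nW) E.
case: i; rewrite ?Tf // -(nl_eq nV) -(nl_eq nW).
by rewrite F_sym [RHS]F_sym !Tf.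
Qed.

Lemma nil_iso (V W : biquadratic k) (T : V -> V) (T' : W -> W) :
  nil_space T -> nil_space T' -> isomorphic V W.
Proof.
move=> fV fW.
have [|f fi _] := carrier_iso (DD := [::]) maskC two_neq0 (nil_carrier fV)
  (nil_carrier fW) (nil_transfer fV fW)
  (n := 0) (kd := fun=> tt) (x := fun=> 0) (x' := fun=> 0); first by split.
by exists f.
Qed.

Lemma nil_oligo (V : biquadratic k) T : @nil_space V T -> linearly_oligomorphic (aut_rep V).
Proof.
move=> fV; apply: (carrier_oligomorphic maskC two_neq0 tt (nil_carrier fV)).
exact: nil_transfer.
Qed.

End Nil.

Section Double.

(** When V = S (+) T S and the first form is the second one twisted by T on S, these four forms
    on S determine both forms of V. *)
Definition dform (V : biquadratic k) (T : V -> V) (i : 'I_4) (x y : V) : k :=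
  match nat_of_ord i with
  | 0%N => F true x y | 1%N => F false x y | 2%N => F false x (T y)
  | _ => F false (T x) (T y) end.

(** Linear relations among the four forms are allowed: those in a are generic, and la expresses
    the others through them. *)
Record double_space (a : pred 'I_4) (la : 'I_4 -> 'I_4 -> k) (V : biquadratic k)
    (S : set V) (T : V -> V) : Prop := DoubleSpace {
  db_S : subsp S;
  db_T : forall a u v, T (a *: u + v) = a *: T u + T v;
  db_eq : forall x z, S x -> F false x z = F true (T x) z;
  db_cover : forall v, exists x y, [/\ S x, S y & v = x + T y];
  db_dir : forall x y, S x -> S y -> x + T y = 0 -> x = 0 /\ y = 0;
  db_comb : forall j x y, S x -> S y ->
    dform T j x y = \sum_(i | a i) la j i * dform T i x y;
  db_nd : forall u : 'I_4 -> V, (forall i, S (u i)) ->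
    (forall y, S y -> \sum_(i | a i) dform T i (u i) y = 0) -> forall i, a i -> u i = 0;
  db_inf : infmod S [set 0]
}.

Variables (a : pred 'I_4) (la : 'I_4 -> 'I_4 -> k).

Let mask (_ _ : unit) (i : 'I_4) := a i.
Let maskC j l i : mask j l i = mask l j i. Proof. by []. Qed.
Let X (V : biquadratic k) (S : set V) (_ : unit) : set V := S.
Let N (V : biquadratic k) (_ : unit) : set V := [set 0].

Lemma double_carrier (V : biquadratic k) (S : set V) T : double_space a la S T ->
  carrier mask 2 true (X S) (@N V) (dform T) T [::].
Proof.
move=> db; have sN j : subsp (@N V j) by exact: subsp0.
split.
- split=> //.
  + by move=> j; exact: db_S db.
  + move=> i x c u v; rewrite /dform; case: (nat_of_ord i) => [|[|[|_]]]; rewrite ?(db_T db);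
    exact: F_lin.
  + move=> i j l x y Sx Sy; rewrite /dform; case: (nat_of_ord i) => [|[|[|_]]]; try exact: F_sym.
    by rewrite (db_eq db _ Sx) F_sym -(db_eq db _ Sy).
  + move=> l u Su _ E [] i ai.
    apply: (db_nd db (u := u tt)) ai => [i'|y Sy]; first exact: (Su tt i').
    by rewrite -[RHS](E y Sy) [RHS](bigD1 tt) //= [X in _ + X]big1 ?addr0; last by case.
  + by move=> j; exact: db_inf db.
- exact: db_T db.
- move=> n kd x v gx; have [y [z [Sy Sz vE]]] := db_cover db v.
  have [n1 [kd1 [x1 [p1 [z1 z1s /= z1a]]]]] := cover_step (j := tt) sN gx Sy.
  have [_ _ g1] := p1.
  have [n2 [kd2 [x2 [p2 [z2 z2s /= z2b]]]]] := cover_step (j := tt) sN g1 Sz.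
  exists n2, kd2, x2.
  have [h1 h2 h3] := prolongs_trans p1 p2; split=> //.
  rewrite /contr /= vE (subr0_eq z2b) (subr0_eq z1a); apply: subspD.
  + exact: lspan_subsp.
  + apply: (lspan_sub (s := map x2 (iota 0 n2))) => [w ys|]; first by rewrite mem_cat ys.
    exact: prolongs_lspan p2 _ z1s.
  + apply: (lspan_sub (s := map (fun i => T (x2 i)) (iota 0 n2))) => [w ys|].
      by rewrite mem_cat ys orbT.
    exact: lspan_image z2s (db_T db).
- move=> n kd x [gX gN] d c c' /= -> ; rewrite add0r => E.
  have allt (r : seq nat) (f : nat -> V) : \sum_(i <- r | kd i == tt) f i = \sum_(i <- r) f i.
    by apply: eq_bigl => i; case: (kd i).
  have SS (b : nat -> k) : S (\sum_(i <- iota 0 n) b i *: x i).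
    by apply: subsp_lcomb => [|i ni _]; [exact: db_S db | exact: gX].
  have cf (b : nat -> k) : \sum_(i <- iota 0 n) b i *: x i = 0 -> forall i, (i < n)%N -> b i = 0.
    move=> Ka i ni; have := gN tt b _ i; rewrite mem_iota allt; apply=> //.
    by case: (kd i).
  have [c0 c'0] := db_dir db (SS c) (SS c') E.
  by split=> //; [exact: cf | move=> _; exact: cf].
- by [].
Qed.

Lemma double_transfer (V W : biquadratic k) S T S' T' :
  @double_space a la V S T -> @double_space a la W S' T' ->
  transfer mask (X S) (dform T) T (X S') (dform T') T' [::].
Proof.
move=> dV dW; split=> //; last by move=> d d' /= [-> ->].
move=> f j l x y x' y' Sx Sy Sx' Sy' E.
have {}E i : dform T i x y = dform T' i x' y'.
  rewrite (db_comb dV i Sx Sy) (db_comb dW i Sx' Sy'); apply: eq_bigr => i' ai.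
  by rewrite E.
have [E0 E1 E2 E3] := And4 (E (inord 0)) (E (inord 1)) (E (inord 2)) (E (inord 3)).
rewrite /dform !inordK // in E0 E1 E2 E3.
split; apply: form_transfer => -[] //.
- by rewrite -(db_eq dV _ Sx) -(db_eq dW _ Sx').
- rewrite F_sym [RHS]F_sym (db_eq dV _ Sy) (db_eq dW _ Sy') F_sym [RHS]F_sym.
  by rewrite -(db_eq dV _ Sx) -(db_eq dW _ Sx').
- by rewrite -(db_eq dV _ Sx) -(db_eq dW _ Sx').
Qed.

Lemma double_iso (V W : biquadratic k) S T S' T' :
  @double_space a la V S T -> @double_space a la W S' T' -> isomorphic V W.
Proof.
move=> fV fW.
have [|f fi _] := carrier_iso (DD := [::]) maskC two_neq0 (double_carrier fV)
  (double_carrier fW) (double_transfer fV fW)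
  (n := 0) (kd := fun=> tt) (x := fun=> 0) (x' := fun=> 0); first by split.
by exists f.
Qed.

Lemma double_oligo (V : biquadratic k) S T :
  @double_space a la V S T -> linearly_oligomorphic (aut_rep V).
Proof.
move=> fV; apply: (carrier_oligomorphic maskC two_neq0 tt (double_carrier fV)).
exact: double_transfer.
Qed.

End Double.

End Models.

(** * Orthonormal systems in universal spaces *)

Section ScaledDot.
Variables (k : fieldType) (n : nat) (a : k).

Definition sdot (u v : 'rV[k]_n) : k := a * \sum_i u 0 i * v 0 i.

Lemma sdotC u v : sdot u v = sdot v u.
Proof. by rewrite /sdot; under eq_bigr do rewrite mulrC. Qed.

Lemma sdot_linr u : lin1 (sdot u).
Proof.
move=> c x y; rewrite /sdot mulrCA -mulrDr; congr (_ * _).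
rewrite mulr_sumr -big_split /=; apply: eq_bigr => i _.
by rewrite !mxE; ring.
Qed.

Lemma sdot_linl v : lin1 (fun u => sdot u v).
Proof. by move=> c x y; rewrite ![sdot _ v]sdotC sdot_linr. Qed.

HB.instance Definition _ := isBilinear.Build k _ _ _ ( *%R ) (idfun \; *%R) sdot
  (fun v x y => lin1B x y (sdot_linl v)) (fun u x y => lin1B x y (sdot_linr u))
  (fun v c x => lin1Z c x (sdot_linl v)) (fun u c x => lin1Z c x (sdot_linr u)).

Lemma sdot_hermitian u v : sdot u v = (-1) ^+ false * idfun (sdot v u).
Proof. by rewrite expr0 mul1r sdotC. Qed.

HB.instance Definition _ :=
  isHermitianSesquilinear.Build k _ false idfun sdot sdot_hermitian.

Definition sdot_symmetric : {symmetric 'rV[k]_n} := sdot.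

Lemma delta_basis : is_basis [set: 'rV[k]_n] (fun i : 'I_n => delta_mx 0 i : 'rV[k]_n).
Proof.
split=> // [|v _].
  apply/lin_independent_fin => c E i.
  have /rowP/(_ i) := E; rewrite !mxE summxE (bigD1 i) //= big1 => [|j ji].
    by rewrite !mxE !eqxx mulr1 addr0.
  by rewrite !mxE eq_sym (negbTE ji) andbF mulr0.
exists (index_enum 'I_n), (fun i => v 0 i); exact: row_sum_delta.
Qed.

Lemma sdot_delta i j : sdot (delta_mx 0 i) (delta_mx 0 j) = a * (i == j)%:R.
Proof.
rewrite /sdot (bigD1 j) //= big1 => [|l lj].
  by rewrite !mxE !eqxx mulr1 addr0 eq_sym.
by rewrite !mxE (negbTE lj) andbF mulr0.
Qed.

End ScaledDot.

Lemma universal_orthonormal (k : fieldType) (V : biquadratic k) : universal V ->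
  forall n (a a' : k), exists x : 'I_n -> V, forall i j,
    bq_omega V (x i) (x j) = a * (i == j)%:R /\ bq_omega' V (x i) (x j) = a' * (i == j)%:R.
Proof.
move=> uV n a a'.
have cd : countable_dim 'rV[k]_n.
  by exists 'I_n, (fun i => delta_mx 0 i); exact: delta_basis.
pose U := @Biquadratic k 'rV[k]_n (sdot_symmetric n a) (sdot_symmetric n a') cd.
have [|f [_ _ f1 f2]] := uV U.
  exists n; split; first by apply/subspP.
  by exists (fun i => delta_mx 0 i); exact: delta_basis.
exists (fun i => f (delta_mx 0 i)) => i j.
by rewrite f1 f2; split; exact: sdot_delta.
Qed.

(** * Conditions that force a model *)

Section Conditions.
Variable k : closedFieldType.
Implicit Types (e : k * k).

Definition linked e e' (V : biquadratic k) (x y : V) : Prop :=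
  forall z, pen e x z = pen e' y z.

Definition radical (V : biquadratic k) : set V :=
  [set x | forall z, bq_omega V x z = 0 /\ bq_omega' V x z = 0].

Definition perp e e' (V : biquadratic k) : set V :=
  [set x | forall s, kernel e e' s -> pen e' x s = 0].

(** The only consequence of universality that the models require. *)
Definition has_orthonormal (V : biquadratic k) : Prop :=
  forall n (a a' : k), exists x : 'I_n -> V, forall i j,
    bq_omega V (x i) (x j) = a * (i == j)%:R /\ bq_omega' V (x i) (x j) = a' * (i == j)%:R.

(** Modulo the radical, which may be zero, the two forms are generic. *)
Definition cond_rad (V : biquadratic k) : Prop :=
  forall x y : V, (forall z, bq_omega V x z + bq_omega' V y z = 0) ->
    radical x /\ radical y.

Record cond_sum e e' (be : bool) (V : biquadratic k) : Prop := CondSum {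
  cs_nd : forall x : V, kernel e e' x -> (forall y, kernel e e' y -> pen e' x y = 0) -> x = 0;
  cs_cover : forall v : V, exists2 s, kernel e e' s & perp e e' (v - s);
  cs_perp : forall x y : V, perp e e' x -> perp e e' y ->
    (forall z, perp e e' z -> pen e x z + pen e' y z = 0) -> x = 0 /\ (be -> y = 0);
  cs_zero : ~~ be -> forall x y : V, perp e e' x -> perp e e' y -> pen e' x y = 0
}.

Record cond_flag e e' (ga : bool) (V : biquadratic k) : Prop := CondFlag {
  cf_nd : ga -> forall x : V, perp e e' x -> x = 0;
  cf_iso : ~~ ga -> forall x : V, kernel e e' x <-> perp e e' x;
  cf_free : forall x y : V, (forall z, pen e x z + pen e' y z = 0) -> y = 0
}.

Record cond_nil e e' (V : biquadratic k) : Prop := CondNil {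
  cn_iso : forall x : V, kernel e e' x <-> perp e e' x;
  cn_rad : forall y : V, (forall z, pen e' y z = 0) -> y = 0;
  cn_tot : forall x : V, exists y, linked e e' x y;
  cn_surj : forall y : V, kernel e e' y -> exists x, linked e e' x y
}.

Definition e0 : k * k := (1, 0).
Definition e1 : k * k := (0, 1).

(** The forms [dform] with T x and T y as separate arguments: T is not a symbol of the language,
    but its graph [linked] is definable. *)
Definition lform (V : biquadratic k) (i : nat) (x tx y ty : V) : k :=
  match i with
  | 0%N => pen e1 x y | 1%N => pen e0 x y | 2%N => pen e0 x ty | _ => pen e0 tx ty end.

Record cond_double (a : pred 'I_4) (la : 'I_4 -> 'I_4 -> k) (V : biquadratic k) : Prop :=
  CondDouble {
  cd_rad : forall y : V, (forall z, pen e1 y z = 0) -> y = 0;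
  cd_cover : forall v : V, exists x tx y ty,
    [/\ linked e0 e1 x tx, linked e0 e1 y ty & v = x + ty];
  cd_dir : forall x tx y ty : V, linked e0 e1 x tx -> linked e0 e1 y ty ->
    x + ty = 0 -> x = 0 /\ y = 0;
  cd_comb : forall (j : 'I_4) (x tx y ty : V), linked e0 e1 x tx -> linked e0 e1 y ty ->
    lform j x tx y ty = \sum_(i | a i) la j i * lform i x tx y ty;
  cd_nd : forall u tu : 'I_4 -> V, (forall i, linked e0 e1 (u i) (tu i)) ->
    (forall y ty, linked e0 e1 y ty -> \sum_(i | a i) lform i (u i) (tu i) y ty = 0) ->
    forall i, a i -> u i = 0
}.

Section Models.
Variable V : biquadratic k.
Hypothesis ortho : has_orthonormal V.

(** A system that is orthonormal for the form e is independent modulo the kernel of e. *)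
Lemma kernel_infmod e e' : e != (0, 0) -> infmod [set: V] (@kernel k e e' V).
Proof.
move=> e_neq0 r.
have [a [a' aa']] : exists a a', e.1 * a + e.2 * a' = 1.
  have [e1_0|e1_0] := eqVneq e.1 0; last by exists e.1^-1, 0; rewrite mulfV // mulr0 addr0.
  exists 0, e.2^-1; rewrite mulr0 add0r mulfV //.
  by apply: contraNneq e_neq0 => e2_0; rewrite [e]surjective_pairing e1_0 e2_0.
have [x xE] := ortho (size r).+1 a a'.
have px i j : pen e (x i) (x j) = (i == j)%:R.
  by have [E E'] := xE i j; rewrite /pen E E' !mulrA -mulrDl aa' mul1r.
apply: contrapT => nw.
have /choice[n nP] i : exists n, kernel e e' n /\ lspan r (x i - n).
  apply: contrapT => nn; apply: nw; exists (x i) => // n Kn xn.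
  by apply: nn; exists n.
have [|i|c [i ci] cE] := @lspan_dep _ _ _ (fun i => x i - n i) r; first exact: ltnSn.
  by case: (nP i).
have Kx : kernel e e' (\sum_i c i *: x i).
  have -> : \sum_i c i *: x i = \sum_i c i *: n i.
    apply/eqP; rewrite -subr_eq0 -sumrB -[X in _ == X]cE; apply/eqP.
    by apply: eq_bigr => j _; rewrite scalerBr.
  by apply: subsp_lcomb => [|j _ _]; [exact: kernel_subsp | case: (nP j)].
case/eqP: ci; have := Kx (x i); rewrite F_sym lin1_sum; last exact: F_lin.
rewrite (bigD1 i) //= big1 => [|j ji]; rewrite /form2 px.
  by rewrite eqxx mulr1 addr0.
by rewrite eq_sym (negbTE ji) mulr0.
Qed.

Lemma pair_neq0 (a b : k) : a != 0 \/ b != 0 -> (a, b) != (0, 0).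
Proof. by case=> h; apply: contraNneq h => -[] ? ?; apply/eqP. Qed.

Lemma pdet_neq0 e e' : pdet e e' != 0 -> e != (0, 0).
Proof. by apply: contraNneq => ->; rewrite /pdet !mul0r subrr. Qed.

Lemma pdet01 : pdet e0 e1 != 0.
Proof. by rewrite /pdet /= mul1r mul0r subr0 oner_neq0. Qed.

Lemma pen_e0 (x y : V) : pen e0 x y = bq_omega V x y.
Proof. by rewrite /pen mul1r mul0r addr0. Qed.

Lemma pen_e1 (x y : V) : pen e1 x y = bq_omega' V x y.
Proof. by rewrite /pen mul1r mul0r add0r. Qed.

(** Every complement of the radical carries two generic forms. *)
Lemma cond_rad_model : cond_rad V ->
  exists B, orthogonal_sum e0 e1 false true (@radical V) B.
Proof.
move=> cr.
have RE (x : V) : radical x <-> forall i z, form2 e0 e1 i x z = 0.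
  split=> [Rx [] z|Rx z]; rewrite /form2.
  - by rewrite pen_e1; case: (Rx z).
  - by rewrite pen_e0; case: (Rx z).
  - by have := Rx true z; have := Rx false z; rewrite /form2 pen_e0 pen_e1.
have sR : subsp (@radical V).
  split=> [|c u v /RE Ru /RE Rv]; apply/RE => i z; rewrite F_sym.
    by rewrite (lin1_0 (F_lin _ _ i z)).
  by rewrite (F_lin e0 e1 i z) F_sym Ru F_sym Rv mulr0 addr0.
have [B [sB BR B0]] := complementP sR.
exists B; split=> //.
- move=> v; have [b Bb Rvb] := BR v; exists (v - b) => //.
  by rewrite opprB addrC subrK.
- by move=> x Rx Bx; exact: B0.
- by move=> a b i /RE Ra _; exact: Ra.
- by move=> x y i /RE Rx _ _; exact: Rx.
- move=> x y Bx By E.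
  have [|Rx Ry] := cr x y.
    move=> z; have [b Bb Rzb] := BR z; rewrite -(subrK b z).
    have -> : bq_omega V x (z - b + b) = bq_omega V x b.
      rewrite -!pen_e0 lin1D; last exact: pen_linr.
      by have /RE/(_ false x) := Rzb; rewrite F_sym /form2 /= => ->; rewrite add0r.
    have -> : bq_omega' V y (z - b + b) = bq_omega' V y b.
      rewrite -!pen_e1 lin1D; last exact: pen_linr.
      by have /RE/(_ true y) := Rzb; rewrite F_sym /form2 /= => ->; rewrite add0r.
    by have := E b Bb; rewrite /form2 pen_e0 pen_e1.
  by split=> [|_]; exact: B0.
- move=> r; have [|w _ wK] := @kernel_infmod e0 e1 _ r; first exact: pdet_neq0 pdet01.
  have [b Bb Rwb] := BR w; exists b => // _ ->; rewrite subr0 => br.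
  apply: (wK (w - b)); last by rewrite opprB addrC subrK.
  by move=> z; have /RE := Rwb; apply.
Qed.

Lemma cond_sum_model e e' be : pdet e e' != 0 -> cond_sum e e' be V ->
  orthogonal_sum e e' true be (@kernel k e e' V) (@perp e e' V).
Proof.
move=> ee' cs; split.
- exact: kernel_subsp.
- split=> [s _|c u v Pu Pv s Ks].
    by rewrite penC lin1_0 //; exact: pen_linr.
  by rewrite pen_linl Pu // Pv // mulr0 addr0.
- exact: cs_cover cs.
- by move=> x Kx Px; apply: (cs_nd cs Kx).
- move=> a b [] Ka Pb; last exact: Ka.
  by rewrite F_sym; exact: Pb.
- by move=> x y [] // Kx Ky _; exact: Kx.
- by move=> _ x Kx; exact: cs_nd cs x Kx.
- by move=> nbe x y; exact: cs_zero cs nbe x y.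
- by move=> x y; exact: cs_perp cs x y.
- move=> r; have [|w _ wK] := @kernel_infmod e e' _ r; first exact: pdet_neq0 ee'.
  have [s Ks Pws] := cs_cover cs w; exists (w - s) => // _ ->; rewrite subr0 => wr.
  exact: wK Ks wr.
Qed.

(** If the kernel S were finite dimensional, some vector outside it would be orthogonal to S. *)
Lemma cond_flag_model e e' ga : pdet e e' != 0 -> cond_flag e e' ga V ->
  flag_space e e' ga V.
Proof.
move=> ee' cf.
have infK : infmod [set: V] (@kernel k e e' V) by apply: kernel_infmod; exact: pdet_neq0 ee'.
split=> //.
- by move=> g x; exact: cf_nd cf g x.
- by move=> g x s /(cf_iso cf g) Px Ks; exact: Px.
- by move=> g x Px; apply/(cf_iso cf g).
- exact: cf_free cf.
- move=> r; apply: contrapT => nw.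
  have Kr s : kernel e e' s -> lspan r s.
    move=> Ks; apply: contrapT => sr; apply: nw; exists s => // _ ->.
    by rewrite subr0.
  have [w [_ wr] wK] := @infmod_ker _ _ _ _ _ r (fun y => form2 e e' true y)
     (subspT V) (fun y => F_lin e e' true y) infK [::].
  have Pw : perp e e' w.
    move=> s /Kr; apply: (@lspan_min _ _ _ [set s | pen e' w s = 0]).
      split=> [|c u v /= Pu Pv] /=; first by rewrite lin1_0 //; exact: pen_linr.
      by rewrite pen_linr Pu Pv mulr0 addr0.
    by move=> t tr /=; rewrite penC; exact: wr.
  case: (boolP ga) => g.
    apply: (wK 0); first by case: (kernel_subsp e e' V).
    by rewrite (cf_nd cf g Pw) subrr.
  by apply: (wK w); [apply/(cf_iso cf g) | rewrite subrr].
Qed.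

Lemma linked_lin e e' (a : k) (x y x' y' : V) : linked e e' x y -> linked e e' x' y' ->
  linked e e' (a *: x + x') (a *: y + y').
Proof. by move=> L L' z; rewrite !pen_linl L L'. Qed.

Lemma linked_uniq e e' (x y y' : V) : (forall y : V, (forall z, pen e' y z = 0) -> y = 0) ->
  linked e e' x y -> linked e e' x y' -> y = y'.
Proof.
move=> rad L L'; apply/eqP; rewrite -subr_eq0; apply/eqP/rad => z.
have := pen_linl e' z (-1) y' y; rewrite scaleN1r addrC => ->.
by rewrite -L -L' mulN1r addNr.
Qed.

Lemma cond_nil_model e e' : pdet e e' != 0 -> cond_nil e e' V ->
  exists T : V -> V, nil_space e e' T.
Proof.
move=> ee' cn; have /choice[T TP] := cn_tot cn; exists T; split.
- move=> a u v; apply: (linked_uniq (cn_rad cn) (TP _)); exact: linked_lin.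
- by move=> x z; exact: TP.
- move=> s Ks; have [x xs] := cn_surj cn Ks; exists x.
  exact: (linked_uniq (cn_rad cn) xs).
- by move=> x Px; apply/(cn_iso cn).
- exact: cn_rad cn.
- by apply: kernel_infmod; exact: pdet_neq0 ee'.
Qed.

Lemma cond_double_model a la : cond_double a la V ->
  exists S (T : V -> V), double_space e0 e1 a la S T.
Proof.
move=> cd; pose L := linked (V := V) e0 e1.
have Lu x y y' : L x y -> L x y' -> y = y' by exact: linked_uniq (cd_rad cd).
have L0 : L 0 0 by move=> z; rewrite ![pen _ 0 z]penC !lin1_0 //; exact: pen_linr.
pose Q v w := exists x y ty, [/\ L x w, L y ty & v = x + ty].
have Qlin c v w v' w' : Q v w -> Q v' w' -> Q (c *: v + v') (c *: w + w').
  move=> [x [y [ty [xw yt ->]]]] [x' [y' [ty' [xw' yt' ->]]]].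
  exists (c *: x + x'), (c *: y + y'), (c *: ty + ty'); split; try exact: linked_lin.
  by rewrite scalerDr addrACA.
have Q0 w : Q 0 w -> w = 0.
  move=> [x [y [ty [xw yt /esym E]]]]; have [x0 _] := cd_dir cd xw yt E.
  by apply: (Lu x); rewrite // x0.
have /choice[T TP] v : exists w, Q v w.
  have [x [tx [y [ty [xt yt ->]]]]] := cd_cover cd v.
  by exists tx, x, y, ty.
have Qu v w w' : Q v w -> Q v w' -> w = w'.
  move=> q q'; have := Qlin (-1) _ _ _ _ q' q.
  by rewrite !scaleN1r addNr addrC => /Q0/subr0_eq.
have LT x y : L x y -> T x = y.
  move=> xy; apply: Qu (TP x) _; exists x, 0, 0; split=> //.
  by rewrite addr0.
pose S := [set x | exists y, L x y].
have SL x : S x -> L x (T x) by move=> [y xy]; rewrite (LT _ _ xy).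
have dE (i : 'I_4) x y : dform e0 e1 T i x y = lform i x (T x) y (T y).
  by rewrite /dform /lform; case: (nat_of_ord i) => [|[|[|]]].
have cov v : exists x y, [/\ S x, S y & v = x + T y].
  have [x [tx [y [ty [xt yt ->]]]]] := cd_cover cd v.
  by exists x, y; split; [exists tx | exists ty | rewrite (LT _ _ yt)].
have Tl c u v : T (c *: u + v) = c *: T u + T v.
  by apply: (Qu (c *: u + v)) => //; exact: Qlin.
exists S, T; split=> //.
- split=> [|c u v [u' uu'] [v' vv']]; first by exists 0.
  by exists (c *: u' + v'); exact: linked_lin.
- by move=> x z /SL; exact.
- by move=> x y /SL Sx /SL Sy E; exact: cd_dir cd _ _ _ _ Sx Sy E.
- move=> j x y /SL Sx /SL Sy; rewrite dE (cd_comb cd j Sx Sy).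
  by apply: eq_bigr => i _; rewrite dE.
- move=> u Su E i ai; apply: (cd_nd cd (u := u) (tu := fun i => T (u i))) ai.
    by move=> j; exact: SL.
  move=> y ty yt; rewrite -[RHS](E y); last by exists ty.
  by apply: eq_bigr => j _; rewrite dE (LT _ _ yt).
- move=> r; apply: contrapT => nw.
  have Sr s : S s -> lspan r s.
    move=> Ss; apply: contrapT => sr; apply: nw; exists s => // _ ->.
    by rewrite subr0.
  have [|w _ wK] := @kernel_infmod e0 e1 _ (r ++ map T r); first exact: pdet_neq0 pdet01.
  apply: (wK 0); first by case: (kernel_subsp e0 e1 V).
  have [x [y [Sx Sy ->]]] := cov w; rewrite subr0; apply/lspan_cat; exists x; first exact: Sr.
  rewrite addrC addKr; have := Sr y Sy.
  apply: (@lspan_min _ _ _ [set y | lspan (map T r) (T y)]).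
    split=> [|c u v h h'] /=; last by rewrite Tl; apply: (lspan_subsp _).2.
    by rewrite (LT _ _ L0); case: (lspan_subsp (map T r)).
  by move=> s sr; apply: lspan_mem; exact: map_f.
Qed.

End Models.
End Conditions.

Arguments e0 {k}.
Arguments e1 {k}.

(** * Classification of the spaces of length two *)

Section Classification.
Variables (k : closedFieldType) (V : biquadratic k).
Implicit Types (S M N : set V) (e : k * k).

Definition stable S : Prop :=
  subsp S /\ forall g : V -> V, is_isomorphism g -> forall x, S x -> S (g x).

Definition nontrivial S : Prop := exists2 x, S x & x <> 0.

Definition proper S : Prop := exists x, ~ S x.

Lemma stableP S : stable S <-> is_subrep (aut_rep V) S.
Proof.
split=> -[/subspP sS gS]; split=> //.
  by move=> g _ [x Sx <-]; apply: gS => //; exact: (svalP g).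
by move=> g gi x Sx; apply: (gS (exist _ g gi : bq_aut V)); exists x.
Qed.

Lemma stable_cap S M : stable S -> stable M -> stable (S `&` M).
Proof.
move=> [sS gS] [sM gM]; split; last by move=> g gi x [Sx Mx]; split; [exact: gS | exact: gM].
split=> [|a u v [Su Mu] [Sv Mv]]; first by split; [case: sS | case: sM].
by split; [exact: sS.2 | exact: sM.2].
Qed.

Definition ssum S M : set V := [set x | exists2 s, S s & M (x - s)].

Lemma stable_sum S M : stable S -> stable M -> stable (ssum S M).
Proof.
move=> [sS gS] [sM gM]; split.
  split=> [|a u v [s Ss Ms] [t St Mt]].
    by exists 0; [case: sS | rewrite subr0; case: sM].
  exists (a *: s + t); first exact: sS.2.
  by rewrite opprD addrACA -scalerBr; exact: sM.2.
move=> g gi x [s Ss Ms]; exists (g s); first exact: gS.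
have [[gl _ _ _] _] := gi.
have <- : g (x - s) = g x - g s by rewrite addrC -scaleN1r gl scaleN1r addrC.
exact: gM.
Qed.

Lemma ssum_l S M : subsp M -> S `<=` ssum S M.
Proof. by move=> sM x Sx; exists x; rewrite // subrr; case: sM. Qed.

Lemma ssum_r S M : subsp S -> M `<=` ssum S M.
Proof. by move=> sS x Mx; exists 0; [case: sS | rewrite subr0]. Qed.

Lemma not_nontrivial S : ~ nontrivial S -> forall x, S x -> x = 0.
Proof. by move=> nS x Sx; apply: contrapT => x0; apply: nS; exists x. Qed.

Lemma not_proper S : ~ proper S -> forall x, S x.
Proof. by move=> nS x; apply: contrapT => nx; apply: nS; exists x. Qed.

(** Every nonzero proper stable subspace is both minimal and maximal. *)
Definition length_at_most_two : Prop := forall M N, stable M -> stable N ->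
  nontrivial M -> proper N -> M `<=` N -> N `<=` M.

(** Let S be the middle term of the composition series, and M <= N.  If M does not contain S, it
    meets S trivially and M + S = V; a proper N containing M then meets S trivially as well, and
    N = M by the modular law. *)
Lemma has_length_twoP : has_length (aut_rep V) 2 ->
  length_at_most_two /\ exists S, [/\ stable S, nontrivial S & proper S].
Proof.
move=> [F [F0 F2 Fst Fs]].
have stS : stable (F 1%N) by apply/stableP; exact: Fst.
have [[F01 nF10] min] := Fs 0%N isT; have [[F12 nF21] max] := Fs 1%N isT.
set S := F 1%N in stS F01 nF10 min F12 nF21 max.
have [sS gS] := stS.
have nzS : nontrivial S.
  apply: contrapT => nz; apply: nF10 => x Sx; rewrite F0 /=.
  by apply: contrapT => x0; apply: nz; exists x.
have prS : proper S.
  by apply: contrapT => np; apply: nF21 => x _; apply: contrapT => nx; apply: np; exists x.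
have minS M : stable M -> M `<=` S -> nontrivial M -> S `<=` M.
  move=> stM MS [x Mx x0]; case: (min M) => //; first by apply/stableP.
    by rewrite F0 => _ ->; case: stM => -[].
  by move=> ME; move: x0; rewrite ME F0 in Mx *.
  by move=> ->.
have maxS M : stable M -> S `<=` M -> proper M -> M `<=` S.
  move=> stM SM [x nMx]; case: (max M) => //; first by apply/stableP.
  - by rewrite F2.
  - by move=> ->.
  - by move=> ME; case: nMx; rewrite ME F2.
split; last by exists S.
move=> M N stM stN nzM prN MN.
have [SM|nSM] := pselect (S `<=` M).
  by apply: (subset_trans _ SM); apply: maxS => // y /SM /MN.
have MS0 x : M x -> S x -> x = 0.
  move=> Mx Sx; apply: contrapT => x0; apply: nSM.
  have h : S `<=` M `&` S.
    by apply: minS; [exact: stable_cap | move=> y [] | exists x].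
  by move=> y /h[].
have MSV : forall x, ssum M S x.
  apply: not_proper => pr; have [x Mx x0] := nzM; apply: x0; apply: MS0 => //.
  apply: (maxS (ssum M S)) => //; first exact: stable_sum.
    by apply: ssum_r; case: stM.
  by apply: ssum_l => //.
have NS0 x : N x -> S x -> x = 0.
  move=> Nx Sx; apply: contrapT => x0; have [y nNy] := prN; apply: nNy.
  have h : S `<=` N `&` S.
    by apply: minS; [exact: stable_cap | move=> z [] | exists x].
  have [m Mm Sm] := MSV y; rewrite -(subrK m y); apply: subspD; first by case: stN.
    by case: (h _ Sm).
  exact: MN.
move=> x Nx; have [m Mm Sm] := MSV x.
have -> : x = m; last by [].
apply/eqP; rewrite -subr_eq0; apply/eqP/NS0 => //.
by apply: subspB => //; [case: stN | exact: MN].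
Qed.

Lemma iso_linked e e' (g : V -> V) (x y : V) : is_isomorphism g ->
  linked e e' x y -> linked e e' (g x) (g y).
Proof.
move=> gi xy z; have [_ [h gh hg]] := gi.
by rewrite -(hg z) !(pen_iso _ gi).
Qed.

Lemma iso_lin (g : V -> V) a (x y : V) : is_isomorphism g ->
  g (a *: x + y) = a *: g x + g y.
Proof. by move=> [[gl _ _ _] _]; exact: gl. Qed.

Lemma iso0 (g : V -> V) : is_isomorphism g -> g 0 = 0.
Proof. by move=> gi; have := iso_lin (-1) 0 0 gi; rewrite scaler0 addr0 scaleN1r addNr. Qed.

Lemma linked0 e e' : linked e e' (0 : V) 0.
Proof. by move=> z; rewrite ![pen _ 0 z]penC !lin1_0 //; exact: pen_linr. Qed.

Lemma stable_kernel e e' : stable (@kernel k e e' V).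
Proof.
split; first exact: kernel_subsp.
move=> g gi x Kx z; have [_ [h gh hg]] := gi.
by rewrite -(hg z) /form2 (pen_iso _ gi); exact: Kx.
Qed.

Lemma stable_perp e e' : stable (@perp k e e' V).
Proof.
split.
  split=> [s _|c u v Pu Pv s Ks]; first by rewrite penC lin1_0 //; exact: pen_linr.
  by rewrite pen_linl Pu // Pv // mulr0 addr0.
move=> g gi x Px s Ks; have [_ [h gh hg]] := gi.
rewrite -(hg s) (pen_iso _ gi); apply: Px.
exact: (stable_kernel e e').2 (is_isomorphism_inv gi gh hg) _ Ks.
Qed.

Hypothesis two : length_at_most_two.
Hypothesis kc : ~ countable [set: k].

Definition stable_rel (Z : V -> V -> Prop) : Prop :=
  [/\ Z 0 0,
      forall a x y x' y', Z x y -> Z x' y' -> Z (a *: x + x') (a *: y + y') &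
      forall g : V -> V, is_isomorphism g -> forall x y, Z x y -> Z (g x) (g y)].

Lemma stable_linked e e' : stable_rel (@linked k e e' V).
Proof.
split; first exact: linked0; last by move=> g gi x y; exact: iso_linked.
by move=> a x y x' y'; exact: linked_lin.
Qed.

Lemma stable_rel_restr S (Z : V -> V -> Prop) : stable S -> stable_rel Z ->
  stable_rel (fun x y => [/\ S x, S y & Z x y]).
Proof.
move=> [sS gS] [Z0 Zl Zg]; split.
- by split=> //; case: sS.
- move=> a x y x' y' [Sx Sy xy] [Sx' Sy' xy'].
  by split; [exact: sS.2 | exact: sS.2 | exact: Zl].
- by move=> g gi x y [Sx Sy xy]; split; [exact: gS | exact: gS | exact: Zg].
Qed.

Lemma stable_dom Z : stable_rel Z -> stable [set x | exists y, Z x y].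
Proof.
move=> [Z0 Zl Zg]; split; last by move=> g gi x [y xy]; exists (g y); exact: Zg.
split=> [|a u v [u' uu'] [v' vv']]; first by exists 0.
by exists (a *: u' + v'); exact: Zl.
Qed.

Lemma stable_shift a Z : stable_rel Z -> stable [set u | exists x y, Z x y /\ u = y - a *: x].
Proof.
move=> [Z0 Zl Zg]; split; last first.
  move=> g gi _ [x [y [xy ->]]]; exists (g x), (g y); split; first exact: Zg.
  by rewrite addrC -scaleNr iso_lin // scaleNr addrC.
split=> [|b _ _ [x [y [xy ->]]] [x' [y' [xy' ->]]]].
  by exists 0, 0; rewrite scaler0 subr0.
exists (b *: x + x'), (b *: y + y'); split; first exact: Zl.
rewrite scalerBr scalerDr opprD addrACA; congr (_ + _ + _).
by rewrite !scalerA mulrC.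
Qed.

Lemma stable_im Z : stable_rel Z -> stable [set y | exists x, Z x y].
Proof.
move=> /(stable_shift 0); congr stable; apply/seteqP; split=> y /=.
  by move=> [x [y' [xy ->]]]; exists x; rewrite scale0r subr0.
by move=> [x xy]; exists x, y; rewrite scale0r subr0.
Qed.

Lemma stable_eigen a Z : stable_rel Z -> stable [set x | Z x (a *: x)].
Proof.
move=> [Z0 Zl Zg]; split; last first.
  move=> g gi y /= /(Zg g gi).
  have -> // : g (a *: y) = a *: g y.
  by rewrite -[a *: y]addr0 iso_lin // iso0 // addr0.
split=> [|b u v /= Zu Zv] /=; first by rewrite scaler0.
by rewrite scalerDr scalerA mulrC -scalerA; exact: Zl.
Qed.

(** The domain, the eigenspaces and the images of Z - a are stable, hence zero or S; if no
    eigenspace were S, all Z - a would be bijective. *)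
Lemma schur_stable S Z : stable S -> nontrivial S -> proper S ->
  stable_rel Z -> (forall x y, Z x y -> S x /\ S y) ->
  (forall y, Z 0 y -> y = 0) -> (exists x y, Z x y /\ x <> 0) ->
  exists a, forall x, S x -> Z x (a *: x).
Proof.
move=> stS nzS prS stZ ZS Z0 [x0 [y0 [Zxy x00]]]; have [Z00 Zl Zg] := stZ.
have sub M : stable M -> M `<=` S -> nontrivial M -> S `<=` M.
  by move=> stM MS nzM; exact: two.
have Ztot : forall x, S x -> exists y, Z x y.
  apply: (sub _ (stable_dom stZ)); first by move=> x [y /ZS[]].
  by exists x0 => //; exists y0.
apply: contrapT => ns.
have Zinj a x : Z x (a *: x) -> x = 0.
  move=> Zx; apply: contrapT => xn0; apply: ns; exists a.
  by apply: (sub _ (stable_eigen a stZ)); [move=> y /ZS[] | exists x].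
have Zsurj a u : S u -> exists x y, Z x y /\ u = y - a *: x.
  move: u; apply: (sub _ (stable_shift a stZ)).
  - move=> u [x [y [/ZS[Sx Sy] ->]]]; apply: subspB; [by case: stS | by [] | by apply: subspZ => //; case: stS].
  - have [y xy] := Ztot x0 (ZS _ _ Zxy).1; exists (y - a *: x0); first by exists x0, y.
    by move=> /subr0_eq yE; apply: x00; apply: (Zinj a); rewrite -yE.
have [x Sx xn0] := nzS; apply: xn0.
exact: (schur_zero stS.1 ZS Zl Ztot Z0 Zinj Zsurj (bq_countable_dim V) kc).
Qed.

(** The forms are added one at a time.  If the functionals of f n on S meet those of the previous
    generic ones, the resulting map from S to a power of S is scalar in each coordinate by Schur's
    lemma, and f n is a linear combination of the previous forms. *)
Lemma schur_forms S (f : nat -> V -> V -> k) : stable S -> nontrivial S -> proper S ->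
  (forall i a x x' y, S x -> S x' -> S y ->
    f i (a *: x + x') y = a * f i x y + f i x' y) ->
  (forall g : V -> V, is_isomorphism g -> forall i x y, S x -> S y -> f i (g x) (g y) = f i x y) ->
  forall n, exists (a : nat -> bool) (la : nat -> nat -> k),
    (forall j x y, (j < n)%N -> S x -> S y ->
      f j x y = \sum_(i < n) if a i then la j i * f i x y else 0) /\
    (forall u : nat -> V, (forall i, S (u i)) ->
      (forall y, S y -> \sum_(i < n) (if a i then f i (u i) y else 0) = 0) ->
      forall i, (i < n)%N -> a i -> u i = 0).
Proof.
move=> stS nzS prS fl fg; have [sS gS] := stS.
have S0 : S 0 by case: sS.
have f0 i y : S y -> f i 0 y = 0.
  by move=> Sy; have := fl i (-1) 0 0 y S0 S0 Sy; rewrite scaler0 addr0 mulN1r addNr.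
elim=> [|n [a [la [comb nd]]]].
  by exists (fun=> false), (fun _ _ => 0); split.
pose ext b i := if i == n then b else a i.
have extE b (G : nat -> k) : \sum_(i < n.+1) (if ext b i then G i else 0) =
    \sum_(i < n) (if a i then G i else 0) + (if b then G n else 0).
  rewrite big_ord_recr /= /ext eqxx; congr (_ + _).
  by apply: eq_bigr => i _; rewrite (ltn_eqF (ltn_ord i)).
case: (pselect (exists c : nat -> k, forall x y, S x -> S y ->
    f n x y = \sum_(i < n) if a i then c i * f i x y else 0)) => [[c fc]|nc].
  exists (ext false), (fun j => if j == n then c else la j); split.
    move=> j x y; rewrite ltnS leq_eqVlt.
    rewrite (extE _ (fun i => (if j == n then c else la j) i * f i x y)) addr0.
    case: eqP => [-> _ Sx Sy|_ /= jn Sx Sy]; [exact: fc | exact: comb].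
  move=> u Su E i; rewrite ltnS leq_eqVlt /ext; case: eqP => //= _ ni ai.
  apply: nd ai => // y Sy.
  by rewrite -[RHS](E y Sy) (extE _ (fun i => f i (u i) y)) addr0.
exists (ext true), (fun j i => if j == n then (i == n)%:R else if i == n then 0 else la j i).
split.
  move=> j x y; rewrite ltnS leq_eqVlt.
  rewrite (extE _ (fun i => (if j == n then (i == n)%:R else
    if i == n then 0 else la j i) * f i x y)) eqxx.
  case: eqP => [-> _ Sx Sy|_ /= jn Sx Sy].
    rewrite mul1r big1 ?add0r // => i _; rewrite (ltn_eqF (ltn_ord i)) mul0r.
    by case: (a i).
  rewrite mul0r addr0 comb //; apply: eq_bigr => i _.
  by rewrite (ltn_eqF (ltn_ord i)).
move=> u Su E; have un : u n = 0.
  apply: contrapT => un; apply: nc.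
  pose w_rel x (w : nat -> V) := [/\ S x, forall i, S (w i) &
    forall z, S z -> \sum_(i < n) (if a i then f i (w i) z else 0) = f n x z].
  have wlin c x w x' w' : w_rel x w -> w_rel x' w' ->
      w_rel (c *: x + x') (fun i => c *: w i + w' i).
    move=> [Sx Sw wE] [Sx' Sw' wE']; split=> [|i|z Sz]; try exact: sS.2.
    rewrite fl // -wE // -wE' // mulr_sumr -big_split /=; apply: eq_bigr => i _.
    by case: (a i); rewrite ?fl // mulr0 addr0.
  have wg g : is_isomorphism g -> forall x w, w_rel x w -> w_rel (g x) (fun i => g (w i)).
    move=> gi x w [Sx Sw wE]; split=> [|i|z Sz]; try exact: gS.
    have [_ [h gh hg]] := gi.
    have Shz : S (h z) by apply: gS => //; exact: is_isomorphism_inv gi gh hg.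
    rewrite -(hg z) fg // -wE //; apply: eq_bigr => i _.
    by case: (a i) => //; rewrite fg.
  have w0 w : w_rel 0 w -> forall i, (i < n)%N -> a i -> w i = 0.
    by move=> [_ Sw wE]; apply: nd => // y Sy; rewrite wE // f0.
  pose Z i x y := exists2 w, w_rel x w & y = w i.
  have stZ i : stable_rel (Z i).
    split.
    - exists (fun=> 0) => //; split=> // z Sz; rewrite f0 // big1 // => j _.
      by case: (a j); rewrite ?f0.
    - by move=> c x y x' y' [w wx ->] [w' wx' ->]; eexists; first exact: wlin wx wx'.
    - by move=> g gi x y [w wx ->]; eexists; first exact: wg gi _ _ wx.
  have w1 : w_rel (u n) (fun i => - u i).
    split=> [//|i|z Sz]; first exact: subspN.
    have := E z Sz; rewrite (extE true (fun i => f i (u i) z)) => /eqP.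
    rewrite addrC addr_eq0 => /eqP ->; rewrite -sumrN; apply: eq_bigr => i _.
    case: (a i); last by rewrite oppr0.
    by rewrite -scaleN1r -[_ *: _]addr0 fl // f0 // addr0 mulN1r.
  have eig i : exists c, (i < n)%N -> a i -> forall x, S x -> Z i x (c *: x).
    case: (boolP ((i < n)%N && a i)) => [/andP[ni ai]|]; last first.
      by rewrite negb_and => /orP[] /negbTE h; exists 0; rewrite h.
    have [|||c cP] := schur_stable stS nzS prS (stZ i); last by exists c.
    - by move=> x y [w [Sx Sw wE] ->].
    - by move=> y [w wx ->]; exact: w0 wx i ni ai.
    - by exists (u n), (- u i); split=> //; exists (fun i => - u i).
  have /choice[c cP] := eig; exists c => x y Sx Sy.
  have [w wx] : exists w, w_rel x w.
    have h : S `<=` [set x | exists y, Z 0%N x y].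
      apply: two => //; first exact: stable_dom.
      - by exists (u n) => //; exists (- u 0%N); exists (fun i => - u i).
      - by move=> z [_ [w [Sz _ _] _]].
    by have [_ [w wx _]] := h x Sx; exists w.
  have [_ Sw wE] := wx; rewrite -wE //; apply: eq_bigr => i _; case: ifP => // ai.
  have [w' wx' cw'] := cP i (ltn_ord i) ai x Sx.
  have wE' : w i = w' i.
    have := w0 _ _ i (ltn_ord i) ai; have := wlin (-1) _ _ _ _ wx' wx.
    rewrite scaleN1r addNr => h /(_ _ h); rewrite scaleN1r addrC => /subr0_eq //.
  by rewrite wE' -cw' -[_ *: x]addr0 fl // f0 // addr0.
move=> i; rewrite ltnS leq_eqVlt /ext; case: eqP => [-> //|_ /= ni ai].
apply: nd ai => // y Sy.
by rewrite -[RHS](E y Sy) (extE _ (fun i => f i (u i) y)) un f0 // addr0.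
Qed.

Hypothesis ortho : has_orthonormal V.

Lemma kernel_proper e e' : e != (0, 0) -> proper (@kernel k e e' V).
Proof.
move=> en0; have [w _ wK] := kernel_infmod ortho e' en0 [::].
by exists w => Kw; apply: (wK w Kw); rewrite subrr.
Qed.

Lemma pencil_kernel (a : k) (x : V) : linked e0 e1 x (a *: x) ->
  forall e', kernel (1, - a) e' x.
Proof.
move=> L e' z; rewrite /form2 /pen /=.
have := L z; rewrite penC [RHS]penC (lin1Z _ _ (pen_linr _ _)) ![pen _ z x]penC.
by rewrite pen_e0 pen_e1 mul1r mulNr => ->; rewrite subrr.
Qed.

Lemma radicalP (x : V) : radical x <-> forall e z, pen e x z = 0.
Proof.
split=> [Rx e z|Rx z]; first by rewrite /pen; have [-> ->] := Rx z; rewrite !mulr0 addr0.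
by have := Rx e0 z; have := Rx e1 z; rewrite pen_e0 pen_e1.
Qed.

Lemma stable_radical : stable (@radical k V).
Proof.
split; last first.
  move=> g gi x /radicalP Rx; apply/radicalP => e z; have [_ [h gh hg]] := gi.
  by rewrite -(hg z) (pen_iso _ gi).
split=> [|a u v /radicalP Ru /radicalP Rv]; apply/radicalP => e z.
  by rewrite penC lin1_0 //; exact: pen_linr.
by rewrite pen_linl Ru Rv mulr0 addr0.
Qed.

(** The quotient of V by its nonzero radical R is irreducible.  If a relation held between the two
    forms outside R, Schur's lemma on a complement of R would make it a scalar, so that a member of
    the pencil would vanish on a vector outside R, hence everywhere. *)
Lemma radical_case : nontrivial (@radical k V) -> cond_rad V.
Proof.
move=> nzR x0 y0' E.
have stR := stable_radical; have [sR gR] := stR.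
pose y0 := - y0'.
have L0 : linked e0 e1 x0 y0.
  move=> z; rewrite penC [RHS]penC (lin1N _ (pen_linr _ _)) penC [in RHS]penC pen_e0 pen_e1.
  by have /eqP := E z; rewrite addr_eq0 => /eqP.
have Ker e (x : V) : e != (0, 0) -> (forall z, pen e x z = 0) -> radical x.
  move=> en0 Kx; have prK := @kernel_proper e e1 en0.
  have sub := two stR (stable_kernel e e1) nzR prK.
  by apply: (sub _ x) => [y /radicalP Ry z|z]; [exact: Ry | exact: Kx].
have e0n : e0 != (0, 0) :> k * k by exact: pdet_neq0 (pdet01 k).
have e1n : e1 != (0, 0) :> k * k by apply: pair_neq0; right; exact: oner_neq0.
have Rlink (x y : V) : radical x -> linked e0 e1 x y -> radical y.
  by move=> /radicalP Rx L; apply: (Ker e1) => // z; rewrite -L.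
have [Rx0|nRx0] := pselect (radical x0).
  split=> //; have /(subspN sR) := Rlink _ _ Rx0 L0; by rewrite opprK.
have [B [sB BR B0]] := complementP sR.
exfalso; apply: (nRx0).
have RL (x y r s : V) : linked e0 e1 x y -> radical r -> radical s -> linked e0 e1 (x - r) (y - s).
  move=> L /radicalP Rr /radicalP Rs z.
  by rewrite penC [RHS]penC !lin1B ?[pen _ z r]penC ?[pen _ z s]penC ?Rr ?Rs ?subr0 ?[pen _ z _]penC //;
    exact: pen_linr.
have stL := stable_linked e0 e1.
have tot : forall x : V, exists y, linked e0 e1 x y.
  apply: not_proper => pr; apply: nRx0.
  have sub := two stR (stable_dom stL) nzR pr; apply: (sub _ x0); last by exists y0.
  by move=> x /radicalP Rx; exists 0 => z; rewrite Rx pen0l.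
have split_link (x y : V) : linked e0 e1 x y -> exists b c,
    [/\ B b, B c, radical (x - b), radical (y - c) & linked e0 e1 b c].
  move=> L; have [b Bb Rb] := BR x; have [c Bc Rc] := BR y; exists b, c; split=> //.
  by have := RL _ _ _ _ L Rb Rc; rewrite !opprB !addrA ![_ + b]addrC ![_ + c]addrC !addrK.
pose Z (u v : V) := [/\ B u, B v & linked e0 e1 u v].
have [b0 Bb0 Rb0] := BR x0.
suff b00 : b0 = 0 by move: Rb0; rewrite b00 subr0.
have ker1 (a : k) : (1, - a) != (0, 0) :> k * k by apply: pair_neq0; left; exact: oner_neq0.
apply: (@schur_zero k V B Z sB _ _ _ _ _ _ (bq_countable_dim V) kc b0 Bb0).
- by move=> x y [].
- move=> a x y x' y' [Bx By L] [Bx' By' L'].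
  by split; [exact: sB.2 | exact: sB.2 | exact: linked_lin].
- move=> x Bx; have [y L] := tot x; have [b [c [Bb Bc Rb Rc Lbc]]] := split_link _ _ L.
  exists c; split=> //; suff -> : x = b by [].
  by apply/eqP; rewrite -subr_eq0; apply/eqP/B0 => //; exact: subspB.
- by move=> y [_ By L]; apply: B0 By _; apply: (Rlink 0); first by case: sR.
- by move=> a x [Bx _ L]; apply: B0 Bx _; apply: (Ker _ _ (ker1 a)); exact: (pencil_kernel L e1).
- move=> a u Bu.
  have [x [y [L uE]]] : exists x y, linked e0 e1 x y /\ u = y - a *: x.
    move: {Bu} u; apply: not_proper => pr; apply: nRx0.
    have sub := two stR (stable_shift a stL) nzR pr.
    have Rsh : radical (y0 - a *: x0).
      apply: (sub _ (y0 - a *: x0)); last by exists x0, y0.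
      move=> r Rr; exists 0, r; split; last by rewrite scaler0 subr0.
      by move=> z; have /radicalP -> := Rr; rewrite penC lin1_0 //; exact: pen_linr.
    apply: (Ker _ _ (ker1 a)); apply: (@pencil_kernel a x0 _ e1).
    have R0 : radical (0 : V) by case: sR.
    by have := RL _ _ _ _ L0 R0 Rsh; rewrite subr0 opprB addrC subrK.
  have [b [c [Bb Bc Rb Rc Lbc]]] := split_link _ _ L; exists b, c; split=> //.
  apply/eqP; rewrite -subr_eq0; apply/eqP/B0.
    by apply: subspB => //; apply: subspB => //; exact: subspZ.
  have -> : u - (c - a *: b) = (y - c) - a *: (x - b).
    by rewrite uE scalerBr !opprB addrACA [RHS]addrACA; congr (_ + _); rewrite addrC.
  exact: (subspB sR Rc (subspZ a sR Rb)).
Qed.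

Definition kernel_type : Prop := exists e e', pdet e e' != 0 /\
  [\/ exists be, cond_sum e e' be V, exists ga, cond_flag e e' ga V | cond_nil e e' V].

Hypothesis radical0 : forall x : V, radical x -> x = 0.

Lemma pen_radical0 e e' (x : V) : pdet e e' != 0 ->
  (forall z, pen e x z = 0) -> (forall z, pen e' x z = 0) -> x = 0.
Proof.
move=> ee' Ex Ex'; apply: radical0; apply/radicalP => f z.
exact: (form_transfer0 ee').
Qed.

(** Let S be the kernel of e and M its orthogonal for e'.  Since S and M are stable, M is 0, a
    complement of S, or S.  In the second case Schur's lemma on M decides whether e and e' are
    generic or proportional there.  In the third, the vectors x whose functional e(x, .) is of the
    form e'(y, .) form S or V. *)
Lemma kernel_case e e' : pdet e e' != 0 -> nontrivial (@kernel k e e' V) -> kernel_type.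
Proof.
move=> ee' nzS; set S := @kernel k e e' V in nzS.
have stS : stable S := stable_kernel e e'; have [sS _] := stS.
have prS : proper S by apply: kernel_proper; exact: pdet_neq0 ee'.
set M := @perp k e e' V.
have stM : stable M := stable_perp e e'; have [sM _] := stM.
have stSM := stable_cap stS stM.
have [nzSM|/not_nontrivial SM0] := pselect (nontrivial (S `&` M)).
  have SM : S `<=` M.
    have h : S `<=` S `&` M by apply: (two stSM stS nzSM prS) => x [].
    by move=> x /h[].
  have prM : proper M.
    apply: contrapT => /not_proper MT; have [x Sx x0] := nzS; apply: x0.
    apply: (pen_radical0 ee') => z; first exact: Sx.
    by rewrite penC; exact: MT.
  have MS : M `<=` S by exact: two.
  have SE (x : V) : kernel e e' x <-> perp e e' x by split; [exact: SM | exact: MS].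
  have rad' (y : V) : (forall z, pen e' y z = 0) -> y = 0.
    move=> y0; apply: (pen_radical0 ee' (x := y)) => // z.
    have Sy : S y by apply: MS => s _; exact: y0.
    exact: Sy.
  have stL := stable_linked e e'.
  have DS (x y : V) : kernel e e' x -> linked e e' x y -> y = 0.
    by move=> Kx L; apply: rad' => z; rewrite -L; exact: Kx.
  have [prD|/not_proper tot] := pselect (proper [set x : V | exists y, linked e e' x y]).
    exists e, e'; split=> //; apply: Or32; exists false; split=> // x y E.
    have L : linked e e' x (- y).
      move=> z; rewrite [RHS]penC (lin1N _ (pen_linr _ _)) penC.
      by have /eqP := E z; rewrite addr_eq0 penC [pen e' _ _]penC => /eqP.
    have Kx : kernel e e' x.
      have sub := two stS (stable_dom stL) nzS prD.
      apply: (sub _ x); last by exists (- y).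
      by move=> u Ku; exists 0 => z; rewrite pen0l; exact: Ku.
    by apply: oppr_inj; rewrite (DS _ _ Kx L) oppr0.
  exists e, e'; split=> //; apply: Or33; split=> // y Ky.
  have sub := @two _ _ (stable_im stL) stS; apply: (sub _ prS _ y Ky) => [|u [x xu]].
    have [x nx] := prS; have [y' L] := tot x; exists y'; first by exists x.
    by move=> y'0; apply: nx => z; rewrite /form2 L y'0 pen0l.
  by apply: MS => s Ks; rewrite -xu penC; exact: Ks.
have [nzM|/not_nontrivial M0] := pselect (nontrivial M); last first.
  exists e, e'; split=> //; apply: Or32; exists true; split=> // x y E.
  apply: M0 => s Ks; rewrite -[RHS](E s).
  by have -> : pen e x s = 0; [rewrite penC; exact: Ks | rewrite add0r].
have prM : proper M.
  by have [x Sx x0] := nzS; exists x => Mx; apply: x0; exact: SM0.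
have SMV : forall x, ssum S M x.
  apply: not_proper => pr; have [x Sx x0] := nzS; apply: x0; apply: SM0; split=> //.
  have sub := two stM (stable_sum stS stM) nzM pr; apply: (sub _ x); first exact: ssum_r.
  exact: ssum_l.
have nd (x : V) : kernel e e' x -> (forall y, kernel e e' y -> pen e' x y = 0) -> x = 0.
  by move=> Kx Px; apply: SM0.
have eM (c : k * k) (x : V) : M x -> (forall z, M z -> c.1 * pen e x z + c.2 * pen e' x z = 0) ->
    forall z, c.1 * pen e x z + c.2 * pen e' x z = 0.
  move=> Mx E z; have [s Ss Ms] := SMV z; rewrite -(subrK s z).
  rewrite (lin1D _ _ (pen_linr e x)) (lin1D _ _ (pen_linr e' x)) [pen e x s]penC (Mx s Ss).
  have -> : pen e s x = 0 by exact: Ss.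
  by rewrite !addr0; exact: E.
have e_nd (x : V) : M x -> (forall z, M z -> pen e x z = 0) -> x = 0.
  move=> Mx E; apply: SM0; split=> // z.
  have := eM (1, 0) x Mx _ z; rewrite /= mul1r mul0r addr0; apply=> t Mt.
  by rewrite mul1r mul0r addr0; exact: E.
(* either some member of the pencil vanishes on M, or none relates M to itself *)
have [[c c2 cM]|nc] := pselect (exists2 c : k, True &
    forall x y, M x -> M y -> pen e' x y = c * pen e x y).
  pose f := (e'.1 - c * e.1, e'.2 - c * e.2).
  have fE (x y : V) : pen f x y = pen e' x y - c * pen e x y by rewrite /pen /=; ring.
  have ef : pdet e f != 0 by have -> : pdet e f = pdet e e' by rewrite /pdet /=; ring.
  have KE (x : V) : kernel e f x <-> kernel e e' x by [].
  have PE (x : V) : perp e f x <-> M x.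
    split=> Px s Ks.
      have := Px s Ks; rewrite fE [pen e x s]penC.
      by have -> : pen e s x = 0; [exact: Ks | rewrite mulr0 subr0].
    rewrite fE [pen e x s]penC.
    have -> : pen e s x = 0 by exact: Ks.
    by rewrite mulr0 subr0; exact: Px.
  have f0 (x y : V) : M x -> M y -> pen f x y = 0.
    by move=> Mx My; rewrite fE cM // subrr.
  exists e, f; split=> //; apply: Or31; exists false; split=> //.
  - move=> x Kx Px; apply: nd => // s Ks; have := Px s Ks; rewrite fE.
    by have -> : pen e x s = 0; [exact: Kx | rewrite mulr0 subr0].
  - by move=> v; have [s Ss Ms] := SMV v; exists s => //; apply/PE.
  - move=> x y /PE Mx /PE My E; split=> //; apply: e_nd => // z Mz.
    by rewrite -[RHS](E z) ?f0 ?addr0 //; apply/PE.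
  - by move=> _ x y /PE Mx /PE My; exact: f0.
exists e, e'; split=> //; apply: Or31; exists true; split=> //.
move=> x0 y0 Mx0 My0 E.
have [y00|/eqP y00] := eqVneq y0 0.
  split=> //; apply: e_nd => // z Mz.
  by rewrite -[RHS](E z Mz) y00 pen0l addr0.
exfalso; apply: nc.
pose Z y x := [/\ M y, M x & linked e' e y x].
have stZ : stable_rel Z by apply: stable_rel_restr => //; exact: stable_linked.
have [|||c cP] := schur_stable stM nzM prM stZ.
- by move=> y x [].
- move=> x [_ Mx L]; apply: e_nd => // z _; rewrite -L.
  exact: pen0l.
- exists y0, (- x0); split; last by [].
  split=> [//||z]; first exact: (subspN sM Mx0).
  rewrite [RHS]penC (lin1N _ (pen_linr _ _)) [in RHS]penC.
  have [s Ss Ms] := SMV z; rewrite -(subrK s z).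
  rewrite (lin1D _ _ (pen_linr e' y0)) (lin1D _ _ (pen_linr e x0)).
  rewrite (My0 s Ss) [pen e x0 s]penC.
  have -> : pen e s x0 = 0 by exact: Ss.
  by have /eqP := E _ Ms; rewrite !addr0 addrC addr_eq0 => /eqP.
exists c => // x y Mx My; have [_ _ L] := cP x Mx.
by rewrite L penC (lin1Z _ _ (pen_linr _ _)) penC.
Qed.

Lemma linked_of_relation (x y : V) :
  (forall z, bq_omega V x z + bq_omega' V y z = 0) -> linked e0 e1 x (- y).
Proof.
move=> E z; rewrite [RHS]penC (lin1N _ (pen_linr _ _)) [in RHS]penC pen_e0 pen_e1.
by have /eqP := E z; rewrite addr_eq0 => /eqP.
Qed.

(** The relation [linked] is the graph of an equivariant isomorphism from D to R.  If D were V,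
    Schur's lemma would give an eigenvector, and a member of the pencil would be degenerate; the
    same argument shows that D and R are different, so that V = D (+) R. *)
Lemma double_case : (exists S, [/\ stable S, nontrivial S & proper S]) ->
  (forall e (x : V), e != (0, 0) -> (forall z, pen e x z = 0) -> x = 0) ->
  ~ cond_rad V -> exists a la, cond_double a la V.
Proof.
move=> [S0 [stS0 nzS0 prS0]] ker0 ncr; pose L := @linked k e0 e1 V.
have e0n : e0 != (0, 0) :> k * k by exact: pdet_neq0 (pdet01 k).
have e1n : e1 != (0, 0) :> k * k by apply: pair_neq0; right; exact: oner_neq0.
have ker1 (a : k) : (1, - a) != (0, 0) :> k * k by apply: pair_neq0; left; exact: oner_neq0.
have rad1 (y : V) : (forall z, pen e1 y z = 0) -> y = 0 by exact: ker0.
have stL : stable_rel L := stable_linked e0 e1.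
have [L00 Llin Lg] := stL.
have Lfun y : L 0 y -> y = 0 by move=> Ly; apply: rad1 => z; rewrite -Ly pen0l.
have Linj x : L x 0 -> x = 0 by move=> Lx; apply: (ker0 e0) => // z; rewrite Lx pen0l.
have Leig a x : L x (a *: x) -> x = 0.
  by move=> Lx; apply: (ker0 _ _ (ker1 a)); exact: (pencil_kernel Lx e1).
have LB x y x' y' : L x y -> L x' y' -> L (x - x') (y - y').
  by move=> h h'; have := Llin (-1) _ _ _ _ h' h; rewrite !scaleN1r ![- _ + _]addrC.
have [x0 [y0 [Lxy0 x00]]] : exists x y, L x y /\ x <> 0.
  apply: contrapT => nx; apply: ncr => x y /linked_of_relation Lxy.
  have [x0|x0] := pselect (x = 0); last by case: nx; exists x, (- y).
  have R0 : radical (0 : V) by case: stable_radical => -[].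
  have y0 : y = 0 by apply: oppr_inj; rewrite oppr0; apply: Lfun; rewrite -x0.
  by rewrite x0 y0.
have y00 : y0 <> 0 by move=> y00; apply: x00; apply: Linj; rewrite -y00.
(* a stable subspace linked to itself would contain an eigenvector of the pencil *)
have noself S : stable S -> nontrivial S -> proper S ->
    forall x y, S x -> S y -> L x y -> x = 0.
  move=> stS nzS prS x y Sx Sy Lxy; apply: contrapT => xn0.
  have [|||a aP] := schur_stable stS nzS prS (stable_rel_restr stS stL).
  - by move=> u v [].
  - by move=> v [_ _]; exact: Lfun.
  - by exists x, y; split.
  - have [s Ss sn0] := nzS; have [_ _ La] := aP s Ss; apply: sn0; exact: Leig La.
pose D := [set x : V | exists y, L x y]; pose R := [set y : V | exists x, L x y].
have stD : stable D by exact: stable_dom.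
have stR : stable R by exact: stable_im.
have nzD : nontrivial D by exists x0 => //; exists y0.
have nzR : nontrivial R by exists y0 => //; exists x0.
have prD : proper D.
  apply: contrapT => /not_proper tot.
  have Zsurj a u : exists x y, L x y /\ u = y - a *: x.
    move: u; apply: not_proper => pr.
    pose N := [set u : V | exists x y, [/\ S0 x, L x y & u = y - a *: x]].
    have stN : stable N.
      have [[S00 S0l] S0g] := stS0; split; last first.
        move=> g gi _ [x [y [Sx xy ->]]]; exists (g x), (g y); split; [exact: S0g | exact: Lg |].
        by rewrite addrC -scaleNr iso_lin // scaleNr addrC.
      split=> [|b _ _ [x [y [Sx xy ->]]] [x' [y' [Sx' xy' ->]]]].
        by exists 0, 0; rewrite scaler0 subr0.
      exists (b *: x + x'), (b *: y + y'); split; [exact: S0l | exact: Llin |].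
      rewrite scalerBr scalerDr opprD addrACA; congr (_ + _ + _).
      by rewrite !scalerA mulrC.
    have nzN : nontrivial N.
      have [s Ss sn0] := nzS0; have [t Lst] := tot s.
      exists (t - a *: s); first by exists s, t.
      by move=> /subr0_eq tE; apply: sn0; apply: (Leig a); rewrite -tE.
    have sub := two stN (stable_shift a stL) nzN pr.
    have [x nSx] := prS0; have [y Lxy] := tot x; apply: nSx.
    have [||x1 [y1 [Sx1 Lxy1 E]]] := sub _ (y - a *: x).
    - by move=> _ [x1 [y1 [_ Lxy1 ->]]]; exists x1, y1.
    - by exists x, y.
    have -> : x = x1; last by [].
    apply/eqP; rewrite -subr_eq0; apply/eqP/(Leig a).
    have -> : a *: (x - x1) = y - y1; last exact: LB.
    rewrite -[y](subrK (a *: x)) E scalerBr [RHS]addrAC [y1 - _ - y1]addrAC subrr add0r.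
    by rewrite addrC.
  apply: x00.
  apply: (@schur_zero k V setT L (subspT V) _ Llin _ Lfun Leig _ (bq_countable_dim V) kc) => //.
  - by move=> x _; exact: tot.
have prR : proper R.
  apply: contrapT => /not_proper Rsurj.
  pose N := [set x : V | exists2 y, S0 y & L x y].
  have stN : stable N.
    have [[S00 S0l] S0g] := stS0; split; last first.
      by move=> g gi x [y Sy xy]; exists (g y); [exact: S0g | exact: Lg].
    split=> [|b u v [u' Su' uu'] [v' Sv' vv']]; first by exists 0.
    by exists (b *: u' + v'); [exact: S0l | exact: Llin].
  have nzN : nontrivial N.
    have [s Ss sn0] := nzS0; have [x Lxs] := Rsurj s; exists x; first by exists s.
    by move=> xE; apply: sn0; apply: Lfun; rewrite -xE.
  have sub := two stN stD nzN prD.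
  have [s nSs] := prS0; have [x Lxs] := Rsurj s; apply: nSs.
  have [||y Sy Lxy] := sub _ x; [by move=> u [y _ uy]; exists y | by exists s |].
  suff -> : s = y by [].
  by apply/eqP; rewrite -subr_eq0; apply/eqP/Lfun; have := LB _ _ _ _ Lxs Lxy; rewrite subrr.
have nDR : ~ D `<=` R.
  move=> DR; have sub := two stD stR nzD prR DR.
  apply: x00; apply: (noself D stD nzD prD x0 y0) => //; first by exists y0.
  by apply: sub; exists x0.
have DR0 x : D x -> R x -> x = 0.
  move=> Dx Rx; apply: contrapT => xn0; apply: nDR.
  have h : D `<=` D `&` R.
    apply: (two (stable_cap stD stR) stD _ prD) => [|u []//].
    by exists x.
  by move=> u /h[].
have DRV : forall v, ssum D R v.
  apply: not_proper => pr; apply: nDR.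
  have sub := two stR (stable_sum stD stR) nzR pr.
  by move=> u Du; apply: (sub _ u); [apply: ssum_r; case: stD | apply: ssum_l => //; case: stR].
have /choice[T TP] : forall x, exists y, D x -> L x y.
  by move=> x; case: (pselect (D x)) => [[y]|nD]; [exists y | exists 0].
have Luniq x y y' : L x y -> L x y' -> y = y'.
  by move=> h h'; apply/eqP; rewrite -subr_eq0; apply/eqP/Lfun; have := LB _ _ _ _ h h'; rewrite subrr.
have LT x y : L x y -> T x = y.
  by move=> Lxy; apply: (Luniq x) => //; apply: TP; exists y.
pose f i x y := lform i x (T x) y (T y).
have [||a0 [la [comb nd]]] := schur_forms (f := f) stD nzD prD _ _ 4.
- move=> i b x x' y Dx Dx' Dy.
  have -> : f i (b *: x + x') y = lform i (b *: x + x') (b *: T x + T x') y (T y).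
    by rewrite /f (LT (b *: x + x') (b *: T x + T x')) //; apply: Llin; exact: TP.
  by rewrite /f /lform; case: i => [|[|[|i]]]; rewrite pen_linl.
- move=> g gi i x y Dx Dy.
  have Tg u : D u -> T (g u) = g (T u) by move=> Du; apply: LT; apply: Lg => //; exact: TP.
  by rewrite /f !Tg // /lform; case: i => [|[|[|i]]]; rewrite (pen_iso _ gi).
exists (fun i : 'I_4 => a0 i), (fun i j : 'I_4 => la i j); split.
- exact: rad1.
- move=> v; have [x Dx [y Lyx]] := DRV v.
  by exists x, (T x), y, (v - x); split=> //; [exact: TP | rewrite addrC subrK].
- move=> x tx y ty Lx Ly E.
  have xE : x = - ty by apply/eqP; rewrite -addr_eq0 E.
  have x0' : x = 0.
    apply: DR0; first by exists tx.
    by rewrite xE; apply: subspN; [case: stR | exists y].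
  by split=> //; apply: Linj; move: E; rewrite x0' add0r => <-.
- move=> j x tx y ty Lx Ly.
  have := comb j x y (ltn_ord j); rewrite /f (LT _ _ Lx) (LT _ _ Ly) => -> //.
  + by rewrite [RHS]big_mkcond.
  + by exists tx.
  + by exists ty.
- move=> u tu Lu E i ai; pose u' j := if insub j is Some i then u i else 0.
  have uE (j : 'I_4) : u' j = u j by rewrite /u' valK.
  rewrite -uE; apply: (nd u') => // [j|y Dy].
    rewrite /u'; case: insubP => [i' _ _|_]; first by exists (tu i'); exact: Lu.
    by case: stD => -[].
  rewrite -[RHS](E y (T y) (TP y Dy)) [RHS]big_mkcond; apply: eq_bigr => j _.
  by rewrite uE /f (LT _ _ (Lu j)).
Qed.

End Classification.

Lemma classification (k : closedFieldType) (V : biquadratic k) :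
  ~ countable [set: k] -> universal V -> has_length (aut_rep V) 2 ->
  [\/ cond_rad V, kernel_type V | exists a la, cond_double a la V].
Proof.
move=> kc uV /has_length_twoP[two ex].
have ortho := universal_orthonormal uV.
have [nzR|/not_nontrivial R0] := pselect (nontrivial (@radical k V)).
  by apply: Or31; exact: radical_case.
have [cr|ncr] := pselect (cond_rad V); first exact: Or31.
have [[e [e' [ee' nzK]]]|nK] := pselect (exists e e', pdet e e' != 0 /\ nontrivial (@kernel k e e' V)).
  by apply: Or32; exact: kernel_case ee' nzK.
apply: Or33; apply: double_case => // e x en0 Kx; apply: contrapT => x0; apply: nK.
have [e1_0|e1_0] := eqVneq e.1 0; last first.
  by exists e, e1; split; [rewrite /pdet /= mulr1 mulr0 subr0 | exists x].
exists e, e0; split; last by exists x.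
rewrite /pdet /= mulr0 mulr1 sub0r oppr_eq0.
by apply: contraNneq en0 => e2_0; rewrite [e]surjective_pairing e1_0 e2_0.
Qed.

(** * Transfer of first-order properties *)

Scheme sterm_mind := Induction for sterm Sort Prop
  with vterm_mind := Induction for vterm Sort Prop.
Combined Scheme terms_mind from sterm_mind, vterm_mind.

Section Transfer.
Variable k : fieldType.

Lemma fv_terms_bounded :
  (forall t : sterm k, exists n, forall s x, (n <= x)%N -> ~~ fv_sterm s x t) /\
  (forall t : vterm k, exists n, forall s x, (n <= x)%N -> ~~ fv_vterm s x t).
Proof.
have join (A B : bool -> nat -> bool) :
    (exists n, forall s x, (n <= x)%N -> ~~ A s x) ->
    (exists n, forall s x, (n <= x)%N -> ~~ B s x) ->
    exists n, forall s x, (n <= x)%N -> ~~ (A s x || B s x).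
  move=> [n nA] [n' nB]; exists (maxn n n') => s x; rewrite geq_max => /andP[h h'].
  by rewrite negb_or nA // nB.
apply: terms_mind => /=; try by move=> *; exact: join.
- by move=> n; exists n.+1 => s x nx; rewrite (gtn_eqF nx) andbF.
- by move=> _; exists 0%N.
- by move=> n; exists n.+1 => s x nx; rewrite (gtn_eqF nx) andbF.
- by exists 0%N.
Qed.

Lemma fv_formula_bounded (p : formula k) :
  exists n, forall s x, (n <= x)%N -> ~~ fv_formula s x p.
Proof.
have join (A B : bool -> nat -> bool) :
    (exists n, forall s x, (n <= x)%N -> ~~ A s x) ->
    (exists n, forall s x, (n <= x)%N -> ~~ B s x) ->
    exists n, forall s x, (n <= x)%N -> ~~ (A s x || B s x).
  move=> [n nA] [n' nB]; exists (maxn n n') => s x; rewrite geq_max => /andP[h h'].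
  by rewrite negb_or nA // nB.
have [bs bv] := fv_terms_bounded.
have quant (A B : bool -> nat -> bool) :
    (exists n, forall s x, (n <= x)%N -> ~~ A s x) ->
    exists n, forall s x, (n <= x)%N -> ~~ (B s x && A s x).
  by move=> [n nA]; exists n => s x nx; rewrite negb_and nA // orbT.
elim: p => /=.
- by move=> t t'; apply: join; exact: bs.
- by move=> t t'; apply: join; exact: bv.
- by exists 0%N.
- by [].
- by move=> *; exact: join.
- by move=> *; exact: join.
- by move=> *; exact: join.
- by move=> n p; apply: (quant (fun s x => fv_formula s x p)).
- by move=> n p; apply: (quant (fun s x => fv_formula s x p)).
- by move=> n p; apply: (quant (fun s x => fv_formula s x p)).
- by move=> n p; apply: (quant (fun s x => fv_formula s x p)).
Qed.

(** A formula holds under all assignments if and only if its universal closure does.  This spares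
    the verification that the formulas used below are sentences. *)
Fixpoint univ_closure n (p : formula k) : formula k :=
  if n is n'.+1 then FSForall n' (FVForall n' (univ_closure n' p)) else p.

Lemma fv_univ_closure n p s x :
  fv_formula s x (univ_closure n p) = (n <= x)%N && fv_formula s x p.
Proof.
elim: n => //= n ->; rewrite !andbA; congr (_ && _).
by case: (ltngtP x n); case: s.
Qed.

Lemma holds_univ_closure (V : biquadratic k) n p :
  (forall es (ev : nat -> V), holds es ev (univ_closure n p)) <->
  (forall es (ev : nat -> V), holds es ev p).
Proof.
have idem (T : Type) (f : nat -> T) (x : nat) : ([eta f with x |-> f x] : nat -> T) = f.
  by apply/funext => y /=; case: eqP => // ->.
elim: n => //= n IH; split=> H es ev; last first.
  by move=> a v; move: (IH.2 H); exact.
apply: (IH.1 _ es ev) => {}es {}ev.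
by have := H es ev (es n) (ev n); rewrite !idem.
Qed.

Lemma Th_holds (V W : biquadratic k) p : Th W = Th V ->
  (forall es (ev : nat -> V), holds es ev p) -> forall es (ev : nat -> W), holds es ev p.
Proof.
move=> E Vp; have [n np] := fv_formula_bounded p.
apply: (holds_univ_closure W n p).1.
have : Th V (univ_closure n p).
  split; last exact/holds_univ_closure.
  by move=> s x; rewrite fv_univ_closure; case: leqP => //= /np.
by rewrite -E => -[].
Qed.

Definition first_order (Phi : biquadratic k -> Prop) : Prop :=
  exists p, forall (V : biquadratic k) es ev, @holds k V es ev p <-> Phi V.

Lemma first_order_transfer Phi (V W : biquadratic k) : first_order Phi ->
  Th W = Th V -> Phi V -> Phi W.
Proof.
move=> [p pP] E PV; apply: (pP W (fun=> 0) (fun=> 0)).1.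
by apply: Th_holds E _ _ _ => es ev; exact/pP.
Qed.

Lemma first_order_and Phi Psi : first_order Phi -> first_order Psi ->
  first_order (fun V => Phi V /\ Psi V).
Proof.
move=> [p pP] [q qP]; exists (FAnd p q) => V es ev /=.
by rewrite pP qP.
Qed.

Lemma first_order_iff Phi Psi : (forall V, Phi V <-> Psi V) ->
  first_order Phi -> first_order Psi.
Proof. by move=> E [p pP]; exists p => V es ev; rewrite pP E. Qed.

Definition ttrue : formula k := FNot (FFalse k).

Definition tall (A : Type) (r : seq A) (f : A -> formula k) : formula k :=
  foldr (fun a p => FAnd (f a) p) ttrue r.

Lemma holds_tall (A : eqType) (r : seq A) f (V : biquadratic k) es ev :
  @holds k V es ev (tall r f) <-> forall a, a \in r -> holds es ev (f a).
Proof.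
elim: r => [|a r IH] /=; first by split=> // _; case.
split=> [[fa /IH fr] b|H].
  by rewrite inE => /predU1P[->|/fr].
split; first by apply: H; rewrite mem_head.
by apply/IH => b br; apply: H; rewrite inE br orbT.
Qed.

Fixpoint exv n p : formula k := if n is m.+1 then exv m (FVExists m p) else p.
Fixpoint allv n p : formula k := if n is m.+1 then allv m (FVForall m p) else p.
Fixpoint exs n p : formula k := if n is m.+1 then exs m (FSExists m p) else p.
Fixpoint alls n p : formula k := if n is m.+1 then alls m (FSForall m p) else p.

(** The assignment after n nested quantifiers over the variables 0, ..., n - 1. *)
Definition mix (T : Type) n (x e : nat -> T) i := if (i < n)%N then x i else e i.

Lemma mix_rcons (T : Type) n (x e : nat -> T) v :
  ([eta mix n x e with n |-> v] : nat -> T) = mix n.+1 [eta x with n |-> v] e.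
Proof.
apply/funext => i; rewrite /mix /= ltnS [(i <= n)%N]leq_eqVlt.
by case: (i == n).
Qed.

Lemma mixS (T : Type) n (x e : nat -> T) :
  mix n.+1 x e = [eta mix n x e with n |-> x n].
Proof.
apply/funext => i; rewrite /mix /= ltnS [(i <= n)%N]leq_eqVlt.
by case: (eqVneq i n) => [->|_] /=.
Qed.

Lemma mix0 (T : Type) (x e : nat -> T) : mix 0 x e = e.
Proof. by []. Qed.

Section Quantifiers.
Variable V : biquadratic k.

Lemma holds_exv n p es ev : @holds k V es ev (exv n p) <-> exists x, holds es (mix n x ev) p.
Proof.
elim: n p => [|n IH] p /=; first by split=> [h|[x]]; [exists ev | ]; rewrite mix0.
rewrite IH; split=> -[x] /= => [[v]|h].
  by rewrite mix_rcons; exists [eta x with n |-> v].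
by exists x, (x n); rewrite -mixS.
Qed.

Lemma holds_allv n p es ev : @holds k V es ev (allv n p) <-> forall x, holds es (mix n x ev) p.
Proof.
elim: n p => [|n IH] p /=; first by split=> [h x|/(_ ev)]; rewrite mix0.
rewrite IH; split=> [h x|h x v]; last by rewrite mix_rcons; exact: h.
by rewrite mixS; exact: h.
Qed.

Lemma holds_exs n p es ev : @holds k V es ev (exs n p) <-> exists x, holds (mix n x es) ev p.
Proof.
elim: n p => [|n IH] p /=; first by split=> [h|[x]]; [exists es | ]; rewrite mix0.
rewrite IH; split=> -[x] /= => [[v]|h].
  by rewrite mix_rcons; exists [eta x with n |-> v].
by exists x, (x n); rewrite -mixS.
Qed.

Lemma holds_alls n p es ev : @holds k V es ev (alls n p) <-> forall x, holds (mix n x es) ev p.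
Proof.
elim: n p => [|n IH] p /=; first by split=> [h x|/(_ es)]; rewrite mix0.
rewrite IH; split=> [h x|h x v]; last by rewrite mix_rcons; exact: h.
by rewrite mixS; exact: h.
Qed.

End Quantifiers.

Definition tsum (A : Type) (r : seq A) (f : A -> sterm k) : sterm k :=
  foldr (fun a t => SAdd (f a) t) (SConst 0) r.

Definition vcomb n : vterm k :=
  foldr (fun i t => VAdd (VScale (SVar k i) (VVar k i)) t) (VZero k) (iota 0 n).

Lemma seval_tsum (A : Type) (r : seq A) f (V : biquadratic k) es ev :
  @seval k V es ev (tsum r f) = \sum_(a <- r) seval es ev (f a).
Proof. by elim: r => [|a r IH]; rewrite ?big_nil // big_cons -IH. Qed.

Lemma veval_vcomb n (V : biquadratic k) es ev :
  @veval k V es ev (vcomb n) = \sum_(i <- iota 0 n) es i *: ev i.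
Proof. by rewrite /vcomb; elim: (iota 0 n) => [|a r IH]; rewrite ?big_nil // big_cons -IH. Qed.

End Transfer.

(** * The conditions are first order *)

Section FirstOrderConditions.
Variable k : closedFieldType.
Implicit Types (e : k * k).

Let var (x : nat) : vterm k := VVar k x.
Let szero : sterm k := SConst 0.

Definition tpen e (u v : vterm k) : sterm k :=
  SAdd (SMul (SConst e.1) (SOmega u v)) (SMul (SConst e.2) (SOmega' u v)).

(** In the abbreviations below the last arguments are the bound variables. *)
Definition fker e (x z : nat) : formula k := FVForall z (FSEq (tpen e (var x) (var z)) szero).

Definition fperp e e' (x y z : nat) : formula k :=
  FVForall y (FImp (fker e y z) (FSEq (tpen e' (var x) (var y)) szero)).

Definition flinked e e' (x y z : nat) : formula k :=
  FVForall z (FSEq (tpen e (var x) (var z)) (tpen e' (var y) (var z))).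

Definition frad (x z : nat) : formula k :=
  FVForall z (FAnd (FSEq (SOmega (var x) (var z)) szero) (FSEq (SOmega' (var x) (var z)) szero)).

Lemma first_order_rad : first_order (@cond_rad k).
Proof.
exists (FVForall 0 (FVForall 1 (FImp
  (FVForall 2 (FSEq (SAdd (SOmega (var 0) (var 2)) (SOmega' (var 1) (var 2))) szero))
  (FAnd (frad 0 2) (frad 1 2))))).
by move=> V es ev; split=> H; exact: H.
Qed.

Lemma first_order_sum e e' be : first_order (@cond_sum k e e' be).
Proof.
pose c1 (V : biquadratic k) := forall x : V, kernel e e' x ->
  (forall y, kernel e e' y -> pen e' x y = 0) -> x = 0.
pose c2 (V : biquadratic k) := forall v : V, exists s t,
  kernel e e' s /\ (perp e e' t /\ v = s + t).
pose c3 (V : biquadratic k) := forall x y : V, perp e e' x -> perp e e' y ->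
  (forall z, perp e e' z -> pen e x z + pen e' y z = 0) ->
  x = 0 /\ (if be then y = 0 else ~ False).
pose c4 (V : biquadratic k) := if be then ~ False else
  forall x y : V, perp e e' x -> perp e e' y -> pen e' x y = 0.
apply: (@first_order_iff _ (fun V => (c1 V /\ c2 V) /\ (c3 V /\ c4 V))).
  move=> V; split=> [[[h1 h2] [h3 h4]]|[h1 h2 h3 h4]].
    split=> //.
    - by move=> v; have [s [t [Ks [Pt ->]]]] := h2 v; exists s; rewrite // addrC addKr.
    - move=> x y Px Py E; have [-> y0] := h3 x y Px Py E; split=> // b.
      by move: y0; rewrite b.
    - by move=> nbe; move: h4; rewrite /c4 (negbTE nbe).
  split; split=> //.
  - by move=> v; have [s Ks Pt] := h2 v; exists s, (v - s); do 2?split=> //; rewrite [RHS]addrC subrK.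
  - move=> x y Px Py E; have [-> y0] := h3 x y Px Py E; split=> //.
    by case: ifP => [b|_ []]; exact: y0 b.
  - by rewrite /c4; case: ifP => [_ []//|/negbT nbe x y]; exact: h4 nbe x y.
apply: first_order_and; apply: first_order_and.
- exists (FVForall 0 (FImp (fker e 0 9) (FImp (FVForall 1 (FImp (fker e 1 9)
    (FSEq (tpen e' (var 0) (var 1)) szero))) (FVEq (var 0) (VZero k))))).
  by move=> V es ev; split=> H; exact: H.
- exists (FVForall 0 (FVExists 1 (FVExists 2 (FAnd (fker e 1 9) (FAnd (fperp e e' 2 8 9)
    (FVEq (var 0) (VAdd (var 1) (var 2)))))))).
  by move=> V es ev; split=> H; exact: H.
- exists (FVForall 0 (FVForall 1 (FImp (fperp e e' 0 8 9) (FImp (fperp e e' 1 8 9)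
    (FImp (FVForall 2 (FImp (fperp e e' 2 8 9)
      (FSEq (SAdd (tpen e (var 0) (var 2)) (tpen e' (var 1) (var 2))) szero)))
    (FAnd (FVEq (var 0) (VZero k)) (if be then FVEq (var 1) (VZero k) else ttrue k))))))).
  by move=> V es ev; rewrite /c3; case: (be); split=> H; exact: H.
- exists (if be then ttrue k else FVForall 0 (FVForall 1 (FImp (fperp e e' 0 8 9)
    (FImp (fperp e e' 1 8 9) (FSEq (tpen e' (var 0) (var 1)) szero))))).
  by move=> V es ev; rewrite /c4; case: (be); split=> H; exact: H.
Qed.

Lemma first_order_flag e e' ga : first_order (@cond_flag k e e' ga).
Proof.
pose c1 (V : biquadratic k) := if ga then forall x : V, perp e e' x -> x = 0
  else forall x : V, (kernel e e' x -> perp e e' x) /\ (perp e e' x -> kernel e e' x).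
pose c2 (V : biquadratic k) := forall x y : V,
  (forall z, pen e x z + pen e' y z = 0) -> y = 0.
apply: (@first_order_iff _ (fun V => c1 V /\ c2 V)).
  move=> V; rewrite /c1; split=> [[h1 h2]|[h1 h1' h2]].
    by split=> //; move: h1; case: (ga).
  by split=> //; move: h1 h1'; case: (ga) => h1 h1'; [exact: h1 | exact: h1'].
apply: first_order_and.
- exists (if ga then FVForall 0 (FImp (fperp e e' 0 8 9) (FVEq (var 0) (VZero k))) else
    FVForall 0 (FAnd (FImp (fker e 0 9) (fperp e e' 0 8 9)) (FImp (fperp e e' 0 8 9) (fker e 0 9)))).
  by move=> V es ev; rewrite /c1; case: (ga); split=> H; exact: H.
- exists (FVForall 0 (FVForall 1 (FImp (FVForall 2
    (FSEq (SAdd (tpen e (var 0) (var 2)) (tpen e' (var 1) (var 2))) szero))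
    (FVEq (var 1) (VZero k))))).
  by move=> V es ev; split=> H; exact: H.
Qed.

Lemma first_order_nil e e' : first_order (@cond_nil k e e').
Proof.
pose c1 (V : biquadratic k) :=
  forall x : V, (kernel e e' x -> perp e e' x) /\ (perp e e' x -> kernel e e' x).
pose c2 (V : biquadratic k) := forall y : V, (forall z, pen e' y z = 0) -> y = 0.
pose c3 (V : biquadratic k) := forall x : V, exists y, linked e e' x y.
pose c4 (V : biquadratic k) := forall y : V, kernel e e' y -> exists x, linked e e' x y.
apply: (@first_order_iff _ (fun V => (c1 V /\ c2 V) /\ (c3 V /\ c4 V))).
  by move=> V; split=> [[[h1 h2] [h3 h4]]|[h1 h2 h3 h4]]; split=> //; split.
apply: first_order_and; apply: first_order_and.
- exists (FVForall 0 (FAnd (FImp (fker e 0 9) (fperp e e' 0 8 9))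
    (FImp (fperp e e' 0 8 9) (fker e 0 9)))).
  by move=> V es ev; split=> H; exact: H.
- exists (FVForall 0 (FImp (FVForall 1 (FSEq (tpen e' (var 0) (var 1)) szero))
    (FVEq (var 0) (VZero k)))).
  by move=> V es ev; split=> H; exact: H.
- exists (FVForall 0 (FVExists 1 (flinked e e' 0 1 9))).
  by move=> V es ev; split=> H; exact: H.
- exists (FVForall 0 (FImp (fker e 0 9) (FVExists 1 (flinked e e' 1 0 9)))).
  by move=> V es ev; split=> H; exact: H.
Qed.

Definition tlform (i x tx y ty : nat) : sterm k :=
  match i with
  | 0%N => tpen e1 (var x) (var y) | 1%N => tpen e0 (var x) (var y)
  | 2%N => tpen e0 (var x) (var ty) | _ => tpen e0 (var tx) (var ty) end.

Lemma seval_tlform (V : biquadratic k) es (ev : nat -> V) (i x tx y ty : nat) :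
  seval es ev (tlform i x tx y ty) = lform i (ev x) (ev tx) (ev y) (ev ty).
Proof. by case: i => [|[|[|i]]]. Qed.

Lemma holds_fker e e' (x z : nat) (V : biquadratic k) es (ev : nat -> V) :
  x != z -> holds es ev (fker e x z) <-> kernel e e' (ev x).
Proof.
move=> xz; split=> H v; first by have := H v; rewrite /= (negbTE xz) eqxx.
by rewrite /= (negbTE xz) eqxx; exact: H.
Qed.

Lemma holds_frad (x z : nat) (V : biquadratic k) es (ev : nat -> V) :
  x != z -> holds es ev (frad x z) <-> radical (ev x).
Proof.
move=> xz; split=> H v; first by have := H v; rewrite /= (negbTE xz) eqxx.
by rewrite /= (negbTE xz) eqxx; exact: H.
Qed.

Lemma holds_flinked e e' (x y z : nat) (V : biquadratic k) es (ev : nat -> V) :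
  x != z -> y != z -> holds es ev (flinked e e' x y z) <-> linked e e' (ev x) (ev y).
Proof.
move=> xz yz; split=> H v; first by have := H v; rewrite /= (negbTE xz) (negbTE yz) eqxx.
by rewrite /= (negbTE xz) (negbTE yz) eqxx; exact: H.
Qed.

Lemma first_order_double a la : first_order (@cond_double k a la).
Proof.
pose A := [seq i <- index_enum 'I_4 | a i].
pose c1 (V : biquadratic k) := forall y : V, (forall z, pen e1 y z = 0) -> y = 0.
pose c2 (V : biquadratic k) := forall v : V, exists x tx y ty,
  linked e0 e1 x tx /\ (linked e0 e1 y ty /\ v = x + ty).
pose c3 (V : biquadratic k) := forall x tx y ty : V, linked e0 e1 x tx ->
  linked e0 e1 y ty -> x + ty = 0 -> x = 0 /\ y = 0.
pose c4 (V : biquadratic k) := forall (j : 'I_4) (x tx y ty : V), linked e0 e1 x tx ->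
  linked e0 e1 y ty -> lform j x tx y ty = \sum_(i | a i) la j i * lform i x tx y ty.
pose c5 (V : biquadratic k) := forall u tu : 'I_4 -> V, (forall i, linked e0 e1 (u i) (tu i)) ->
  (forall y ty, linked e0 e1 y ty -> \sum_(i | a i) lform i (u i) (tu i) y ty = 0) ->
  forall i, a i -> u i = 0.
apply: (@first_order_iff _ (fun V => (c1 V /\ c2 V) /\ (c3 V /\ (c4 V /\ c5 V)))).
  move=> V; split=> [[[h1 h2] [h3 [h4 h5]]]|[h1 h2 h3 h4 h5]].
    split=> // v; have [x [tx [y [ty [L [L' ->]]]]]] := h2 v.
    by exists x, tx, y, ty.
  split; last by split.
  split=> // v; have [x [tx [y [ty [L L' ->]]]]] := h2 v.
  by exists x, tx, y, ty.
do 3?[apply: first_order_and].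
- exists (FVForall 0 (FImp (FVForall 1 (FSEq (tpen e1 (var 0) (var 1)) szero))
    (FVEq (var 0) (VZero k)))).
  by move=> V es ev; split=> H; exact: H.
- exists (FVForall 0 (FVExists 1 (FVExists 2 (FVExists 3 (FVExists 4
    (FAnd (flinked e0 e1 1 2 9) (FAnd (flinked e0 e1 3 4 9)
    (FVEq (var 0) (VAdd (var 1) (var 4)))))))))).
  by move=> V es ev; split=> H; exact: H.
- exists (FVForall 1 (FVForall 2 (FVForall 3 (FVForall 4
    (FImp (flinked e0 e1 1 2 9) (FImp (flinked e0 e1 3 4 9)
    (FImp (FVEq (VAdd (var 1) (var 4)) (VZero k))
    (FAnd (FVEq (var 1) (VZero k)) (FVEq (var 3) (VZero k)))))))))).
  by move=> V es ev; split=> H; exact: H.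
- pose cj (j : 'I_4) := FSEq (tlform j 1 2 3 4)
    (tsum A (fun i : 'I_4 => SMul (SConst (la j i)) (tlform i 1 2 3 4))).
  pose fj (j : 'I_4) := FVForall 1 (FVForall 2 (FVForall 3 (FVForall 4
    (FImp (flinked e0 e1 1 2 9) (FImp (flinked e0 e1 3 4 9) (cj j)))))).
  exists (tall (index_enum 'I_4) fj) => V es ev; rewrite holds_tall.
  split=> [H j x tx y ty L L'|H j _ /= x tx y ty L L'].
    have := H j (mem_index_enum j) x tx y ty L L'.
    rewrite /= seval_tsum seval_tlform big_filter => -> /=.
    by apply: eq_bigr => i _; rewrite /= seval_tlform.
  rewrite seval_tsum seval_tlform big_filter (H j x tx y ty L L').
  by apply: eq_bigr => i _; rewrite /= seval_tlform.
- pose hyp := tall (index_enum 'I_4) (fun i : 'I_4 => flinked e0 e1 i (4 + i) 10).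
  pose rel := FVForall 8 (FVForall 9 (FImp (flinked e0 e1 8 9 10)
    (FSEq (tsum A (fun i : 'I_4 => tlform i i (4 + i) 8 9)) szero))).
  exists (allv 8 (FImp hyp (FImp rel (tall A (fun i : 'I_4 => FVEq (var i) (VZero k)))))).
  move=> V es ev; rewrite holds_allv.
  have lt8 (j : 'I_4) : (j < 8)%N by rewrite (leq_trans (ltn_ord j)).
  have lt8' (j : 'I_4) : (4 + j < 8)%N by rewrite (leq_trans (n := 4 + 4)) ?ltn_add2l.
  have env (f : nat -> V) v w n : (n < 8)%N ->
      [eta [eta f with 8 |-> v] with 9 |-> w] n = f n.
    move=> n8 /=; rewrite (ltn_eqF n8) (ltn_eqF (leq_trans n8 _)) //.
  have LE (f : nat -> V) (j : 'I_4) :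
      holds es f (flinked e0 e1 j (4 + j) 10) <-> linked e0 e1 (f j) (f (4 + j)%N).
    by apply: holds_flinked; rewrite ltn_eqF // ?(leq_trans (lt8 j)) ?(leq_trans (lt8' j)).
  have SE (f : nat -> V) v w : seval es [eta [eta f with 8 |-> v] with 9 |-> w]
      (tsum A (fun i : 'I_4 => tlform i i (4 + i) 8 9)) =
      \sum_(i | a i) lform i (f i) (f (4 + i)%N) v w.
    rewrite seval_tsum big_filter; apply: eq_bigr => i _.
    by rewrite seval_tlform (env _ _ _ _ (lt8 i)) (env _ _ _ _ (lt8' i)).
  split=> [H u tu Lu E i ai|H x].
    pose x n := if insub n is Some i then u i else if insub (n - 4)%N is Some i then tu i else 0.
    have xu (j : 'I_4) : mix 8 x ev j = u j by rewrite /mix lt8 /x valK.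
    have xtu (j : 'I_4) : mix 8 x ev (4 + j)%N = tu j.
      by rewrite /mix lt8' /x insubF ?addKn ?valK // -ltn_subRL ltn0.
    have [Hh Hr] : holds es (mix 8 x ev) hyp /\ holds es (mix 8 x ev) rel.
      split; first by apply/holds_tall => j _; apply/LE; rewrite xu xtu.
      move=> y ty L; transitivity (\sum_(i | a i)
        lform i (mix 8 x ev i) (mix 8 x ev (4 + i)%N) y ty); first exact: SE.
      rewrite -[RHS](E y ty L); apply: eq_bigr => j _.
      by rewrite xu xtu.
    have /holds_tall/(_ i) := H x Hh Hr; rewrite mem_filter ai mem_index_enum /= xu.
    by apply.
  move=> Hh Hr; apply/holds_tall => i; rewrite mem_filter => /andP[ai _].
  pose x' := mix 8 x ev.
  apply: (H (fun j : 'I_4 => x' j) (fun j : 'I_4 => x' (4 + j)%N)) ai => [j|y ty L].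
    by apply/LE; move/holds_tall: Hh; apply; exact: mem_index_enum.
  by rewrite -(SE x' y ty); exact: Hr y ty L.
Qed.

End FirstOrderConditions.

(** * Dimension, and conclusion *)

Section Dimension.
Variables (k : closedFieldType) (A : forall V : biquadratic k, set V).

Definition freely (V : lmodType k) n (x : nat -> V) : Prop :=
  forall c : nat -> k, \sum_(i <- iota 0 n) c i *: x i = 0 -> forall i, (i < n)%N -> c i = 0.

Definition has_free n (V : biquadratic k) : Prop :=
  exists x : nat -> V, (forall i, (i < n)%N -> A (x i)) /\ freely n x.

(** The scalars are constants of the language, so that one sentence fixes the isometry type of
    a finite dimensional A. *)
Definition has_gram_basis (e e' : k * k) n (G : bool -> nat -> nat -> k) (V : biquadratic k) : Prop :=
  exists x : nat -> V, [/\ forall i, (i < n)%N -> A (x i), freely n x,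
    forall y : V, A y -> exists c : nat -> k, y = \sum_(i <- iota 0 n) c i *: x i &
    forall b i j, (i < n)%N -> (j < n)%N -> form2 e e' b (x i) (x j) = G b i j].

Lemma free_or_basis (e e' : k * k) (V : biquadratic k) :
  (forall n, has_free n V) \/ exists n G, has_gram_basis e e' n G V.
Proof.
case: (pselect (exists n G, has_gram_basis e e' n G V)) => nb; [by right | left].
elim=> [|n [x [Ax fx]]]; first by exists (fun=> 0); split.
have [y Ay ny] : exists2 y : V, A y & forall c : nat -> k, y <> \sum_(i <- iota 0 n) c i *: x i.
  apply: contrapT => h; apply: nb; exists n, (fun b i j => form2 e e' b (x i) (x j)), x.
  split=> // y Ay; apply: contrapT => nc; apply: h; exists y => // c yE.
  by apply: nc; exists c.
exists (fun i => if i == n then y else x i); split=> [i|c].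
  by rewrite ltnS leq_eqVlt; case: eqP => //= _; exact: Ax.
have sE : \sum_(i <- iota 0 n) c i *: (if i == n then y else x i) =
    \sum_(i <- iota 0 n) c i *: x i.
  by apply: eq_big_seq => i; rewrite mem_iota => ni; rewrite (ltn_eqF ni).
rewrite -addn1 iotaD add0n big_cat big_seq1 sE eqxx /= => E.
have cn : c n = 0.
  apply: contrapT => /eqP cn; apply: (ny (fun i => - (c n)^-1 * c i)).
  under eq_bigr do rewrite -scalerA.
  move/eqP: E; rewrite addr_eq0 => /eqP E.
  by rewrite -scaler_sumr E scaleNr scalerN opprK scalerA mulVf // scale1r.
move=> i; rewrite addn1 ltnS leq_eqVlt => /predU1P[->//|].
by apply: fx; move: E; rewrite cn scale0r addr0.
Qed.

Lemma has_free_infmod (V : biquadratic k) : (forall n, has_free n V) ->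
  infmod (@A V) [set 0].
Proof.
move=> h r; have [x [Ax fx]] := h (size r).+1.
apply: contrapT => nw.
have xr (i : 'I_(size r).+1) : lspan r (x i).
  apply: contrapT => xr; apply: nw; exists (x i); first exact: Ax.
  by move=> _ ->; rewrite subr0.
have [c [i ci] cE] := lspan_dep (ltnSn _) xr; case/eqP: ci.
have := fx (fun j => c (inord j)) _ i (ltn_ord i); rewrite inord_val; apply.
rewrite -[X in iota 0 X]subn0 -/(index_iota 0 (size r).+1) big_mkord -[RHS]cE.
by apply: eq_bigr => j _; rewrite inord_val.
Qed.

Variable fA : nat -> formula k.
Hypothesis fAP : forall (V : biquadratic k) es ev x, @holds k V es ev (fA x) <-> A (ev x).

Definition tfree n : formula k :=
  alls n (FImp (FVEq (vcomb k n) (VZero k)) (tall (iota 0 n) (fun i => FSEq (SVar k i) (SConst 0)))).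

Lemma mix_lt (T : Type) n (x e : nat -> T) i : (i < n)%N -> mix n x e i = x i.
Proof. by rewrite /mix => ->. Qed.

Lemma veval_mix (V : biquadratic k) n c x es (ev : nat -> V) :
  (forall i, (i < n)%N -> ev i = x i) ->
  veval (mix n c es) ev (vcomb k n) = \sum_(i <- iota 0 n) c i *: x i.
Proof.
move=> evx; rewrite veval_vcomb; apply: eq_big_seq => i; rewrite mem_iota => ni.
by rewrite mix_lt // evx.
Qed.

Lemma holds_tfree (V : biquadratic k) n x es ev :
  @holds k V es (mix n x ev) (tfree n) <-> freely n x.
Proof.
have xE i : (i < n)%N -> mix n x ev i = x i by exact: mix_lt.
rewrite holds_alls; split=> H c.
  move=> c0 i ni; have := H c; rewrite /= (veval_mix _ _ xE) => /(_ c0)/holds_tall/(_ i).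
  by rewrite mem_iota /= mix_lt //; apply.
rewrite /= (veval_mix _ _ xE) => /H c0; apply/holds_tall => i; rewrite mem_iota => ni /=.
by rewrite mix_lt // c0.
Qed.

Lemma first_order_free n : first_order (has_free n).
Proof.
exists (exv n (FAnd (tall (iota 0 n) fA) (tfree n))) => V es ev.
rewrite holds_exv; split=> -[x] [h1 h2]; exists x; split.
- by move=> i ni; move/holds_tall/(_ i): h1; rewrite mem_iota fAP mix_lt //; apply.
- by move/holds_tfree: h2.
- by apply/holds_tall => i; rewrite mem_iota fAP => ni; rewrite mix_lt //; exact: h1.
- exact/holds_tfree.
Qed.

Lemma first_order_gram_basis e e' n G : first_order (has_gram_basis e e' n G).
Proof.
pose tspan := FVForall n (FImp (fA n) (exs n (FVEq (VVar k n) (vcomb k n)))).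
pose tgram := tall (index_enum bool) (fun b => tall (iota 0 n) (fun i => tall (iota 0 n)
  (fun j => FSEq (tpen (if b then e' else e) (VVar k i) (VVar k j)) (SConst (G b i j))))).
exists (exv n (FAnd (FAnd (tall (iota 0 n) fA) (tfree n)) (FAnd tspan tgram))) => V es ev.
rewrite holds_exv; split=> [[x] [[h1 h2] [h3 h4]]|[x [h1 h2 h3 h4]]]; exists x.
  split.
  - by move=> i ni; move/holds_tall/(_ i): h1; rewrite mem_iota fAP mix_lt //; apply.
  - by move/holds_tfree: h2.
  - move=> y Ay; have /holds_exs[c /=] : holds es [eta mix n x ev with n |-> y]
        (exs n (FVEq (VVar k n) (vcomb k n))).
      by apply: (h3 y); apply/fAP; rewrite /= eqxx.
    rewrite eqxx (@veval_mix _ _ _ x) => [->|i ni]; first by exists c.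
    by rewrite /= (ltn_eqF ni) mix_lt.
  - move=> b i j ni nj; move/holds_tall/(_ b): h4.
    rewrite mem_index_enum => /(_ isT)/holds_tall/(_ i); rewrite mem_iota => /(_ ni)/holds_tall/(_ j).
    by rewrite mem_iota => /(_ nj) /=; rewrite !mix_lt.
split; split.
- by apply/holds_tall => i; rewrite mem_iota fAP => ni; rewrite mix_lt //; exact: h1.
- exact/holds_tfree.
- move=> y /fAP; rewrite /= eqxx => /h3[c yE]; apply/holds_exs; exists c => /=.
  rewrite eqxx (@veval_mix _ _ _ x) => [//|i ni].
  by rewrite /= (ltn_eqF ni) mix_lt.
- apply/holds_tall => b _; apply/holds_tall => i; rewrite mem_iota => ni.
  apply/holds_tall => j; rewrite mem_iota => nj /=.
  by rewrite !mix_lt //; exact: h4.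
Qed.

(** The hypothesis on W holds when A is definable and the orthogonal decomposition follows from
    first-order conditions; the dimension of A is then the only other invariant. *)
Lemma orthogonal_sum_conclusion e e' al be (V : biquadratic k) :
  pdet e e' != 0 -> 2%:R != 0 :> k ->
  (forall W : biquadratic k, Th W = Th V ->
    exists B, orthogonal_sum e e' al be (@A W) B) ->
  linearly_oligomorphic (aut_rep V) /\ linearly_omega_categorical V.
Proof.
move=> ee' two_neq0 model; have [B osV] := model V erefl.
have [free|[n [G gb]]] := free_or_basis e e' V.
  have infV := has_free_infmod free; split; first exact: orthogonal_sum_oligo osV infV.
  move=> W E; have [B' osW] := model W E; apply: orthogonal_sum_iso osW _ osV infV => //.
  apply: has_free_infmod => n.
  exact: first_order_transfer (first_order_free n) E (free n).
have span (U : biquadratic k) (C : set U) x : orthogonal_sum e e' al be (@A U) C ->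
    (forall i, (i < n)%N -> A (x i)) ->
    (forall y : U, A y -> exists c : nat -> k, y = \sum_(i <- iota 0 n) c i *: x i) ->
    @A U = lspan (map x (iota 0 n)).
  move=> os Ax sx; apply/seteqP; split=> y.
    by move=> /sx[c ->]; apply/(lspan_mapP _ _ (iota_uniq _ _)); exists c.
  apply: lspan_min; first exact: os_A os.
  by move=> _ /mapP[i + ->]; rewrite mem_iota; exact: Ax.
split.
  have [x [Ax _ sx _]] := gb.
  exact: finite_sum_oligo osV (span _ _ _ osV Ax sx).
move=> W E; have [B' osW] := model W E.
have [x [Ax fx sx gx]] := gb.
have [x' [Ax' fx' sx' gx']] := first_order_transfer (first_order_gram_basis e e' n G) E gb.
pose DD := [seq (x' i, x i) | i <- iota 0 n].
have [|||||f fi _] := @finite_sum_iso k e e' ee' two_neq0 al be W V _ _ _ _ DD osW osV _ _ _ _ 0 (fun=> tt) (fun=> 0) (fun=> 0).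
- by rewrite -map_comp; exact: span osW Ax' sx'.
- by rewrite -map_comp; exact: span osV Ax sx.
- move=> p q b /mapP[i + ->] /mapP[j + ->]; rewrite !mem_iota => ni nj /=.
  by rewrite gx' // gx.
- move=> v w /(lspan_mapP _ _ (iota_uniq _ _))[c]; rewrite pair_lcomb => -[-> ->].
  split=> [/fx' c0|/fx c0]; rewrite big_seq big1 // => i; rewrite mem_iota => ni;
    by rewrite c0 ?scale0r.
- by split.
by exists f.
Qed.

End Dimension.

Lemma char0_two_neq0 (k : fieldType) : [pchar k] =i pred0 -> 2%:R != 0 :> k.
Proof. by move=> /(_ 2%N); rewrite !inE /= => /negbT. Qed.

Lemma first_order_orthonormal (k : closedFieldType) n (a a' : k) :
  first_order (fun V : biquadratic k => exists x : 'I_n -> V, forall i j,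
    bq_omega V (x i) (x j) = a * (i == j)%:R /\ bq_omega' V (x i) (x j) = a' * (i == j)%:R).
Proof.
exists (exv n (tall (enum 'I_n) (fun i => tall (enum 'I_n) (fun j =>
  FAnd (FSEq (SOmega (VVar k i) (VVar k j)) (SConst (a * (i == j)%:R)))
       (FSEq (SOmega' (VVar k i) (VVar k j)) (SConst (a' * (i == j)%:R))))))) => V es ev.
rewrite holds_exv; split=> [[x /holds_tall H]|[x H]].
  exists (fun i => x i) => i j; have /holds_tall/(_ j) := H i (mem_enum _ _).
  by rewrite mem_enum /= !mix_lt // => /(_ isT).
exists (fun n => if insub n is Some i then x i else 0).
apply/holds_tall => i _; apply/holds_tall => j _ /=.
by rewrite !mix_lt // !valK; exact: H.
Qed.

Lemma has_orthonormal_transfer (k : closedFieldType) (V W : biquadratic k) :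
  Th W = Th V -> has_orthonormal V -> has_orthonormal W.
Proof.
move=> E oV n a a'.
exact: first_order_transfer (first_order_orthonormal n a a') E (oV n a a').
Qed.

Theorem theorem1p2 (k : closedFieldType) (V : biquadratic k) :
  ~ countable [set: k]%classic -> [pchar k]%R =i pred0 ->
  universal V -> has_length (aut_rep V) 2 ->
  linearly_oligomorphic (aut_rep V) /\ linearly_omega_categorical V.
Proof.
move=> kc /char0_two_neq0 two_neq0 uV len2.
have oV := universal_orthonormal uV.
have tr Phi W : first_order Phi -> Th W = Th V -> Phi V -> Phi W.
  exact: first_order_transfer.
have kerP e e' (U : biquadratic k) es (ev : nat -> U) x :
    holds es ev (fker e x x.+1) <-> kernel e e' (ev x).
  by apply: holds_fker; rewrite ltn_eqF.
have radP (U : biquadratic k) es (ev : nat -> U) x :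
    holds es ev (frad k x x.+1) <-> radical (ev x).
  by apply: holds_frad; rewrite ltn_eqF.
case: (classification kc uV len2) => [cr|[e [e' [ee' types]]]|[a [la cd]]].
- apply: (orthogonal_sum_conclusion (A := @radical k) radP (pdet01 k) two_neq0).
  move=> W E; apply: cond_rad_model; first exact: has_orthonormal_transfer E oV.
  exact: tr (first_order_rad k) E cr.
- case: types => [[be cs]|[ga cf]|cn].
  + apply: (orthogonal_sum_conclusion (A := @kernel k e e') (kerP e e') ee' two_neq0).
    move=> W E; eexists; apply: cond_sum_model => //.
      exact: has_orthonormal_transfer E oV.
    exact: tr (first_order_sum e e' be) E cs.
  + have mV := cond_flag_model oV ee' cf; split; first exact: flag_oligo mV.
    move=> W E; apply: (flag_iso ee' two_neq0 _ mV); apply: cond_flag_model => //.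
      exact: has_orthonormal_transfer E oV.
    exact: tr (first_order_flag e e' ga) E cf.
  + have [T mV] := cond_nil_model oV ee' cn; split; first exact: nil_oligo mV.
    move=> W E; have oW := has_orthonormal_transfer E oV.
    have [T' mW] := cond_nil_model oW ee' (tr _ _ (first_order_nil e e') E cn).
    exact: nil_iso mW mV.
- have [S [T mV]] := cond_double_model oV cd.
  split; first by apply: (double_oligo _ _ mV) => //; exact: pdet01.
  move=> W E; have oW := has_orthonormal_transfer E oV.
  have [S' [T' mW]] := cond_double_model oW (tr _ _ (first_order_double a la) E cd).
  by apply: (double_iso _ _ mW mV) => //; exact: pdet01.
Qed.
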